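(* Let $(A,\sigma)$ be an $F$-algebra with involution. There exists a finite set $H=\{h_1,\dots,h_s\}$ of diagonal hermitian forms of dimension one over $(A,\sigma)$ such that for every $P\in X_F\setminus\mathrm{Nil}[A,\sigma]$, every real closure $\iota:F\to F_P$ of $F$ at $P$ and every Morita equivalence $\mathscr{M}:\mathscr{H}(A\otimes_F F_P,\sigma\otimes\mathrm{id})\to\mathscr{H}_{\varepsilon_P}(D_P,\vartheta_P)$ there exists $h\in H$ such that $\mathrm{sign}_\iota^{\mathscr{M}}h\ne0$.
   Context: **Algebras with involution and forms.** $F$ is a formally real field and $X_F$ is its space of orderings. An $F$-algebra with involution is a pair $(A,\sigma)$ with $A$ a finite-dimensional $F$-algebra and $\sigma:A\to A$ an $F$-linear map with $\sigma(xy)=\sigma(y)\sigma(x)$, $\sigma^2=\mathrm{id}$, such that either ($\sigma$ of the first kind) $A$ is simple with centre $F$, or ($\sigma$ of the second kind, or unitary) $A$ is simple with centre a quadratic field extension $F(\sqrt d)$ of $F$ on which $\sigma$ acts nontrivially. If $\sigma$ is of the first kind and $\dim_F A=m^2$, then $\sigma$ is orthogonal (resp. symplectic) if $\{a\in A:\sigma(a)=a\}$ has $F$-dimension $m(m+1)/2$ (resp. $m(m-1)/2$). For $\varepsilon\in\{-1,1\}$, an $\varepsilon$-hermitian form over a ring with involution $(A,\sigma)$ is a finitely generated right module $M$ (always projective here) with a biadditive $h:M\times M\to A$ such that $h(xa,yb)=\sigma(a)h(x,y)b$ and $h(y,x)=\varepsilon\sigma(h(x,y))$; hermitian means $\varepsilon=1$.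 All forms are assumed nonsingular. A diagonal hermitian form of dimension one is $\langle a\rangle_\sigma:A\times A\to A$, $(x,y)\mapsto\sigma(x)ay$, with $a\in A^\times$, $\sigma(a)=a$. $\mathscr{H}_\varepsilon(A,\sigma)$ is the category of nonsingular $\varepsilon$-hermitian forms with isometries as morphisms, $W_\varepsilon(A,\sigma)$ the Witt group; the subscript is dropped when $\varepsilon=1$. **Signatures, real closed case.** Let $R$ be real closed. For a symmetric bilinear form over $R$, a hermitian form over $(R(\sqrt{-1}),-)$ (conjugation), or a hermitian form over $((-1,-1)_R,-)$ (quaternion conjugation), diagonalize as $\langle\alpha_1,\dots,\alpha_n\rangle$ with $\alpha_i\in\{-1,1\}$ and put $\mathrm{sign}=\sum\alpha_i$. For skew-symmetric forms over $R$, hermitian forms over $(R\times R,\text{exchange involution }(x,y)\mapsto(y,x))$ and skew-hermitian forms over $((-1,-1)_R,-)$, put $\mathrm{sign}=0$. **$M$-signature.** A real closure of $F$ at $P$ is a field embedding $\iota:F\to F_P$ with $F_P$ real closed, $\iota(P)\subseteq F_P^2$ and $F_P$ algebraic over $\iota(F)$. Tensor products with $F_P$ are along $\iota$. The algebra with involution $(A\otimes_F F_P,\sigma\otimes\mathrm{id})$ is (hermitian) Morita equivalent to $(D_P,\vartheta_P)$, where: if $\sigma$ is of the first kind, $(D_P,\vartheta_P)=(F_P,\mathrm{id})$ or $(H_P,-)$ with $H_P=(-1,-1)_{F_P}$, according to whether $A\otimes_F F_P$ is a matrix algebra over $F_P$ or over $H_P$; if $\sigma$ is unitary, $(D_P,\vartheta_P)=(F_P(\sqrt{-1}),-)$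 if $d<_P0$ and $(F_P\times F_P,\text{exchange})$ if $d>_P0$. Put $\varepsilon_P=-1$ if one of $\sigma,\vartheta_P$ is orthogonal and the other symplectic ($\mathrm{id}$ on $F_P$ being orthogonal and $-$ on $H_P$ symplectic), $\varepsilon_P=1$ otherwise. A Morita equivalence $\mathscr{M}:\mathscr{H}(A\otimes_F F_P,\sigma\otimes\mathrm{id})\to\mathscr{H}_{\varepsilon_P}(D_P,\vartheta_P)$ is an equivalence of categories given by hermitian Morita theory; it respects isometries, orthogonal sums and hyperbolic forms and induces a group isomorphism of Witt groups, also denoted $\mathscr{M}$. For a hermitian form $h$ over $(A,\sigma)$, $\mathrm{sign}_\iota^{\mathscr{M}}h:=\mathrm{sign}\,\mathscr{M}(h\otimes F_P)$, where $h\otimes F_P=(\mathrm{id}_A\otimes\iota)^*(h)$. **Nil-orderings.** $\mathrm{Nil}[A,\sigma]$ is the set of $P\in X_F$ with $D_P=H_P$ if $\sigma$ is orthogonal, $D_P=F_P$ if $\sigma$ is symplectic, $D_P=F_P\times F_P$ if $\sigma$ is unitary. *)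

(* Defs.v *)
From HB Require Import structures.
From mathcomp Require Import all_boot all_order all_algebra all_field.
From mathcomp Require Import complex.
From mathcomp Require Import boolp classical_sets.
From mathcomp Require Import ring.

Set Implicit Arguments.
Unset Strict Implicit.
Unset Printing Implicit Defensive.

Import Order.TTheory GRing.Theory Num.Theory.

Local Open Scope ring_scope.

(* Right B-modules are left modules over the converse ring B^c. *)
Definition ract (B : nzRingType) (M : lmodType B^c) (x : M) (b : B) : M :=
  (b : B^c) *: x.

Notation "x *>: b" := (ract x b) (at level 40, left associativity) : ring_scope.

Section RightModules.
Variable B : nzRingType.
Implicit Types (M : lmodType B^c) (a b : B).

Lemma ractM M (x : M) a b : x *>: (a * b) = x *>: a *>: b.
Proof. by rewrite /ract scalerA. Qed.

Lemma ractDr M (x : M) a b : x *>: (a + b) = x *>: a + x *>: b.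
Proof. by rewrite /ract scalerDl. Qed.

Lemma ractDl M (x y : M) a : (x + y) *>: a = x *>: a + y *>: a.
Proof. by rewrite /ract scalerDr. Qed.

Lemma ract1 M (x : M) : x *>: 1 = x.
Proof. exact: scale1r. Qed.

(* M is a retract of a free module of finite rank. *)
Definition fg_projective M : Prop :=
  exists (n : nat) (p : {linear 'rV[B^c]_n -> M})
         (s : {linear M -> 'rV[B^c]_n}), cancel s p.

(* x |-> h(x, .) is a bijection from M onto Hom_B(M, B). *)
Definition nonsingular M (h : M -> M -> B) : Prop :=
  (forall x, (forall y, h x y = 0) -> x = 0) /\
  (forall f : {linear M -> (B^c)^o}, exists x, forall y, h x y = f y).

End RightModules.

Record involution (B : nzRingType) (tau : B -> B) : Prop := Involution {
  involD : {morph tau : a b / a + b};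
  involM : forall a b, tau (a * b) = tau b * tau a;
  involK : involutive tau }.

(* Nonsingular (-1)^e-hermitian forms over (B, tau). *)
Record hermform (B : nzRingType) (tau : B -> B) (e : bool) := HermForm {
  hmod :> lmodType B^c;
  hfun : hmod -> hmod -> B;
  hfunDl : forall x x' y, hfun (x + x') y = hfun x y + hfun x' y;
  hfunDr : forall x y y', hfun x (y + y') = hfun x y + hfun x y';
  hfunZ : forall x a y b, hfun (x *>: a) (y *>: b) = tau a * hfun x y * b;
  hfunC : forall x y, hfun y x = (-1) ^+ e * tau (hfun x y);
  hmod_proj : fg_projective hmod;
  hfun_nonsing : nonsingular hfun }.

Record isometry (B : nzRingType) (tau : B -> B) (e : bool)
    (h h' : hermform tau e) := Isometry {
  isom_fun :> {linear h -> h'};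
  isom_bij : bijective isom_fun;
  isom_form : forall x y, hfun (isom_fun x) (isom_fun y) = hfun x y }.

Section DiagonalForms.
Variables (B : unitRingType) (tau : B -> B) (tau_inv : involution tau).
Variables (a : B) (Ua : a \is a GRing.unit) (Sa : tau a = a).

Let M : lmodType B^c := (B^c)^o.
Let h (x y : M) : B := tau x * a * y.

Let hDl x x' y : h (x + x') y = h x y + h x' y.
Proof. by rewrite /h (involD tau_inv) !mulrDl. Qed.

Let hDr x y y' : h x (y + y') = h x y + h x y'.
Proof. by rewrite /h mulrDr. Qed.

Let hZ x b y c : h (x *>: b) (y *>: c) = tau b * h x y * c.
Proof.
rewrite /h (_ : x *>: b = (x : B) * b) // (_ : y *>: c = (y : B) * c) //.
by rewrite (involM tau_inv) !mulrA.
Qed.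

Let hC x y : h y x = (-1) ^+ false * tau (h x y).
Proof. by rewrite /h mul1r !(involM tau_inv) (involK tau_inv) Sa mulrA. Qed.

Let h_proj : fg_projective M.
Proof.
pose p (x : 'rV[B^c]_1) : M := x 0 0.
pose s (x : M) : 'rV[B^c]_1 := const_mx x.
have pl : linear p by move=> c x y; rewrite /p !mxE.
have sl : linear s by move=> c x y; apply/rowP=> i; rewrite !mxE.
pose pa := GRing.isLinear.Build _ _ _ _ p pl.
pose sa := GRing.isLinear.Build _ _ _ _ s sl.
pose pL : {linear _ -> _} := HB.pack p pa.
pose sL : {linear _ -> _} := HB.pack s sa.
by exists 1, pL, sL => x; rewrite /= /p mxE.
Qed.

Let h_nonsing : nonsingular h.
Proof.
have tau0 : tau 0 = 0.
  by apply: (addrI (tau 0)); rewrite -(involD tau_inv) !addr0.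
split=> [x hx0|f].
  have /eqP := hx0 1; rewrite /h mulr1 -[X in _ == X](mul0r a).
  by rewrite (inj_eq (mulIr Ua)) => /eqP /(congr1 tau); rewrite (involK tau_inv) tau0.
exists (tau ((f (1 : B^c) : B) * a^-1)) => y; rewrite /h (involK tau_inv) mulrVK //.
by rewrite -[in RHS](mulr1 y) -[RHS]/(f (y *: (1 : (B^c)^o))) linearZ.
Qed.

(* The form <a>_tau : (x, y) |-> tau x * a * y on B viewed as a right module. *)
Definition diag1 : hermform tau false := HermForm hDl hDr hZ hC h_proj h_nonsing.

End DiagonalForms.

Section BaseChange.
Variables (A B : nzRingType) (sigma : A -> A) (tau : B -> B) (e : bool).
Variables (j : {rmorphism A -> B}).

(* hB is the form j^*(h) on M (x)_A B, for h a form on M: the map u, which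
   stands for x |-> x (x) 1, is the universal j-semilinear map on M. *)
Definition is_base_change (h : hermform sigma e) (hB : hermform tau e) : Prop :=
  exists u : h -> hB,
    [/\ {morph u : x y / x + y},
        forall x a, u (x *>: a) = u x *>: j a,
        forall (U : lmodType B^c) (f : h -> U), {morph f : x y / x + y} ->
          (forall x a, f (x *>: a) = f x *>: j a) ->
          exists2 g : {linear hB -> U}, (forall x, g (u x) = f x) &
            forall g' : {linear hB -> U}, (forall x, g' (u x) = f x) -> g' =1 g
      & forall x y, hfun (u x) (u y) = j (hfun x y)].
End BaseChange.

Section BaseChangeExists.
Variables (A B : nzRingType) (sigma : A -> A) (tau : B -> B) (e : bool).
Variables (j : {rmorphism A -> B}).
Hypothesis tau_inv : involution tau.
Hypothesis tau_j : forall a, tau (j a) = j (sigma a).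
Variable h : hermform sigma e.
Variables (n : nat) (p : {linear 'rV[A^c]_n -> h}) (s : {linear h -> 'rV[A^c]_n}).
Hypothesis spK : cancel s p.

Let ev k : 'rV[A^c]_n := delta_mx 0 k.
Let jr (x : 'rV[A^c]_n) : 'rV[B^c]_n := \row_k (j (x 0 k) : B^c).
Let q (x : 'rV[B^c]_n) : 'rV[B^c]_n := \sum_k x 0 k *: jr (s (p (ev k))).

Let jrD x y : jr (x + y) = jr x + jr y.
Proof. by apply/rowP=> k; rewrite !mxE rmorphD. Qed.
Let jrZ (a : A) x : jr ((a : A^c) *: x) = (j a : B^c) *: jr x.
Proof. by apply/rowP=> k; rewrite !mxE [LHS](rmorphM j). Qed.
Let jr0 : jr 0 = 0.
Proof. by apply/rowP=> k; rewrite !mxE rmorph0. Qed.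
Let jr_sum (I : finType) (F : I -> 'rV[A^c]_n) : jr (\sum_i F i) = \sum_i jr (F i).
Proof. exact: (big_morph jr jrD jr0). Qed.
Let rowE (x : 'rV[A^c]_n) : x = \sum_k x 0 k *: ev k.
Proof. exact: row_sum_delta. Qed.

Let q_lin : linear q.
Proof.
move=> c x y; rewrite /q scaler_sumr -big_split /=; apply: eq_bigr => k _.
by rewrite !mxE scalerDl scalerA.
Qed.
HB.instance Definition _ := GRing.isLinear.Build _ _ _ _ q q_lin.

Let q_jr x : q (jr x) = jr (s (p x)).
Proof.
rewrite [in RHS](rowE x) !linear_sum jr_sum; apply: eq_bigr => k _.
by rewrite !linearZ /= jrZ mxE.
Qed.

Let qq x : q (q x) = q x.
Proof.
rewrite {2 3}/q linear_sum; apply: eq_bigr => k _.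
by rewrite linearZ /= q_jr spK.
Qed.

Let fixq : {pred 'rV[B^c]_n} := fun x => q x == x.
Let fixq_submod : submod_closed fixq.
Proof.
split=> [|c x y]; rewrite !unfold_in ?linear0 //.
by move=> /eqP xq /eqP yq; rewrite (q_lin c x y) xq yq.
Qed.
HB.instance Definition _ := GRing.isSubmodClosed.Build _ _ fixq fixq_submod.

Record fixmod := FixMod { fixval :> 'rV[B^c]_n; _ : fixval \in fixq }.
HB.instance Definition _ := [isSub for fixval].
HB.instance Definition _ := [Choice of fixmod by <:].
HB.instance Definition _ := [SubChoice_isSubLmodule of fixmod by <:].

Let inq x : q x \in fixq.
Proof. by rewrite unfold_in qq. Qed.
Let toq x : fixmod := FixMod (inq x).
Let toqK x : val (toq x) = q x. Proof. by []. Qed.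
Let valq (x : fixmod) : q (val x) = val x.
Proof. by case: x => x /= /eqP. Qed.
Let toq_lin : linear toq.
Proof.
by move=> c x y; apply: val_inj; rewrite linearP /= linearP.
Qed.
HB.instance Definition _ := GRing.isLinear.Build _ _ _ _ toq toq_lin.

Let u (m : h) : fixmod := toq (jr (s m)).
Let uE m : val (u m) = jr (s m). Proof. by rewrite toqK q_jr spK. Qed.
Let uD : {morph u : x y / x + y}.
Proof. by move=> x y; rewrite /u linearD jrD linearD. Qed.
Let uZ x a : u (x *>: a) = u x *>: j a.
Proof. by rewrite /u /ract linearZ /= jrZ linearZ. Qed.
Let u_gen (x : fixmod) : x = \sum_k u (p (ev k)) *>: (val x 0 k : B).
Proof.
apply: val_inj; rewrite -[LHS]valq /q (raddf_sum val); apply: eq_bigr => k _.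
by rewrite -uE [RHS]GRing.valZ.
Qed.

Let ext_lin (U : lmodType B^c) (f : fixmod -> U) : linear f ->
  forall f' : fixmod -> U, linear f' -> (forall m, f (u m) = f' (u m)) -> f =1 f'.
Proof.
move=> fl f' fl' ff' x.
pose fa := GRing.isLinear.Build _ _ _ _ f fl.
pose fa' := GRing.isLinear.Build _ _ _ _ f' fl'.
pose fL : {linear _ -> _} := HB.pack f fa.
pose fL' : {linear _ -> _} := HB.pack f' fa'.
rewrite -[f]/(fL : _ -> _) -[f']/(fL' : _ -> _) (u_gen x) !linear_sum.
by apply: eq_bigr => k _; rewrite /ract !linearZ /= ff'.
Qed.

Let hB (x y : fixmod) : B :=
  \sum_k \sum_l tau (val x 0 k) * j (hfun (p (ev k)) (p (ev l))) * val y 0 l.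

Let tau0 : tau 0 = 0.
Proof. by apply: (addrI (tau 0)); rewrite -(involD tau_inv) !addr0. Qed.

Let tauN x : tau (- x) = - tau x.
Proof. by apply: (addrI (tau x)); rewrite -(involD tau_inv) !subrr. Qed.

Let hBDl x x' y : hB (x + x') y = hB x y + hB x' y.
Proof.
rewrite /hB -big_split /=; apply: eq_bigr => k _; rewrite -big_split /=.
by apply: eq_bigr => l _; rewrite mxE (involD tau_inv) !mulrDl.
Qed.
Let hBDr x y y' : hB x (y + y') = hB x y + hB x y'.
Proof.
rewrite /hB -big_split /=; apply: eq_bigr => k _; rewrite -big_split /=.
by apply: eq_bigr => l _; rewrite mxE mulrDr.
Qed.
Let hBZ x a y b : hB (x *>: a) (y *>: b) = tau a * hB x y * b.
Proof.
rewrite /hB big_distrr big_distrl /=; apply: eq_bigr => k _.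
rewrite big_distrr big_distrl /=; apply: eq_bigr => l _.
rewrite !mxE (_ : (a : B^c) * _ = (val x 0 k : B) * a) //.
by rewrite (_ : (b : B^c) * _ = (val y 0 l : B) * b) // (involM tau_inv) !mulrA.
Qed.
Let hBC x y : hB y x = (-1) ^+ e * tau (hB x y).
Proof.
have tauS (I : finType) (G : I -> B) : tau (\sum_i G i) = \sum_i tau (G i).
  by apply: (big_morph tau _ tau0) => ? ?; rewrite involD.
rewrite /hB tauS exchange_big big_distrr /=; apply: eq_bigr => k _.
rewrite tauS big_distrr /=; apply: eq_bigr => l _.
rewrite !(involM tau_inv) (involK tau_inv) tau_j (hfunC (p (ev k))) rmorphM rmorph_sign.
by move: (j (sigma _)) => c; rewrite !mulr_sign; case: (e); rewrite ?(mulrN, mulNr) !mulrA.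
Qed.

Let hfun_suml (I : finType) (G : I -> h) y :
  hfun (\sum_i G i) y = \sum_i hfun (G i) y.
Proof.
apply: (big_morph (fun x => hfun x y)) => [? ?|]; first exact: hfunDl.
by apply: (addrI (hfun 0 y)); rewrite -hfunDl !addr0.
Qed.
Let hfun_sumr (I : finType) (G : I -> h) y :
  hfun y (\sum_i G i) = \sum_i hfun y (G i).
Proof.
apply: (big_morph (hfun y)) => [? ?|]; first exact: hfunDr.
by apply: (addrI (hfun y 0)); rewrite -hfunDr !addr0.
Qed.

Let hBu x y : hB (u x) (u y) = j (hfun x y).
Proof.
rewrite -[x in RHS]spK -[y in RHS]spK [s x]rowE [s y]rowE !linear_sum.
rewrite hfun_suml rmorph_sum; apply: eq_bigr => k _.
rewrite hfun_sumr rmorph_sum; apply: eq_bigr => l _.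
have pZ m i : p (s m 0 i *: ev i) = p (ev i) *>: s m 0 i by rewrite linearZ.
by rewrite !uE ![jr _ _ _]mxE tau_j !pZ hfunZ !rmorphM.
Qed.

Let hB_proj : fg_projective fixmod.
Proof.
exists n, (toq : {linear _ -> _}), (val : {linear fixmod -> _}).
by move=> x; apply: val_inj; rewrite toqK valq.
Qed.

Let hB_lin x : linear (hB x : fixmod -> (B^c)^o).
Proof.
move=> c y y'; rewrite hBDr -[c *: y]/(y *>: c) -[x in hB x (_ *>: _)]ract1.
have tau1 : tau 1 = 1.
  by rewrite -[LHS](mulr1 (tau 1)) -{2}(involK tau_inv 1) -(involM tau_inv) mulr1 (involK tau_inv).
by rewrite hBZ tau1 mul1r.
Qed.

Let hB_w k : exists w, forall y : fixmod, hB (u w) y = val y 0 k.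
Proof.
pose f (m : h) : (A^c)^o := s m 0 k.
have fl : linear f by move=> c x y; rewrite /f linearP !mxE.
pose fa := GRing.isLinear.Build _ _ _ _ f fl.
pose fL : {linear _ -> _} := HB.pack f fa.
have [_ /(_ fL)[w hw]] := hfun_nonsing h.
exists w; apply: (@ext_lin (B^c)^o).
- exact: hB_lin.
- by move=> c y y'; rewrite !mxE.
by move=> m; rewrite hBu hw uE mxE.
Qed.

Let hB_nonsing : nonsingular hB.
Proof.
split=> [x hx0|f].
  apply: val_inj; apply/rowP=> k; rewrite mxE; have [w <-] := hB_w k.
  by rewrite hBC hx0 tau0 mulr0.
have [w hw] := choice hB_w.
exists (\sum_k u (w k) *>: tau (f (u (p (ev k))) : B)).
have hBs (I : finType) (G : I -> fixmod) y : hB (\sum_i G i) y = \sum_i hB (G i) y.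
  apply: (big_morph (fun x => hB x y)) => [? ?|]; first exact: hBDl.
  by apply: (addrI (hB 0 y)); rewrite -hBDl !addr0.
move=> y; rewrite hBs [in RHS](u_gen y) linear_sum; apply: eq_bigr => k _.
rewrite -[y in LHS]ract1 hBZ (involK tau_inv) mulr1 hw.
by rewrite /ract linearZ.
Qed.

Let hBform : hermform tau e := HermForm hBDl hBDr hBZ hBC hB_proj hB_nonsing.

Lemma base_change_exists_aux : exists hB : hermform tau e, is_base_change j h hB.
Proof.
exists hBform, u; split; [exact: uD | exact: uZ | | exact: hBu].
move=> U f fD fZ.
pose g (x : fixmod) : U := \sum_k f (p (ev k)) *>: (val x 0 k : B).
have gl : linear g.
  move=> c x y; rewrite /g scaler_sumr -big_split /=; apply: eq_bigr => k _.
  by rewrite !mxE /ract scalerDl scalerA.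
pose ga := GRing.isLinear.Build _ _ _ _ g gl.
pose gL : {linear _ -> _} := HB.pack g ga.
have f0 : f 0 = 0 by apply: (addrI (f 0)); rewrite -fD !addr0.
have gu x : gL (u x) = f x.
  rewrite -[x in RHS]spK [s x]rowE linear_sum (big_morph f fD f0).
  by apply: eq_bigr => k _; rewrite uE mxE linearZ /= [RHS]fZ.
exists gL => // g' g'u; apply: ext_lin => [? ? ?|? ? ?|m]; rewrite ?linearP //.
by rewrite g'u gu.
Qed.

End BaseChangeExists.

Lemma base_change_exists (A B : nzRingType) (sigma : A -> A) (tau : B -> B)
    (e : bool) (j : {rmorphism A -> B}) :
  involution tau -> (forall a, tau (j a) = j (sigma a)) ->
  forall h : hermform sigma e, exists hB : hermform tau e, is_base_change j h hB.
Proof.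
move=> tau_inv tau_j h; have [n [p [s spK]]] := hmod_proj h.
exact: base_change_exists_aux spK.
Qed.

(* A (x)_F K along iota : F -> K, in coordinates on the K-basis
   (tens1 e_i)_i, where (e_i)_i is the basis vbasis {:A} of A over F. *)
Definition scalext (F K : fieldType) (iota : {rmorphism F -> K})
  (A : falgType F) : Type := 'rV[K]_(\dim {:A}).

Section ScalarExtension.
Variables (F K : fieldType) (iota : {rmorphism F -> K}) (A : falgType F).
Local Notation AK := (scalext iota A).
Local Notation be i := ((vbasis {:A})`_i).

HB.instance Definition _ := Vector.copy AK 'rV[K]_(\dim {:A}).

Definition crd (u : AK) (i : 'I_(\dim {:A})) : K := (u : 'rV[K]__) 0 i.

(* a (x) 1 *)
Definition tens1 (a : A) : AK := \row_i iota (coord (vbasis {:A}) i a).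

Definition scalext_mul (u v : AK) : AK :=
  \sum_i \sum_k (crd u i * crd v k) *: tens1 (be i * be k).

(* s (x) id, for s : A -> A linear over F *)
Definition scalext_map (s : 'End(A)) (u : AK) : AK :=
  \sum_i crd u i *: tens1 (s (be i)).

Lemma tens1Z c a : tens1 (c *: a) = iota c *: tens1 a.
Proof. by apply/rowP=> i; rewrite !mxE linearZ rmorphM. Qed.

Let tens1D : {morph tens1 : a b / a + b}.
Proof. by move=> a b; apply/rowP=> i; rewrite !mxE linearD rmorphD. Qed.

Let tens10 : tens1 0 = 0.
Proof. by apply/rowP=> i; rewrite !mxE linear0 rmorph0. Qed.

Let tens1_sum (I : finType) (G : I -> A) : tens1 (\sum_i G i) = \sum_i tens1 (G i).
Proof. exact: (big_morph tens1 tens1D tens10). Qed.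

Lemma scalext_basis (u : AK) : u = \sum_i crd u i *: tens1 (be i).
Proof.
rewrite [LHS](row_sum_delta (u : 'rV[K]__)); apply: eq_bigr => i _.
congr (_ *: _); apply/rowP=> k; rewrite !mxE coord_free; last first.
  exact: basis_free (vbasisP _).
by rewrite eqxx /= rmorph_nat eq_sym.
Qed.

Let crdD (u v : AK) i : crd (u + v) i = crd u i + crd v i.
Proof. by rewrite /crd mxE. Qed.
Let crdZ c (u : AK) i : crd (c *: u) i = c * crd u i.
Proof. by rewrite /crd mxE. Qed.

Let mulDl : left_distributive scalext_mul +%R.
Proof.
move=> u v w; rewrite /scalext_mul -big_split /=; apply: eq_bigr => i _.
rewrite -big_split /=; apply: eq_bigr => k _.
by rewrite crdD mulrDl scalerDl.
Qed.
Let mulDr : right_distributive scalext_mul +%R.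
Proof.
move=> u v w; rewrite /scalext_mul -big_split /=; apply: eq_bigr => i _.
rewrite -big_split /=; apply: eq_bigr => k _.
by rewrite crdD mulrDr scalerDl.
Qed.
Let mulZl c u v : scalext_mul (c *: u) v = c *: scalext_mul u v.
Proof.
rewrite /scalext_mul scaler_sumr; apply: eq_bigr => i _.
rewrite scaler_sumr; apply: eq_bigr => k _.
by rewrite crdZ scalerA mulrA.
Qed.
Let mulZr c u v : scalext_mul u (c *: v) = c *: scalext_mul u v.
Proof.
rewrite /scalext_mul scaler_sumr; apply: eq_bigr => i _.
rewrite scaler_sumr; apply: eq_bigr => k _.
by rewrite crdZ scalerA mulrCA.
Qed.

Let tens1M a b : scalext_mul (tens1 a) (tens1 b) = tens1 (a * b).
Proof.
have ce c : c = \sum_i coord (vbasis {:A}) i c *: be i.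
  by rewrite -coord_vbasis ?memvf.
rewrite [in RHS](ce a) [in RHS](ce b) mulr_suml tens1_sum; apply: eq_bigr => i _.
rewrite mulr_sumr tens1_sum; apply: eq_bigr => k _.
by rewrite -scalerAl -scalerAr scalerA tens1Z rmorphM /crd !mxE.
Qed.

Lemma scalext_eq (f g : AK -> AK) : linear f -> linear g ->
  (forall i, f (tens1 (be i)) = g (tens1 (be i))) -> f =1 g.
Proof.
move=> fl gl fg u.
pose fa := GRing.isLinear.Build _ _ _ _ f fl.
pose ga := GRing.isLinear.Build _ _ _ _ g gl.
pose fL : {linear _ -> _} := HB.pack f fa.
pose gL : {linear _ -> _} := HB.pack g ga.
rewrite -[f]/(fL : _ -> _) -[g]/(gL : _ -> _) [u]scalext_basis !linear_sum.
by apply: eq_bigr => i _; rewrite !linearZ /= fg.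
Qed.

Let mulA : associative scalext_mul.
Proof.
move=> u v w; move: u; apply: scalext_eq => [c u u'|c u u'|i].
- by rewrite mulDl mulZl.
- by rewrite !mulDl !mulZl.
move: v; apply: scalext_eq => [c v v'|c v v'|k].
- by rewrite mulDl mulZl mulDr mulZr.
- by rewrite mulDr mulZr mulDl mulZl.
move: w; apply: scalext_eq => [c w w'|c w w'|l].
- by rewrite !mulDr !mulZr.
- by rewrite mulDr mulZr.
by rewrite !tens1M mulrA.
Qed.

Let mul1 : left_id (tens1 1) scalext_mul.
Proof.
apply: scalext_eq => [c u v|//|i]; first by rewrite mulDr mulZr.
by rewrite tens1M mul1r.
Qed.
Let mulr1 : right_id (tens1 1) scalext_mul.
Proof.
apply: (scalext_eq (f := scalext_mul^~ (tens1 1))) => [c u v|//|i].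
  by rewrite mulDl mulZl.
by rewrite tens1M GRing.mulr1.
Qed.
Let one_neq0 : tens1 1 != 0.
Proof.
apply/negP => /eqP /rowP t0; have /eqP := oner_neq0 A; apply.
rewrite (coord_vbasis (memvf (1 : A))) big1 // => i _.
have /eqP := t0 i; rewrite !mxE fmorph_eq0 => /eqP ->.
by rewrite scale0r.
Qed.

HB.instance Definition _ := GRing.Zmodule_isNzRing.Build AK
  mulA mul1 mulr1 mulDl mulDr one_neq0.
HB.instance Definition _ := GRing.Lmodule_isLalgebra.Build K AK
  (fun c u v => esym (mulZl c u v)).
HB.instance Definition _ := GRing.Lalgebra_isAlgebra.Build K AK
  (fun c u v => esym (mulZr c u v)).
HB.instance Definition _ := Algebra_isFalgebra.Build K AK.

Lemma tens1_is_monoid_morphism : monoid_morphism tens1.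
Proof. by split=> // a b; rewrite -tens1M. Qed.
Lemma tens1_is_additive : nmod_morphism tens1.
Proof. by split. Qed.
HB.instance Definition _ := GRing.isNmodMorphism.Build A AK tens1 tens1_is_additive.
HB.instance Definition _ := GRing.isMonoidMorphism.Build A AK tens1
  tens1_is_monoid_morphism.

Lemma scalext_map_is_linear (s : 'End(A)) : linear (scalext_map s).
Proof.
move=> c u v; rewrite /scalext_map scaler_sumr -big_split /=.
by apply: eq_bigr => i _; rewrite crdD crdZ scalerDl scalerA.
Qed.
HB.instance Definition _ s := GRing.isLinear.Build _ _ _ _ (scalext_map s)
  (scalext_map_is_linear s).

Lemma scalext_map_tens1 (s : 'End(A)) a : scalext_map s (tens1 a) = tens1 (s a).
Proof.
rewrite [in RHS](coord_vbasis (memvf a)) linear_sum tens1_sum.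
by apply: eq_bigr => i _; rewrite linearZ tens1Z /crd mxE.
Qed.

Lemma scalext_involution (s : 'End(A)) :
  involution s -> involution (scalext_map s).
Proof.
case=> _ sM sK; split=> [u v|u v|u]; first exact: linearD.
  move: u; apply: scalext_eq => [c u u'|c u u'|i].
  - by rewrite mulrDl -scalerAl linearP.
  - by rewrite linearP mulrDr -scalerAr.
  move: v; apply: scalext_eq => [c v v'|c v v'|k].
  - by rewrite mulrDr -scalerAr linearP.
  - by rewrite linearP mulrDl -scalerAl.
  by rewrite -rmorphM !scalext_map_tens1 -rmorphM sM.
apply: (scalext_eq (f := fun u => scalext_map s (scalext_map s u)) (g := id)) => //.
  by move=> c v w; rewrite !linearP.
by move=> i; rewrite !scalext_map_tens1 sK.
Qed.

End ScalarExtension.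

(* The quaternion algebra (-1, -1)_K; Quat a b c d is a + b i + c j + d k. *)
Record quat (K : Type) := Quat { qre : K; qi : K; qj : K; qk : K }.

Section Quaternions.
Variable K : fieldType.
Local Notation H := (quat K).

Definition quat_tuple (x : H) := (qre x, qi x, qj x, qk x).
Definition tuple_quat (t : K * K * K * K) : H :=
  Quat t.1.1.1 t.1.1.2 t.1.2 t.2.
Lemma quat_tupleK : cancel quat_tuple tuple_quat.
Proof. by case. Qed.
HB.instance Definition _ := Choice.copy H (can_type quat_tupleK).

Definition qadd (x y : H) : H :=
  Quat (qre x + qre y) (qi x + qi y) (qj x + qj y) (qk x + qk y).
Definition qopp (x : H) : H := Quat (- qre x) (- qi x) (- qj x) (- qk x).
Definition qmul (x y : H) : H :=
  Quat (qre x * qre y - qi x * qi y - qj x * qj y - qk x * qk y)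
       (qre x * qi y + qi x * qre y + qj x * qk y - qk x * qj y)
       (qre x * qj y - qi x * qk y + qj x * qre y + qk x * qi y)
       (qre x * qk y + qi x * qj y - qj x * qi y + qk x * qre y).
Definition qscal (c : K) : H := Quat c 0 0 0.
Definition qconj (x : H) : H := Quat (qre x) (- qi x) (- qj x) (- qk x).

Let qaddA : associative qadd.
Proof. by move=> [? ? ? ?] [? ? ? ?] [? ? ? ?]; rewrite /qadd /= !addrA. Qed.
Let qaddC : commutative qadd.
Proof. by move=> [? ? ? ?] [? ? ? ?]; rewrite /qadd /=; congr Quat; ring. Qed.
Let qadd0 : left_id (qscal 0) qadd.
Proof. by move=> [? ? ? ?]; rewrite /qadd /= !add0r. Qed.
Let qaddN : left_inverse (qscal 0) qopp qadd.
Proof. by move=> [? ? ? ?]; rewrite /qadd /= !addNr. Qed.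
HB.instance Definition _ := GRing.isZmodule.Build H qaddA qaddC qadd0 qaddN.

Let qmulA : associative qmul.
Proof.
by move=> [? ? ? ?] [? ? ? ?] [? ? ? ?]; rewrite /qmul /=; congr Quat; ring.
Qed.
Let qmul1 : left_id (qscal 1) qmul.
Proof. by move=> [? ? ? ?]; rewrite /qmul /=; congr Quat; ring. Qed.
Let qmulr1 : right_id (qscal 1) qmul.
Proof. by move=> [? ? ? ?]; rewrite /qmul /=; congr Quat; ring. Qed.
Let qmulDl : left_distributive qmul +%R.
Proof.
by move=> [? ? ? ?] [? ? ? ?] [? ? ? ?]; rewrite /qmul /=; congr Quat => /=; ring.
Qed.
Let qmulDr : right_distributive qmul +%R.
Proof.
by move=> [? ? ? ?] [? ? ? ?] [? ? ? ?]; rewrite /qmul /=; congr Quat => /=; ring.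
Qed.
Let q1_neq0 : qscal 1 != 0.
Proof. by apply/eqP=> -[/eqP]; rewrite oner_eq0. Qed.
HB.instance Definition _ := GRing.Zmodule_isNzRing.Build H
  qmulA qmul1 qmulr1 qmulDl qmulDr q1_neq0.

End Quaternions.

Definition formally_real (F : fieldType) : Prop :=
  ~ exists s : seq F, -1 = \sum_(x <- s) x ^+ 2.

Definition ordering (F : fieldType) (P : set F) : Prop :=
  [/\ forall x y, P x -> P y -> P (x + y),
      forall x y, P x -> P y -> P (x * y),
      forall x, P x \/ P (- x)
    & forall x, P x -> P (- x) -> x = 0].

Definition real_closure (F : fieldType) (P : set F) (K : rcfType)
    (iota : {rmorphism F -> K}) : Prop :=
  (forall x, P x -> exists y, iota x = y ^+ 2) /\
  (forall y : K, algebraicOver iota y).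

(* It is enough to consider ideals that are F-subspaces, since every two-sided
   ideal of a unital F-algebra is one. *)
Definition simple_algebra (F : fieldType) (A : falgType F) : Prop :=
  forall I : {vspace A},
    (forall a x, x \in I -> a * x \in I /\ x * a \in I) ->
    I = 0%VS \/ I = fullv.

Definition centre_is_base (F : fieldType) (A : falgType F) : Prop :=
  ('Z({:A}) = 1)%VS.

(* The centre of A is the quadratic field extension F(sqrt d). *)
Definition centre_is_sqrt (F : fieldType) (A : falgType F) (d : F) : Prop :=
  (forall c : F, c ^+ 2 <> d) /\
  exists2 z : A, z ^+ 2 = d%:A & ('Z({:A}) = 1 + <[z]>)%VS.

Record algInvol (F : fieldType) := AlgInvol {
  alg :> falgType F;
  ainv : 'End(alg);
  ainvM : forall x y, ainv (x * y) = ainv y * ainv x;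
  ainvK : forall x, ainv (ainv x) = x;
  alg_simple : simple_algebra alg;
  alg_centre : centre_is_base alg \/
    (exists d, centre_is_sqrt alg d) /\
    (exists2 x, x \in 'Z({:alg})%VS & ainv x <> x) }.

Lemma ainv_involution (F : fieldType) (A : algInvol F) : involution (ainv A).
Proof. by split; [exact: linearD | exact: ainvM | exact: ainvK]. Qed.

Section Kinds.
Variables (F : fieldType) (A : algInvol F).

Definition first_kind : Prop := centre_is_base A.
Definition unitary (d : F) : Prop := centre_is_sqrt A d.

Definition orthogonal : Prop := first_kind /\
  exists2 m : nat, \dim {:A} = (m ^ 2)%N &
    \dim (fixedSpace (ainv A)) = (m * m.+1)./2.

Definition symplectic : Prop := first_kind /\
  exists2 m : nat, \dim {:A} = (m ^ 2)%N &
    \dim (fixedSpace (ainv A)) = (m * m.-1)./2.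

End Kinds.

(* The possible (D_P, theta_P): (K, id), ((-1,-1)_K, conjugation),
   (K(sqrt(-1)), conjugation), (K x K, exchange). *)
Inductive dkind := DReal | DQuat | DCplx | DSplit.

Section LocalRings.
Variable K : rcfType.

Definition Drg (k : dkind) : nzRingType :=
  match k with
  | DReal => K
  | DQuat => quat K
  | DCplx => K[i]%C
  | DSplit => (K * K)%type
  end.

Definition Dinv (k : dkind) : Drg k -> Drg k :=
  match k return Drg k -> Drg k with
  | DReal => fun x => x
  | DQuat => fun x => qconj x
  | DCplx => fun x => conjc x
  | DSplit => fun x => (x.2, x.1)
  end.

Section Sign.
Variables (k : dkind) (e : bool).

(* h is isometric to < (-1)^(s 0), ..., (-1)^(s (n - 1)) >. *)
Definition diagonalizes (h : hermform (@Dinv k) e) (n : nat) (s : 'I_n -> bool) :=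
  exists2 f : {linear h -> 'rV[(Drg k)^c]_n}, bijective f &
    forall x y, hfun x y =
      \sum_i Dinv (f x 0 i : Drg k) * (-1) ^+ s i * (f y 0 i : Drg k).

(* The value does not depend on the diagonalization chosen (Sylvester). *)
Definition sign (h : hermform (@Dinv k) e) : int :=
  match k, e with
  | DReal, false | DQuat, false | DCplx, false =>
      xget 0 [set z : int | exists n (s : 'I_n -> bool),
                diagonalizes h s /\ z = \sum_i (-1) ^+ s i]
  | _, _ => 0
  end.

End Sign.
End LocalRings.

Section Morita.
Variables (B D : nzRingType) (tau : B -> B) (theta : D -> D) (e : bool).

Definition balanced (M : lmodType B^c) (N : lmodType D^c)
    (act : B -> {linear N -> N}) (T : lmodType D^c) (t : M -> N -> T) : Prop :=
  [/\ forall x x' n, t (x + x') n = t x n + t x' n,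
      forall x n n', t x (n + n') = t x n + t x n',
      forall x b n, t (x *>: b) n = t x (act b n)
    & forall x n d, t x (n *>: d) = t x n *>: d].

(* (T, t) is the tensor product M (x)_B N. *)
Definition is_tensor (M : lmodType B^c) (N : lmodType D^c)
    (act : B -> {linear N -> N}) (T : lmodType D^c) (t : M -> N -> T) : Prop :=
  balanced act t /\
  forall (U : lmodType D^c) (f : M -> N -> U), balanced act f ->
    exists2 g : {linear T -> U}, (forall x n, g (t x n) = f x n) &
      forall g' : {linear T -> U}, (forall x n, g' (t x n) = f x n) -> g' =1 g.

(* A nonsingular (-1)^e-hermitian form on a B-D-bimodule N which is a
   progenerator over D, such that left multiplication identifies (B, tau) with
   End_D(N) and the adjoint involution. *)
Record hmorita_module := HMoritaModule {
  mmod :> hermform theta e;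
  mact : B -> {linear mmod -> mmod};
  mactD : forall b b' n, mact (b + b') n = mact b n + mact b' n;
  mactM : forall b b' n, mact (b * b') n = mact b (mact b' n);
  mact1 : forall n, mact 1 n = n;
  mact_inj : forall b, (forall n, mact b n = 0) -> b = 0;
  mact_surj : forall f : {linear mmod -> mmod}, exists b, mact b =1 f;
  mmod_generator : exists (r : nat) (f : 'I_r -> {linear mmod -> (D^c)^o})
    (x : 'I_r -> mmod), \sum_i (f i (x i) : D) = 1;
  mact_adj : forall b n n', hfun (mact b n) n' = hfun n (mact (tau b) n') }.

Arguments mact [N] b : rename.

(* The functor M |-> M (x)_B N on hermitian forms, with
   (x (x) n, x' (x) n') |-> phi(n, h(x, x') n') for phi the form on N. *)
Record morita_equiv := MoritaEquiv {
  mor_mod : hmorita_module;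
  mor_obj :> hermform tau false -> hermform theta e;
  mor_hom : forall h h' : hermform tau false,
    isometry h h' -> isometry (mor_obj h) (mor_obj h');
  mor_tens : forall h : hermform tau false, h -> mor_mod -> mor_obj h;
  mor_tensP : forall h, is_tensor (@mact mor_mod) (@mor_tens h);
  mor_form : forall (h : hermform tau false) (x x' : h) (n n' : mor_mod),
    hfun (mor_tens x n) (mor_tens x' n') = hfun n (mact (hfun x x') n');
  mor_homE : forall (h h' : hermform tau false) (g : isometry h h') x n,
    mor_hom g (mor_tens x n) = mor_tens (g x) n }.

End Morita.

Definition is_matrix_algebra (K : fieldType) (E : algType K) (D : nzRingType)
    (c : K -> D) : Prop :=
  exists (n : nat) (f : {rmorphism E -> 'M[D]_n.+1}),
    bijective f /\ forall a : K, f a%:A = (c a)%:M.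

Section Local.
Variables (F : fieldType) (A : algInvol F) (P : set F).
Variables (K : rcfType) (iota : {rmorphism F -> K}).

(* (D_P, theta_P) is of type k. *)
Definition Dkind (k : dkind) : Prop :=
  match k with
  | DReal => first_kind A /\ is_matrix_algebra (scalext iota A) (fun c : K => c)
  | DQuat => first_kind A /\ is_matrix_algebra (scalext iota A) (@qscal K)
  | DCplx => exists2 d, unitary A d & P (- d)
  | DSplit => exists2 d, unitary A d & P d
  end.

(* eps_P = (-1)^(epsP k) *)
Definition epsP (k : dkind) : bool :=
  `[< orthogonal A /\ k = DQuat \/ symplectic A /\ k = DReal >].

Definition extinv : scalext iota A -> scalext iota A := scalext_map (ainv A).

Lemma ext_form_exists (h : hermform (ainv A) false) :
  exists hK : hermform extinv false, is_base_change (@tens1 F K iota A) h hK.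
Proof.
apply: base_change_exists; first exact/scalext_involution/ainv_involution.
exact: scalext_map_tens1.
Qed.

(* h (x) K *)
Definition ext_form (h : hermform (ainv A) false) : hermform extinv false :=
  projT1 (cid (ext_form_exists h)).

Lemma ext_formP h : is_base_change (@tens1 F K iota A) h (ext_form h).
Proof. exact: projT2 (cid (ext_form_exists h)). Qed.

Definition msign (k : dkind) (M : morita_equiv extinv (@Dinv K k) (epsP k))
    (h : hermform (ainv A) false) : int := sign (M (ext_form h)).

End Local.

(* Real closures of F at P being isomorphic over F, the condition does not
   depend on the real closure. *)
Definition NilOrd (F : fieldType) (A : algInvol F) (P : set F) : Prop :=
  ordering P /\
  exists (K : rcfType) (iota : {rmorphism F -> K}) (k : dkind),
    [/\ real_closure P iota, Dkind A P iota k &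
        [\/ orthogonal A /\ k = DQuat, symplectic A /\ k = DReal
          | k = DSplit]].

Definition is_diag1 (F : fieldType) (A : algInvol F)
    (h : hermform (ainv A) false) : Prop :=
  exists (a : A) (Ua : a \is a GRing.unit) (Sa : ainv A a = a),
    h = diag1 (ainv_involution A) Ua Sa.

(* Main.v *)
(* Call a representation rho of (A, sigma) on K^m, K real closed, adjoint to a symmetric form G,
   neutral if sig (G rho(a)) = 0 for all symmetric units a of A. A Morita equivalence at P gives
   such a representation, with sig (G rho(a)) a nonzero multiple of the signature of <a>, in which
   a combination of the rho(e_i) with coefficients in K represents a definite form. So it is enough
   that no neutral representation represents a definite form; and that a finite set of units
   suffices for each m <= dim A follows by taking an ultraproduct of counterexamples along the
   finite sets of units.

   Let rho be neutral. If x is an invertible hermitian matrix over A and D a generic diagonal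
   matrix, then x + D and x^-1 + D^-1 are diagonalizable over A and their sum is congruent to that
   of x and D; hence x has signature 0. If X(t) is a family of symmetric elements with polynomial
   coefficients over the base field, then X(t) has signature 0 at each algebraic t: the transfer of
   X along Euler's functional of the minimal polynomial f of t is a hermitian matrix over A, its
   signature is the sum of sign(f'(x)) sig X(x) over the roots x of f, and twisting by the
   derivatives of f separates the roots by Thom's lemma. By local constancy the same holds for every
   t in K where X(t) is invertible. So neutrality persists over the field generated by t, and
   adjoining coefficients one by one it holds for all combinations over K: none is definite. *)
Require Import Defs.
From HB Require Import structures.
From mathcomp Require Import all_boot all_order all_algebra all_field.
From mathcomp Require Import generic_quotient polyrcf complex.
From mathcomp Require Import boolp classical_sets filter.
From mathcomp Require Import ring.

Set Implicit Arguments.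
Unset Strict Implicit.
Unset Printing Implicit Defensive.

Import Order.TTheory GRing.Theory Num.Theory.

Local Open Scope ring_scope.

(** * Signatures of symmetric matrices *)

(** Neutrality concerns elements with coefficients in the base field, whereas a definite form
    appears only after extending scalars to [K], where the image of the base field need not be
    dense. Transfer bridges this gap, but it turns one element over a finite extension into a
    hermitian matrix over [A]; since [A] may have zero divisors, such a matrix need not be
    diagonalizable with invertible entries, which is what the generic shift repairs. Thom's lemma
    and Euler's functional handle a single variable, hence the passage through E(t), and hence
    neutrality is a property of representations over an arbitrary base field. A Morita equivalence
    may act on the scalars of [K] through a nontrivial field automorphism; the finite test therefore
    ranges over all embeddings of the base field into all real closed fields, and it is uniform once
    the size of the matrices is fixed. *)

Section Diagonalization.
Variable R : idomainType.
Hypothesis two_neq0 : (2%:R : R) != 0.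

Lemma congr_pivot n (S : 'M[R]_n.+1) : S^T = S -> S != 0 ->
  exists2 C : 'M[R]_n.+1, \det C != 0 & (C *m S *m C^T) 0 0 != 0.
Proof.
move=> Ssym S0.
have diagE (C : 'M[R]_n.+1) i : (C *m S *m C^T) i i != 0 -> \det C != 0 ->
    exists2 C : 'M[R]_n.+1, \det C != 0 & (C *m S *m C^T) 0 0 != 0.
  move=> Ci dC; exists (perm_mx (perm.tperm 0 i) *m C).
    by rewrite det_mulmx det_perm mulf_neq0 ?signr_eq0.
  have -> : perm_mx (perm.tperm 0 i) *m C *m S *m (perm_mx (perm.tperm 0 i) *m C)^T =
      col_perm (perm.tperm 0 i) (row_perm (perm.tperm 0 i) (C *m S *m C^T)).
    by rewrite col_permE row_permE trmx_mul tr_perm_mx !mulmxA.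
  by rewrite !mxE perm.tpermL; move: Ci; rewrite mxE.
have [/existsP[i Sii]|/existsPn Sd] := boolP [exists i, S i i != 0].
  by apply: (diagE 1%:M i); rewrite ?det1 ?oner_eq0 // mul1mx trmx1 mulmx1.
have [i [j Sij]] : exists i j, S i j != 0.
  have [//|N] := pselect (exists i j, S i j != 0).
  case/eqP: S0; apply/matrixP => i j; rewrite mxE; apply/eqP/negPn/negP => Sij.
  by case: N; exists i, j.
have ij : i != j by apply: contraNneq Sij => ->; have /negPn := Sd j.
(* With a zero diagonal, the value of [S] at [e_i + e_j] is [2 S i j], which is nonzero. *)
apply: (diagE (1%:M + delta_mx i j) i); last first.
  have : \det ((1%:M + delta_mx i j) *m (1%:M - delta_mx i j) : 'M[R]_n.+1) = 1.
    rewrite mulmxDl mul1mx mulmxBr mulmx1 mul_delta_mx_0 1?eq_sym //.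
    by rewrite subr0 subrK det1.
  rewrite det_mulmx => dE; apply/negP => /eqP d0; move: dE.
  by rewrite d0 mul0r => /esym/eqP; rewrite oner_eq0.
have E (k : 'I_n.+1) : \sum_l (1%:M + delta_mx i j) i l * S l k = S i k + S j k.
  rewrite (eq_bigr (fun l => (i == l)%:R * S l k + (j == l)%:R * S l k)).
    rewrite big_split /= (bigD1 i) //= (bigD1 j (P := predT)) //= !eqxx !mul1r.
    by rewrite !big1 ?addr0 // => l /negPf; rewrite eq_sym => ->; rewrite mul0r.
  by move=> l _; rewrite !mxE eqxx /= [l == j]eq_sym mulrDl.
rewrite mxE (eq_bigr (fun k => (i == k)%:R * (S i k + S j k) + (j == k)%:R * (S i k + S j k))).
  rewrite big_split /= (bigD1 i) //= (bigD1 j (P := predT)) //= !eqxx !mul1r.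
  rewrite !big1 ?addr0; last 2 first.
  - by move=> l /negPf; rewrite eq_sym => ->; rewrite mul0r.
  - by move=> l /negPf; rewrite eq_sym => ->; rewrite mul0r.
  have /negPn/eqP -> := Sd i; have /negPn/eqP -> := Sd j.
  rewrite add0r addr0 (_ : S j i = S i j) ?mulf_neq0 // -?mulr2n.
    by rewrite -mulr_natl mulf_neq0.
  by rewrite -[in LHS]Ssym mxE.
by move=> k _; rewrite -E !mxE eqxx /= [k == j]eq_sym mulrC mulrDl.
Qed.

(** A Schur complement without division: the other [n] rows are multiplied by the pivot, which
    accounts for the determinant. *)
Lemma congr_schur n (S1 : 'M[R]_(1 + n)) : S1^T = S1 ->
  exists2 c : 'M[R]_n, c^T = c & exists C1 : 'M[R]_(1 + n),
    \det C1 = S1 0 0 ^+ n /\ C1 *m S1 *m C1^T = block_mx (S1 0 0)%:M 0 0 c.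
Proof.
move=> S1sym; set s := S1 0 0.
pose b : 'rV_n := ursubmx S1; pose c : 'M_n := drsubmx S1.
have S1E : S1 = block_mx s%:M b b^T c.
  rewrite -[LHS]submxK; congr block_mx.
    apply/matrixP => i j; rewrite !ord1 [RHS]mxE eqxx mulr1n 2!mxE /s.
    by congr (fun_of_matrix S1 _ _); apply: val_inj.
  by rewrite /b trmx_ursub S1sym.
have csym : c^T = c by rewrite /c trmx_drsub S1sym.
clearbody s b c; exists (s *: (s *: c - b^T *m b)).
  by rewrite !linearZ /= !linearB /= linearZ /= csym trmx_mul trmxK.
exists (block_mx 1%:M 0 (- b^T) s%:M); split.
  by rewrite det_lblock det1 mul1r det_scalar.
have bN : (- b^T)^T = - b by rewrite linearN /= trmxK.
rewrite {1}S1E tr_block_mx !mulmx_block !trmx1 !trmx0 bN tr_scalar_mx.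
rewrite !(mul0mx, mul1mx, mulmx0, mulmx1, addr0, add0r, mulNmx, mulmxN).
rewrite !mul_scalar_mx !mul_mx_scalar ?mulmxDl ?mulNmx -?scalemxAl.
rewrite !addNr ?subrr ?mul0mx ?oppr0 ?add0r; congr block_mx.
by rewrite addrC.
Qed.

(** Stated over a domain so that it also applies to matrices over [K[X]]: there the congruence
    degenerates only at the finitely many roots of [\det C]. *)
Lemma congr_diag n (S : 'M[R]_n) : S^T = S ->
  exists2 C : 'M[R]_n, \det C != 0 & exists d, C *m S *m C^T = diag_mx d.
Proof.
elim: n S => [|n IH] S Ssym.
  by exists 1%:M; rewrite ?det1 ?oner_eq0 //; exists 0; apply/matrixP => - [].
have [->|S0] := eqVneq S 0.
  exists 1%:M; rewrite ?det1 ?oner_eq0 //; exists 0.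
  by rewrite mulmx0 mul0mx linear0.
have [C0 dC0 C0S] := congr_pivot Ssym S0.
have S1sym : (C0 *m S *m C0^T)^T = C0 *m S *m C0^T by rewrite !trmx_mul trmxK Ssym mulmxA.
have [c csym [C1 [dC1 C1S]]] := @congr_schur n _ S1sym.
have [C2 dC2 [d C2S]] := IH c csym.
pose C3 : 'M_(1 + n) := block_mx 1%:M 0 0 C2.
have dC3 : \det C3 != 0 by rewrite /C3 det_ublock det1 mul1r.
have E : C3 *m (C1 *m (C0 *m S *m C0^T) *m C1^T) *m C3^T =
    diag_mx (row_mx ((C0 *m S *m C0^T) 0 0)%:M d).
  rewrite C1S /C3 tr_block_mx !mulmx_block !trmx0 !trmx1.
  rewrite !(mul0mx, mul1mx, mulmx0, mulmx1, addr0, add0r) C2S diag_mx_row.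
  by congr block_mx; apply/matrixP => i j; rewrite !ord1 !mxE eqxx.
move: C3 dC3 E => /= C3 dC3 E; exists (C3 *m C1 *m C0).
  by rewrite !det_mulmx !mulf_neq0 // dC1 expf_neq0.
by exists (row_mx ((C0 *m S *m C0^T) 0 0)%:M d : 'rV_(1 + n)); rewrite -[RHS]E !trmx_mul !mulmxA.
Qed.

End Diagonalization.

Section Signature.
Variable K : rcfType.

Definition posdef n (S : 'M[K]_n) :=
  forall x : 'rV_n, x != 0 -> 0 < (x *m S *m x^T) 0 0.

Definition haspos n (S : 'M[K]_n) k :=
  exists U : 'M_(k, n), posdef (U *m S *m U^T).

(* The largest dimension of a positive definite subform, so that sig is the signature
   (on symmetric matrices) by the law of inertia. *)
Definition pos n (S : 'M[K]_n) : nat := \max_(k < n.+1 | `[< haspos S k >]) k.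

Definition sig n (S : 'M[K]_n) : int := (pos S)%:Z - (pos (- S))%:Z.

Lemma posdef_row_free n k (S : 'M[K]_n) (U : 'M_(k, n)) :
  posdef (U *m S *m U^T) -> row_free U.
Proof.
move=> pU; rewrite -kermx_eq0; apply/negPn/negP => /rowV0Pn[v /sub_kermxP vU v0].
by have := pU v v0; rewrite !mulmxA vU !mul0mx mxE ltxx.
Qed.

(** The core of the law of inertia: a positive definite subspace meets a negative semidefinite one
    only in 0. *)
Lemma haspos_leq n k l (S : 'M[K]_n) (W : 'M_(l, n)) : row_free W ->
  (forall y : 'rV_l, (y *m (W *m S *m W^T) *m y^T) 0 0 <= 0) ->
  haspos S k -> (k + l <= n)%N.
Proof.
move=> fW nW [U pU]; have fU := posdef_row_free pU.
rewrite leqNgt; apply/negP => lt.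
have : (U :&: W)%MS != 0.
  rewrite -mxrank_eq0; have := mxrank_sum_cap U W.
  rewrite (eqP fU) (eqP fW) => E; apply/eqP => c0; move: lt.
  by rewrite -E c0 addn0 ltnNge rank_leq_col.
case/rowV0Pn => v; rewrite sub_capmx => /andP[/submxP[x vE] /submxP[y vE']] v0.
have x0 : x != 0 by apply: contraNneq v0 => x0; rewrite vE x0 mul0mx.
have := pU x x0; have := nW y.
rewrite !mulmxA -vE -vE' -!mulmxA -!trmx_mul -vE -vE' => le lt0.
by have := lt_le_trans lt0 le; rewrite ltxx.
Qed.

Lemma haspos_pos n k (S : 'M[K]_n) : haspos S k -> (k <= pos S)%N.
Proof.
move=> h; have kn : (k < n.+1)%N.
  have := @haspos_leq n k 0 S 0; rewrite addn0 ltnS; apply => //.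
    by rewrite /row_free mxrank0.
  by move=> y; rewrite thinmx0 !mul0mx mxE.
by rewrite /pos; apply: (@leq_bigmax_cond _ _ _ (Ordinal kn)); apply/asboolP.
Qed.

Lemma pos_haspos n (S : 'M[K]_n) : haspos S (pos S).
Proof.
have h0 : `[< haspos S (ord0 : 'I_n.+1) >].
  apply/asboolP; exists 0 => x; rewrite thinmx0 eqxx //.
have [|k hk E] := @eq_bigmax_cond _ [pred k : 'I_n.+1 | `[< haspos S k >]] (fun k => k).
  by apply/card_gt0P; exists ord0.
by rewrite (_ : pos S = k) //; apply/asboolP.
Qed.

Lemma pos_leq n l (S : 'M[K]_n) (W : 'M_(l, n)) : row_free W ->
  (forall y : 'rV_l, (y *m (W *m S *m W^T) *m y^T) 0 0 <= 0) ->
  (pos S + l <= n)%N.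
Proof. by move=> fW nW; apply: haspos_leq fW nW _; apply: pos_haspos. Qed.

Lemma pos_congr n (S C : 'M[K]_n) : C \in unitmx -> pos (C *m S *m C^T) = pos S.
Proof.
move=> uC; apply/eqP; rewrite eqn_leq; apply/andP; split; apply: haspos_pos.
  have [U pU] := pos_haspos (C *m S *m C^T); exists (U *m C).
  by rewrite trmx_mul !mulmxA in pU *.
have [U pU] := pos_haspos S; exists (U *m invmx C).
have -> // : U *m invmx C *m (C *m S *m C^T) *m (U *m invmx C)^T = U *m S *m U^T.
rewrite !mulmxA mulmxKV // -!mulmxA -trmx_mul mulmxKV //.
Qed.

Lemma sig_congr n (S C : 'M[K]_n) : C \in unitmx -> sig (C *m S *m C^T) = sig S.
Proof. by move=> uC; rewrite /sig -mulNmx -mulmxN !pos_congr. Qed.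

Lemma sigN n (S : 'M[K]_n) : sig (- S) = - sig S.
Proof. by rewrite /sig opprK opprB. Qed.

Lemma posZ n c (S : 'M[K]_n) : 0 < c -> pos (c *: S) = pos S.
Proof.
move=> c0; have H d T k : 0 < d -> haspos T k -> haspos (d *: T : 'M[K]_n) k.
  move=> d0 [U pU]; exists U => x /pU.
  by rewrite -scalemxAr -!(scalemxAl, scalemxAr) [X in _ -> _ < X]mxE => ?; rewrite mulr_gt0.
apply/eqP; rewrite eqn_leq; apply/andP; split; apply: haspos_pos; last first.
  exact/H/pos_haspos.
rewrite -[S in haspos S](scalerK (lt0r_neq0 c0)); apply: H; rewrite ?invr_gt0 //.
exact: pos_haspos.
Qed.

Lemma sigZ n c (S : 'M[K]_n) : c != 0 -> sig (c *: S) = sgz c * sig S.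
Proof.
have H d : 0 < d -> sig (d *: S) = sig S.
  by move=> d0; rewrite /sig -scalerN !posZ.
rewrite neq_lt => /orP[c0|c0]; last by rewrite H // gtr0_sgz // mul1r.
by rewrite ltr0_sgz // -[c]opprK scaleNr sigN H ?oppr_gt0 // mulN1r.
Qed.

Lemma quad_diag n (d : 'rV[K]_n) (x : 'rV[K]_n) :
  (x *m diag_mx d *m x^T) 0 0 = \sum_i d 0 i * x 0 i ^+ 2.
Proof.
rewrite mul_mx_diag mxE; apply: eq_bigr => i _; rewrite !mxE expr2.
by rewrite mulrAC mulrC mulrA.
Qed.

Lemma pos_diag n (d : 'rV[K]_n) : pos (diag_mx d) = #|[pred i | 0 < d 0 i]|.
Proof.
pose P := [pred i | 0 < d 0 i]; pose Q := [pred i | ~~ (0 < d 0 i)].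
have rowsE (A : pred 'I_n) (y : 'rV[K]_#|A|) :
  (y *m (rowsub (@enum_val _ A) 1%:M *m diag_mx d *m (rowsub (@enum_val _ A) 1%:M)^T) *m y^T) 0 0
   = \sum_k d 0 (enum_val k) * y 0 k ^+ 2.
  suff -> : rowsub (@enum_val _ A) 1%:M *m diag_mx d *m (rowsub (@enum_val _ A) 1%:M)^T =
      diag_mx (\row_k d 0 (enum_val k)).
    by rewrite quad_diag; apply: eq_bigr => k _; rewrite mxE.
  apply/matrixP => a b; rewrite mul_mx_diag !mxE (bigD1 (enum_val a)) //=.
  rewrite !mxE eqxx mul1r big1 ?addr0 => [|i ia].
    rewrite (inj_eq enum_val_inj) [b == a]eq_sym.
    by case: (a =P b) => [->|_]; rewrite ?mulr1 ?mulr1n ?mulr0.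
  by rewrite !mxE [_ == i]eq_sym (negPf ia) !mul0r.
have free (A : pred 'I_n) : row_free (rowsub (@enum_val _ A) (1%:M : 'M[K]_n)).
  apply/row_freeP; exists (colsub (@enum_val _ A) 1%:M); apply/matrixP => a b.
  rewrite !mxE (bigD1 (enum_val a)) //= !mxE eqxx mul1r big1 ?addr0 => [|i ia].
    by rewrite (inj_eq enum_val_inj).
  by rewrite !mxE [_ == i]eq_sym (negPf ia) !mul0r.
have PQ : (#|P| + #|Q|)%N = n by rewrite -[RHS]card_ord; exact: cardC P.
(* The coordinate subspace of the indices with [d 0 i <= 0] bounds [pos] from above, that of the
   positive entries from below. *)
apply/eqP; rewrite eqn_leq; apply/andP; split.
  rewrite -(leq_add2r #|Q|) PQ; apply: (pos_leq (free Q)) => y.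
  rewrite rowsE; apply: sumr_le0 => k _; apply: mulr_le0_ge0; rewrite ?sqr_ge0 //.
  by have := enum_valP k; rewrite inE -leNgt.
apply: haspos_pos; exists (rowsub (@enum_val _ P) 1%:M) => x x0; rewrite rowsE.
have [k xk] : exists k, x 0 k != 0.
  have [//|/forallNP N] := pselect (exists k, x 0 k != 0).
  case/eqP: x0; apply/rowP => k; rewrite mxE; apply/eqP.
  by have /negP := N k; rewrite negbK.
have dk (j : 'I_#|P|) : 0 < d 0 (enum_val j) by have := enum_valP j; rewrite inE.
rewrite (bigD1 k) //= ltr_wpDr //; last first.
  by rewrite mulr_gt0 ?dk // exprn_even_gt0.
by rewrite sumr_ge0 // => j _; rewrite mulr_ge0 ?sqr_ge0 // ltW ?dk.
Qed.

Lemma sig_diag n (d : 'rV[K]_n) : sig (diag_mx d) = \sum_i sgz (d 0 i).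
Proof.
rewrite /sig -linearN /= !pos_diag.
have cE (P : pred 'I_n) : #|P|%:Z = \sum_i (P i)%:R :> int.
  rewrite -sum1_card big_mkcond /= -natz natr_sum.
  by apply: eq_bigr => i _; rewrite -topredE /=; case: (P i).
rewrite !cE -sumrB; apply: eq_bigr => i _; rewrite /= mxE oppr_gt0.
by case: ltrgt0P => [/gtr0_sgz|/ltr0_sgz|->] //; rewrite sgz0.
Qed.

Lemma two_neq0 : (2%:R : K) != 0. Proof. by rewrite pnatr_eq0. Qed.

Lemma congr_diag_unit n (S : 'M[K]_n) : S^T = S ->
  exists2 C : 'M[K]_n, C \in unitmx & exists d, C *m S *m C^T = diag_mx d.
Proof.
move=> /(congr_diag two_neq0)[C dC [d E]]; exists C; last by exists d.
by rewrite unitmxE unitfE.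
Qed.

Lemma pos_negD n (S : 'M[K]_n) : (pos S + pos (- S) <= n)%N.
Proof.
have [W pW] := pos_haspos (- S); apply: (pos_leq (posdef_row_free pW)) => y.
have [->|/pW] := eqVneq y 0; first by rewrite !mul0mx mxE.
by rewrite mulmxN mulNmx mulmxN mulNmx mxE oppr_gt0 => /ltW.
Qed.

Lemma pos_negD_unit n (S : 'M[K]_n) : S^T = S -> S \in unitmx ->
  (pos S + pos (- S) = n)%N.
Proof.
move=> /congr_diag_unit[C uC [d E]] uS.
rewrite -(pos_congr _ uC) -(pos_congr (- S) uC) mulmxN mulNmx E -linearN /= !pos_diag.
have d0 i : d 0 i != 0.
  have : \det (diag_mx d) != 0.
    by rewrite -E !det_mulmx det_tr !mulf_neq0 // -unitfE -unitmxE.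
  by rewrite det_diag => /prodf_neq0; apply.
rewrite -[RHS]card_ord -[RHS](cardC [pred i | 0 < d 0 i]); congr (_ + _)%N.
by apply: eq_card => i; rewrite !inE mxE oppr_gt0 -leNgt le_eqVlt (negPf (d0 i)).
Qed.

Lemma pos_id n : pos (1%:M : 'M[K]_n) = n.
Proof.
rewrite -diag_const_mx pos_diag -[RHS]card_ord; apply: eq_card => i.
by rewrite !inE mxE ltr01.
Qed.

Lemma pos_idN n : pos (- 1%:M : 'M[K]_n) = 0%N.
Proof.
rewrite -diag_const_mx -linearN pos_diag; apply: eq_card0 => i.
by rewrite !inE !mxE oppr_gt0 ltr10.
Qed.

Lemma sig_unit_posdef n (C : 'M[K]_n) : C \in unitmx -> sig (C *m C^T) = n.
Proof.
move=> uC; rewrite -[X in X *m _]mulmx1 sig_congr //.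
by rewrite /sig pos_id pos_idN subr0.
Qed.

(** Dividing by square roots turns the inequalities of [haspos] into one matrix equation, which
    passes to ultraproducts and is easy to perturb. *)
Lemma haspos_normal m k (T : 'M[K]_m) : T^T = T -> haspos T k ->
  exists U : 'M_(k, m), U *m T *m U^T = 1%:M.
Proof.
move=> sT [U pU].
have [|C uC [d Cd]] := @congr_diag_unit _ (U *m T *m U^T).
  by rewrite !trmx_mul trmxK sT mulmxA.
have dgt i : 0 < d 0 i.
  have := pU (row i C); rewrite rowE; set e : 'rV[K]_k := delta_mx 0 i.
  have -> : e *m C *m (U *m T *m U^T) *m (e *m C)^T =
     e *m (C *m (U *m T *m U^T) *m C^T) *m e^T.
    by rewrite trmx_mul !mulmxA.
  rewrite Cd quad_diag (bigD1 i) //= big1 ?addr0 => [|l /negPf li].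
    rewrite mxE !eqxx /= expr1n mulr1; apply.
    rewrite -rowE; apply/negP => /eqP r0.
    move: uC; rewrite -row_free_unit => /row_freeP[B] /(congr1 (row i)).
    rewrite row_mul r0 mul0mx => /rowP/(_ i); rewrite !mxE eqxx => /esym/eqP.
    by rewrite oner_eq0.
  by rewrite mxE li /= expr0n mulr0.
exists (diag_mx (\row_i (Num.sqrt (d 0 i))^-1) *m C *m U).
transitivity (diag_mx (\row_i (Num.sqrt (d 0 i))^-1) *m (C *m (U *m T *m U^T) *m C^T)
   *m diag_mx (\row_i (Num.sqrt (d 0 i))^-1)).
  by rewrite !trmx_mul tr_diag_mx !mulmxA.
rewrite Cd !mulmx_diag -diag_const_mx; congr diag_mx; apply/rowP => i.
rewrite !mxE mulrAC -invfM -expr2 sqr_sqrtr ?ltW // mulVf //.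
by rewrite gt_eqF.
Qed.

(* With split_sig0, this turns sig S = 0 into an existential system of polynomial equations,
   which passes to ultraproducts. *)
Lemma sig0_split n (S : 'M[K]_n) : S^T = S -> S \in unitmx -> sig S = 0 ->
  exists h, (h + h = n)%N /\
    exists U U' : 'M[K]_(h, n), U *m S *m U^T = 1%:M /\ U' *m S *m U'^T = - 1%:M.
Proof.
move=> sS uS /eqP; rewrite subr_eq0 => /eqP[E].
have D := pos_negD_unit sS uS.
have [U UE] := haspos_normal sS (pos_haspos S).
have [|U' U'E] := @haspos_normal _ _ (- S) _ (pos_haspos (- S)); first by rewrite linearN /= sS.
rewrite -E in U' U'E; exists (pos S); rewrite {2}E; split=> //; exists U, U'.
by rewrite UE; split=> //; rewrite -U'E mulmxN mulNmx opprK.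
Qed.

(** Both [pos S] and [pos (- S)] are at least [h], and their sum is at most [n]. *)
Lemma split_sig0 n h (S : 'M[K]_n) (U U' : 'M[K]_(h, n)) : (h + h = n)%N ->
  U *m S *m U^T = 1%:M -> U' *m S *m U'^T = - 1%:M -> sig S = 0.
Proof.
move=> hn UE U'E.
have pd : posdef (1%:M : 'M[K]_h).
  move=> x x0; rewrite -diag_const_mx quad_diag lt_neqAle eq_sym; apply/andP; split.
    apply: contra x0; rewrite psumr_eq0 => [/allP x0|i _]; last first.
      by rewrite mxE mul1r sqr_ge0.
    apply/eqP/rowP => i; have := x0 i (mem_index_enum _).
    by rewrite !mxE mul1r sqrf_eq0 => /eqP.
  by apply: sumr_ge0 => i _; rewrite mxE mul1r sqr_ge0.
have p1 : (h <= pos S)%N by apply: haspos_pos; exists U; rewrite UE.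
have p2 : (h <= pos (- S))%N.
  by apply: haspos_pos; exists U'; rewrite mulmxN mulNmx U'E opprK.
rewrite /sig; move: p1 p2 (pos_negD S); move: (pos S) (pos (- S)) => p q p1 p2.
rewrite -hn => le; have -> : p = h.
  by apply/eqP; rewrite eqn_leq p1 andbT -(leq_add2r h) (leq_trans _ le) // leq_add2l.
have -> : q = h.
  by apply/eqP; rewrite eqn_leq p2 andbT -(leq_add2l h) (leq_trans _ le) // leq_add2r.
by rewrite subrr.
Qed.

Lemma sig_block m n (S : 'M[K]_m) (T : 'M[K]_n) : S^T = S -> T^T = T ->
  sig (block_mx S 0 0 T) = sig S + sig T.
Proof.
move=> /congr_diag_unit[C uC [d E]] /congr_diag_unit[C' uC' [d' E']].
rewrite -(sig_congr S uC) -(sig_congr T uC') E E' !sig_diag.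
have uB : block_mx C 0 0 C' \in unitmx.
  by rewrite unitmxE det_ublock unitrM -!unitmxE uC.
rewrite -(sig_congr _ uB) tr_block_mx !mulmx_block !trmx0.
rewrite !(mul0mx, mulmx0, addr0, add0r) E E' -diag_mx_row sig_diag big_split_ord /=.
by congr (_ + _); apply: eq_bigr => i _; rewrite ?row_mxEl ?row_mxEr.
Qed.

End Signature.

Import VectorInternalTheory.

(** * Symmetric forms on vector spaces *)

Section Forms.
Variable K : rcfType.

(** Pulling a form back along a surjection only enlarges its radical. The isometries below are
    therefore checked for surjectivity alone. *)
Lemma pos_congr_surj m n (S : 'M[K]_n) (F : 'M_(m, n)) : row_full F ->
  pos (F *m S *m F^T) = pos S.
Proof.
move=> /row_fullP[F' F'F]; apply/eqP; rewrite eqn_leq.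
apply/andP; split; apply: haspos_pos.
  have [U pU] := pos_haspos (F *m S *m F^T); exists (U *m F).
  by rewrite trmx_mul !mulmxA in pU *.
have [U pU] := pos_haspos S; exists (U *m F').
suff -> : U *m F' *m (F *m S *m F^T) *m (U *m F')^T = U *m S *m U^T by [].
transitivity (U *m (F' *m F) *m S *m (F' *m F)^T *m U^T).
  by rewrite !trmx_mul !mulmxA.
by rewrite F'F trmx1 !mulmx1.
Qed.

Lemma sig_congr_surj m n (S : 'M[K]_n) (F : 'M_(m, n)) : row_full F ->
  sig (F *m S *m F^T) = sig S.
Proof. by move=> fF; rewrite /sig -mulNmx -mulmxN !pos_congr_surj. Qed.

Record symform (V : lmodType K) (B : V -> V -> K) : Prop := SymForm {
  symformP : forall a x y z, B (a *: x + y) z = a * B x z + B y z;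
  symformC : forall x y, B x y = B y x }.

Section Symform.
Variables (V : lmodType K) (B : V -> V -> K) (sB : symform B).

Lemma symformDl x y z : B (x + y) z = B x z + B y z.
Proof. by rewrite -[x]scale1r (symformP sB) mul1r scale1r. Qed.

Lemma symform0l z : B 0 z = 0.
Proof. by apply: (addrI (B 0 z)); rewrite -symformDl !addr0. Qed.

Lemma symformZl a x z : B (a *: x) z = a * B x z.
Proof. by rewrite -[_ *: x]addr0 (symformP sB) symform0l addr0. Qed.

Lemma symform_suml (I : finType) (F : I -> V) z : B (\sum_i F i) z = \sum_i B (F i) z.
Proof. by apply: (big_morph (B^~ z)) => [x y|]; rewrite ?symformDl ?symform0l. Qed.

Lemma symformZr a x z : B z (a *: x) = a * B z x.
Proof. by rewrite !(symformC sB z) symformZl. Qed.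

Lemma symform_sumr (I : finType) (F : I -> V) z : B z (\sum_i F i) = \sum_i B z (F i).
Proof. by rewrite (symformC sB) symform_suml; apply: eq_bigr => i _; rewrite (symformC sB). Qed.

End Symform.

Lemma symform_mx n (S : 'M[K]_n) : S^T = S ->
  symform (fun x y : 'rV_n => (x *m S *m y^T) 0 0).
Proof.
move=> sS; split=> [a x y z|x y]; first by rewrite !mulmxDl -!scalemxAl !mxE.
by rewrite -[in RHS]sS -[y in RHS]trmxK -mulmxA -!trmx_mul [RHS]mxE mulmxA.
Qed.

Definition gram (V : vectType K) (B : V -> V -> K) : 'M[K]_(dim V) :=
  \matrix_(i, j) B (r2v (delta_mx 0 i)) (r2v (delta_mx 0 j)).

Definition sigf (V : vectType K) (B : V -> V -> K) : int := sig (gram B).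

Lemma gram_sym (V : vectType K) (B : V -> V -> K) : symform B -> (gram B)^T = gram B.
Proof. by move=> sB; apply/matrixP => i j; rewrite !mxE (symformC sB). Qed.

Lemma gram_pull (V : vectType K) (B : V -> V -> K) n (f : 'rV_n -> V) :
  symform B -> linear f -> forall i j,
  B (f (delta_mx 0 i)) (f (delta_mx 0 j)) =
  (lin1_mx (v2r \o f) *m gram B *m (lin1_mx (v2r \o f))^T) i j.
Proof.
move=> sB fl i j.
have E k : f (delta_mx 0 k) = \sum_l lin1_mx (v2r \o f) k l *: r2v (delta_mx 0 l).
  rewrite -[LHS]v2rK {1}[v2r _]row_sum_delta linear_sum; apply: eq_bigr => l _.
  by rewrite linearZ mxE.
rewrite (E i) (E j) symform_suml // [RHS]mxE.
rewrite [RHS](eq_bigr (fun l => \sum_k lin1_mx (v2r \o f) i k * gram B k l * lin1_mx (v2r \o f) j l)).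
  rewrite exchange_big /=; apply: eq_bigr => k _; rewrite symform_sumr //.
  by apply: eq_bigr => l _; rewrite symformZl // symformZr // [gram B _ _]mxE; ring.
by move=> l _; rewrite [_^T l j]mxE [X in X * _]mxE mulr_suml.
Qed.

Lemma sigf_mx (V : vectType K) (B : V -> V -> K) n (S : 'M_n) (f : 'rV_n -> V) :
  symform B -> linear f -> (forall v, exists x, f x = v) ->
  (forall i j, S i j = B (f (delta_mx 0 i)) (f (delta_mx 0 j))) ->
  sigf B = sig S.
Proof.
move=> sB fl fS SE.
have -> : S = lin1_mx (v2r \o f) *m gram B *m (lin1_mx (v2r \o f))^T.
  by apply/matrixP => i j; rewrite -gram_pull.
rewrite sig_congr_surj //.
have gl : linear (v2r \o f) by move=> a x y /=; rewrite fl linearP.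
pose ga := GRing.isLinear.Build _ _ _ _ (v2r \o f) gl.
pose g : {linear 'rV[K]_n -> 'rV[K]_(dim V)} := HB.pack (v2r \o f) ga.
rewrite -sub1mx; apply/row_subP => i.
have [x xE] := fS (r2v (row i 1%:M)).
apply/submxP; exists x.
by rewrite (mul_rV_lin1 g) /= xE r2vK.
Qed.

Lemma sigf_isom (V W : vectType K) (B : V -> V -> K) (B' : W -> W -> K) (f : V -> W) :
  symform B' -> linear f -> (forall w, exists v, f v = w) ->
  (forall x y, B x y = B' (f x) (f y)) -> sigf B = sigf B'.
Proof.
move=> sB' fl fS BE; rewrite (@sigf_mx _ B' _ (gram B) (f \o r2v)) //.
- by move=> a x y /=; rewrite linearP fl.
- by move=> w; have [v <-] := fS w; exists (v2r v); rewrite /= v2rK.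
by move=> i j; rewrite mxE BE.
Qed.

Lemma eq_sigf (V : vectType K) (B B' : V -> V -> K) : B =2 B' -> sigf B = sigf B'.
Proof. by move=> BE; congr sig; apply/matrixP => i j; rewrite !mxE BE. Qed.

Lemma sigf_row n (S : 'M[K]_n) : S^T = S ->
  sigf (fun x y : 'rV_n => (x *m S *m y^T) 0 0) = sig S.
Proof.
move=> sS; apply: (@sigf_mx _ _ _ _ id) => //.
- exact: symform_mx.
- by move=> v; exists v.
by move=> i j; rewrite -rowE mxE (bigD1 j) //= big1 => [|k /negPf kj]; 
  rewrite !mxE ?eqxx ?mulr1 ?addr0 // kj mulr0.
Qed.

Lemma symform_sum (V W : vectType K) (B : V -> V -> K) (B' : W -> W -> K) :
  symform B -> symform B' ->
  symform (fun x y : (V * W)%type => B x.1 y.1 + B' x.2 y.2).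
Proof.
move=> sB sB'; split=> [a x y z|x y] /=; last by rewrite (symformC sB) (symformC sB').
by rewrite (symformP sB) (symformP sB'); ring.
Qed.

Lemma sigf_sum (V W : vectType K) (B : V -> V -> K) (B' : W -> W -> K) :
  symform B -> symform B' ->
  sigf (fun x y : (V * W)%type => B x.1 y.1 + B' x.2 y.2) = sigf B + sigf B'.
Proof.
move=> sB sB'.
have -> : sigf B + sigf B' = sig (block_mx (gram B) 0 0 (gram B')).
  by rewrite sig_block ?gram_sym.
apply: (@sigf_mx _ _ _ _ (fun x : 'rV_(dim V + dim W) => (r2v (lsubmx x), r2v (rsubmx x)))).
- exact: symform_sum.
- by move=> a x y; rewrite !linearP.
- by move=> [v w]; exists (row_mx (v2r v) (v2r w)); rewrite row_mxKl row_mxKr !v2rK.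
have l0 (i : 'I_(dim W)) : lsubmx (delta_mx 0 (rshift (dim V) i) : 'rV[K]__) = 0.
  by apply/rowP => j; rewrite !mxE eqxx eq_lrshift.
have r0 (i : 'I_(dim V)) : rsubmx (delta_mx 0 (lshift (dim W) i) : 'rV[K]__) = 0.
  by apply/rowP => j; rewrite !mxE eqxx eq_rlshift.
have ll (i : 'I_(dim V)) : lsubmx (delta_mx 0 (lshift (dim W) i) : 'rV[K]__) = delta_mx 0 i.
  by apply/rowP => j; rewrite !mxE eqxx eq_lshift.
have rr (i : 'I_(dim W)) : rsubmx (delta_mx 0 (rshift (dim V) i) : 'rV[K]__) = delta_mx 0 i.
  by apply/rowP => j; rewrite !mxE eqxx eq_rshift.
move=> i j; case: (split_ordP i) => k ->; case: (split_ordP j) => l -> /=;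
  rewrite ?(block_mxEul, block_mxEur, block_mxEdl, block_mxEdr) ?ll ?rr ?l0 ?r0 !linear0;
  rewrite ?(symform0l sB) ?(symform0l sB') ?(symformC sB _ 0) ?(symformC sB' _ 0);
  by rewrite ?(symform0l sB) ?(symform0l sB') ?addr0 ?add0r mxE.
Qed.

(** An anti-isometry from [B] onto itself gives [sigf B = - sigf B]. *)
Lemma sigf_anti (V : vectType K) (B : V -> V -> K) (f : V -> V) :
  symform B -> linear f -> (forall w, exists v, f v = w) ->
  (forall x y, B (f x) (f y) = - B x y) -> sigf B = 0.
Proof.
move=> sB fl fS E; have := @sigf_isom _ _ (fun x y => - B x y) B f sB fl fS.
rewrite (_ : sigf (fun x y => - B x y) = - sigf B).
  move=> /(_ (fun x y => esym (E x y)))/eqP.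
  by rewrite eq_sym -subr_eq0 opprK -mulr2n mulrn_eq0 /= => /eqP.
by rewrite -sigN; congr sig; apply/matrixP => i j; rewrite !mxE.
Qed.

End Forms.

(** * Transfer along Euler's functional *)

Section Residue.
Variable K : rcfType.

(* Euler's functional on K[X]/f: the coefficient of degree deg f - 1 of the remainder. *)
Definition tau (F : fieldType) (f h : {poly F}) : F := (h %% f)`_(size f).-2.

Lemma tauP (F : fieldType) (f : {poly F}) a (h h' : {poly F}) :
  tau f (a *: h + h') = a * tau f h + tau f h'.
Proof. by rewrite /tau modpD modpZl coefD coefZ. Qed.

Lemma tauD (F : fieldType) (f h h' : {poly F}) : tau f (h + h') = tau f h + tau f h'.
Proof. by rewrite /tau modpD coefD. Qed.

Lemma tauZ (F : fieldType) a (f h : {poly F}) : tau f (a *: h) = a * tau f h.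
Proof. by rewrite /tau modpZl coefZ. Qed.

Lemma tau0 (F : fieldType) (f : {poly F}) : tau f 0 = 0.
Proof. by rewrite /tau mod0p coef0. Qed.

Lemma tau_sum (F : fieldType) (f : {poly F}) (I : finType) (H : I -> {poly F}) :
  tau f (\sum_i H i) = \sum_i tau f (H i).
Proof. by apply: big_morph; [exact: tauD | exact: tau0]. Qed.

Lemma tau_dvd (F : fieldType) (f h : {poly F}) : f %| h -> tau f h = 0.
Proof. by rewrite /tau => /eqP ->; rewrite coef0. Qed.

(** Multiplication by [f2] identifies [K[X]/f1] with the ideal generated by [f2] modulo [f1 * f2];
    since [f2] is monic, it preserves the coefficient read off by Euler's functional. *)
Lemma tau_mulf (f1 f2 h : {poly K}) : f1 \is monic -> f2 \is monic ->
  tau (f1 * f2) (f2 * h) = tau f1 h.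
Proof.
move=> m1 m2; have modE : (f2 * h) %% (f1 * f2) = f2 * (h %% f1).
  symmetry; apply: (@modpP _ _ (h %/ f1)).
    by rewrite [in LHS](divp_eq h f1); ring.
  have [->|g0] := eqVneq (h %% f1) 0.
    by rewrite mulr0 size_poly0 size_poly_gt0 mulf_neq0 // monic_neq0.
  rewrite !size_mul //; try exact: monic_neq0.
  rewrite [X in (X.-1 < _)%N]addnC.
  have := ltn_modp h f1; rewrite monic_neq0 // => lt.
  have : (0 < size f2)%N by rewrite size_poly_gt0 monic_neq0.
  by case: (size f2) => // n _; rewrite !addnS /= ltn_add2r.
rewrite /tau modE.
(* For constant [f1] the truncated [(size f1).-2] is no longer the degree minus one, but then the
   remainder is 0. *)
have [/eqP|sf1] := eqVneq (size f1) 1%N.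
  rewrite size_poly_eq1 => f11.
  by rewrite (_ : h %% f1 = 0) ?mulr0 ?coef0 //; apply/modp_eq0; rewrite (eqp_dvdl h f11) dvd1p.
have f1n : f1 != 0 by rewrite monic_neq0.
have f2n : f2 != 0 by rewrite monic_neq0.
have := ltn_modp h f1; rewrite f1n; set g := h %% f1 => sg.
have [n s1] : exists n, size f1 = n.+2.
  by move: sf1 (f1n); rewrite -size_poly_eq0; case: (size f1) => [|[|n]] // _ _; exists n.
have [d s2] : exists d, size f2 = d.+1.
  by move: (f2n); rewrite -size_poly_eq0; case: (size f2) => [|d] // _; exists d.
have -> : (size (f1 * f2)%R).-2 = (d + n)%N by rewrite size_Mmonic // s1 s2 addnS /= addnC.
rewrite s1 /=.
have [g0|gn] := eqVneq g`_n 0; last first.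
  have sgE : size g = n.+1.
    apply/eqP; rewrite eqn_leq -ltnS -s1 sg ltnNge.
    by apply: contra gn => ?; rewrite nth_default.
  have g_neq0 : g != 0 by rewrite -size_poly_eq0 sgE.
  have sz : size (f2 * g) = (d + n).+1 by rewrite size_mul // s2 sgE addSn addnS.
  have := lead_coefM f2 g; rewrite !lead_coefE sz s2 sgE /= => ->.
  by have /monicP := m2; rewrite lead_coefE s2 /= => ->; rewrite mul1r.
rewrite g0 nth_default //.
have sgn : (size g <= n)%N.
  move: sg; rewrite s1 ltnS leq_eqVlt => /orP[/eqP sgE|//].
  have : lead_coef g = 0 by rewrite lead_coefE sgE.
  by move/eqP; rewrite lead_coef_eq0 => /eqP g00; move: sgE; rewrite g00 size_poly0.
by rewrite (leq_trans (size_polyMleq _ _)) // s2 addSn leq_add2l.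
Qed.

Lemma coprimep_bezout (F : fieldType) (p q : {poly F}) : coprimep p q ->
  exists u v, u * p + v * q = 1.
Proof.
move=> /Bezout_coprimepP[[u v] /=]; rewrite -size_poly_eq1 => /eqP s1.
have := @size1_polyC _ (u * p + v * q); rewrite s1 => /(_ isT).
set c := _`_0 => E; have c0 : c != 0.
  by apply: contra_eq_neq s1 => c0; rewrite E c0 size_poly0.
exists (c^-1 *: u), (c^-1 *: v); rewrite -!scalerAl -scalerDr E -mul_polyC -polyCM mulVf //.
Qed.

(* The form (u, v) |-> tau (u^T M v) on (K[X]/f)^m, the rows of u and v listing coefficients. *)
Definition resform m r (f : {poly K}) (M : 'M[{poly K}]_m) (u v : 'M[K]_(m, r)) : K :=
  \sum_a \sum_b tau f (rVpoly (row a u) * M a b * rVpoly (row b v)).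

Lemma symform_res m r (f : {poly K}) (M : 'M[{poly K}]_m) : M^T = M ->
  symform (@resform m r f M).
Proof.
move=> sM; split=> [a x y z|x y]; rewrite /resform.
  rewrite mulr_sumr -big_split; apply: eq_bigr => i _ /=.
  rewrite mulr_sumr -big_split; apply: eq_bigr => j _ /=.
  by rewrite !linearP /= !mulrDl -!scalerAl tauP.
rewrite exchange_big; apply: eq_bigr => i _; apply: eq_bigr => j _.
by rewrite -[M in LHS]sM mxE; congr tau; ring.
Qed.

(** The Chinese remainder theorem: the ideals generated by [f1] and [f2] are orthogonal modulo
    [f1 * f2]. Two elements of the second one have a product divisible by the square of [f2];
    [tau_mulf] removes one factor [f2] and the other stays on [M]. *)
Lemma resform_split m r1 r2 (f1 f2 : {poly K}) (M : 'M[{poly K}]_m) : M^T = M ->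
  f1 \is monic -> f2 \is monic -> coprimep f1 f2 ->
  size f1 = r1.+1 -> size f2 = r2.+1 ->
  sigf (@resform m (r1 + r2) (f1 * f2) M) =
    sigf (@resform m r1 f1 (f2 *: M)) + sigf (@resform m r2 f2 (f1 *: M)).
Proof.
move=> sM m1 m2 cop s1 s2.
rewrite -sigf_sum; try by apply: symform_res; rewrite linearZ /= sM.
have f1n : f1 != 0 by rewrite monic_neq0.
pose phi (x : 'M[K]_(m, r1) * 'M[K]_(m, r2)) : 'M[K]_(m, r1 + r2) :=
  \matrix_i poly_rV (f2 * rVpoly (row i x.1) + f1 * rVpoly (row i x.2)).
have phiE x i : rVpoly (row i (phi x)) = f2 * rVpoly (row i x.1) + f1 * rVpoly (row i x.2).
  rewrite rowK poly_rV_K // (leq_trans (size_polyD _ _)) // geq_max.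
  rewrite !(leq_trans (size_polyMleq _ _)) // ?s1 ?s2 addSn /=.
    by rewrite leq_add2l size_poly.
  by rewrite addnC leq_add2r size_poly.
symmetry; apply: (@sigf_isom _ _ _ _ _ phi); first exact: symform_res.
- move=> a x y; apply/row_matrixP => i; rewrite linearP /= !rowK -[RHS]linearP.
  by congr (poly_rV _); rewrite !linearP /= scalerDr !mulrDr -!scalerAr addrACA.
- move=> w; have [a [b ab]] := coprimep_bezout cop.
  pose W i := rVpoly (row i w).
  pose u i := (b * W i) %% f1.
  have dv i : f1 %| W i - f2 * u i.
    have -> : W i - f2 * u i = f1 * (a * W i + f2 * ((b * W i) %/ f1)).
      have Wi : W i = f1 * (a * W i) + f2 * (b * W i).
        by rewrite -[LHS]mul1r -ab; ring.
      by rewrite {1}Wi /u {1}(divp_eq (b * W i) f1); ring.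
    exact: dvdp_mulIl.
  pose v i := (W i - f2 * u i) %/ f1.
  exists (\matrix_i poly_rV (u i), \matrix_i poly_rV (v i)).
  have su i : (size (u i) <= r1)%N by rewrite -ltnS -s1 ltn_modp.
  have sv i : (size (v i) <= r2)%N.
    rewrite size_divp // s1 /= leq_subLR (leq_trans (size_polyD _ _)) //.
    rewrite geq_max size_poly size_polyN (leq_trans (size_polyMleq _ _)) // s2 addSn /=.
    by rewrite addnC leq_add2r.
  apply/row_matrixP => i; apply: (can_inj (@rVpolyK _ _)).
  rewrite phiE !rowK !poly_rV_K // /v [f1 * _]mulrC divpK // addrC subrK //.
move=> x y; rewrite /resform -big_split; apply: eq_bigr => i _ /=.
rewrite -big_split; apply: eq_bigr => j _ /=; rewrite !phiE !mxE.
set a := rVpoly _; set b := rVpoly (row j y.1); set c := rVpoly _; set d := rVpoly (row j y.2).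
rewrite -(tau_mulf _ m1 m2) -[in X in _ + X](tau_mulf _ m2 m1) [f2 * f1]mulrC.
have -> : (f2 * a + f1 * c) * M i j * (f2 * b + f1 * d) =
   f2 * (a * (f2 * M i j) * b) + f1 * (c * (f1 * M i j) * d) +
   (f2 * f1) * (a * M i j * d + c * M i j * b) by ring.
by rewrite 2!tauD [X in _ + _ + X]tau_dvd ?addr0 // mulrC dvdp_mulIl.
Qed.

(** Euler's functional modulo [X - x] is evaluation at [x]. *)
Lemma resform_lin m x (M : 'M[{poly K}]_m) : M^T = M ->
  sigf (@resform m 1 ('X - x%:P) M) = sig (map_mx (horner^~ x) M).
Proof.
move=> sM; apply: (@sigf_mx _ _ _ _ _ (fun v : 'rV_m => v^T)); first exact: symform_res.
- by move=> a u v; rewrite linearP.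
- by move=> v; exists v^T; rewrite trmxK.
move=> i j; rewrite mxE /resform.
have E (k l : 'I_m) : rVpoly (row k (delta_mx 0 l : 'rV_m)^T) = (k == l)%:R%:P :> {poly K}.
  rewrite -[RHS](@poly_rV_K _ 1 _ (size_polyC_leq1 _)).
  by congr (rVpoly _); apply/rowP => a; rewrite !ord1 !mxE coefC /=.
rewrite (bigD1 i) //= (bigD1 j) //= !E !eqxx mulr1 mul1r big1 ?addr0 => [|k /negPf kj]; last first.
  by rewrite !E kj mulr0 tau0.
rewrite big1 ?addr0 => [|k /negPf ki]; last by rewrite big1 // => l _; rewrite !E ki !mul0r tau0.
by rewrite /tau modp_XsubC size_XsubC /= coefC.
Qed.

Lemma tau_congr (f h h' : {poly K}) : f %| h - h' -> tau f h = tau f h'.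
Proof. by move=> d; rewrite -[h](subrK h') tauD tau_dvd // add0r. Qed.

(** The factor is the minimal polynomial of a root [a + b i] in the algebraically closed [K[i]]: a
    remainder of degree at most one that vanishes there is 0, because [b != 0]. *)
Lemma quad_factor (q : {poly K}) : (1 < size q)%N -> (forall x, ~~ root q x) ->
  exists a b, b != 0 /\ ('X - a%:P) ^+ 2 + (b ^+ 2)%:P %| q.
Proof.
move=> sq rq.
have sz : size (map_poly (real_complex K) q) != 1%N.
  by rewrite size_map_poly neq_ltn sq orbT.
have [[a b] /rootP mu] := closed_rootP _ sz; exists a, b.
set d := _ + _.
have dE : (map_poly (real_complex K) d).[Complex a b] = 0.
  rewrite /d rmorphD rmorphXn rmorphB /= map_polyX !map_polyC /= !hornerE.
  by simpc; congr Complex; ring.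
have sd : size d = 3%N.
  rewrite /d size_polyDl size_exp_XsubC // (leq_ltn_trans (size_polyC_leq1 _)) //.
have d0 : d != 0 by rewrite -size_poly_eq0 sd.
have b0 : b != 0.
  apply/eqP => b0; move/negP: (rq a); apply; apply/rootP.
  have : (map_poly (real_complex K) q).[(a%:C)%C] = 0 by rewrite -[RHS]mu b0.
  by rewrite horner_map => -[].
split=> //; rewrite /dvdp -/d; set r := q %% d.
have rE : r = r`_1 *: 'X + (r`_0)%:P.
  have sr : (size r < 3)%N by rewrite -[X in (_ < X)%N]sd ltn_modp.
  apply/polyP => i; rewrite coefD coefZ coefX coefC.
  case: i => [|[|n]] /=; rewrite ?mulr0 ?mulr1 ?add0r ?addr0 //.
  by rewrite nth_default // -ltnS (leq_trans sr).
have : (map_poly (real_complex K) r).[Complex a b] = 0.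
  move: mu; rewrite (divp_eq q d) rmorphD rmorphM /= hornerD hornerM dE mulr0 add0r.
  by [].
rewrite rE rmorphD /= linearZ_LR /= map_polyX map_polyC /= !hornerE.
rewrite /real_complex_def; simpc => -[E0 E1].
have r1 : r`_1 = 0 by move/eqP: E1; rewrite mulf_eq0 (negPf b0) orbF => /eqP.
by move: E0; rewrite r1 mul0r add0r => ->; rewrite scale0r addr0.
Qed.

(* Multiplication by j, a square root of -1 modulo f, is an anti-isometry. *)
Lemma resform_anti m r (f j : {poly K}) (M : 'M[{poly K}]_m) : M^T = M ->
  size f = r.+1 -> f %| j ^+ 2 + 1 -> sigf (@resform m r f M) = 0.
Proof.
move=> sM sf fj; have f0 : f != 0 by rewrite -size_poly_eq0 sf.
pose J (u : 'M[K]_(m, r)) : 'M[K]_(m, r) := \matrix_i poly_rV ((j * rVpoly (row i u)) %% f).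
have JE i u : rVpoly (row i (J u)) = (j * rVpoly (row i u)) %% f.
  by rewrite rowK poly_rV_K // -ltnS -sf ltn_modp.
have Jl : linear J.
  move=> a x y; apply/row_matrixP => i; rewrite linearP /= !rowK -[RHS]linearP.
  by congr (poly_rV _); rewrite !linearP /= mulrDr -scalerAr modpD modpZl.
have modE (g : {poly K}) : f %| g - (g %% f).
  by rewrite [X in X - _](divp_eq g f) addrK dvdp_mull.
apply: (@sigf_anti _ _ _ J) => //; first exact: symform_res.
  (* Since [j ^+ 2 = -1] modulo [f], the inverse of [J] is [- J]. *)
  move=> w; exists (- J w); apply/row_matrixP => i; apply: (can_inj (@rVpolyK _ _)).
  rewrite JE linearN /= linearN /= JE mulrN modpN modp_mul mulrA -expr2.
  have -> : j ^+ 2 * rVpoly (row i w) = (j ^+ 2 + 1) * rVpoly (row i w) - rVpoly (row i w) by ring.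
  rewrite modpD modp_eq0 ?dvdp_mulr // add0r modpN opprK modp_small //.
  by rewrite sf ltnS size_poly.
move=> x y; rewrite /resform -sumrN; apply: eq_bigr => a _; rewrite -sumrN; apply: eq_bigr => b _.
rewrite !JE -mulN1r -tauZ; apply: tau_congr.
move: (modE (j * rVpoly (row a x))) (modE (j * rVpoly (row b y))).
set X := rVpoly (row a x); set Y := rVpoly (row b y); set X' := _ %% f; set Y' := _ %% f.
move: fj => /dvdpP[u uE] /dvdpP[v vE] /dvdpP[w wE].
have -> : X' = j * X - v * f by rewrite -vE; ring.
have -> : Y' = j * Y - w * f by rewrite -wE; ring.
rewrite scaleN1r opprK; apply/dvdpP.
exists (u * X * M a b * Y - v * M a b * (j * Y - w * f) - j * X * M a b * w).
have -> : u * X * M a b * Y - v * M a b * (j * Y - w * f) - j * X * M a b * w =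
  u * (X * M a b * Y) - v * M a b * (j * Y - w * f) - j * X * M a b * w by ring.
by rewrite !mulrBl [u * _ * f]mulrAC -uE; ring.
Qed.

Lemma resform_noroot m r (f : {poly K}) (M : 'M[{poly K}]_m) : M^T = M ->
  f \is monic -> size f = r.+1 -> separable_poly f -> (forall x, ~~ root f x) ->
  sigf (@resform m r f M) = 0.
Proof.
have [n] := ubnP r; elim: n r f M => // n IH [|r] f M rn sM mf sf sepf nr.
  (* A constant [f] gives the zero space, so any [j] serves. *)
  have f1 : f %= 1 by rewrite -size_poly_eq1 sf.
  by apply: (@resform_anti _ _ _ 0) => //; rewrite (eqp_dvdl _ f1) dvd1p.
have [|a [b [b0 df]]] := quad_factor _ nr; first by rewrite sf.
set d := _ + _ in df.
have sd : size d = 3%N.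
  by rewrite /d size_polyDl size_exp_XsubC // (leq_ltn_trans (size_polyC_leq1 _)).
have md : d \is monic.
  rewrite monicE /d lead_coefDl ?lead_coef_exp ?lead_coefXsubC ?expr1n //.
  by rewrite size_exp_XsubC (leq_ltn_trans (size_polyC_leq1 _)).
have /dvdpP[g fE] := df.
have mg : g \is monic by move: mf; rewrite fE monicMr.
have g0 : g != 0 by rewrite monic_neq0.
have [r2 sg] : exists r2, size g = r2.+1.
  by move: g0; rewrite -size_poly_eq0; case: (size g) => // k _; exists k.
have rE : r.+1 = (2 + r2)%N.
  by apply: succn_inj; rewrite -sf fE size_Mmonic // sg sd addnC.
move: sepf; rewrite fE mulrC separable_mul => /and3P[_ sepg cop].
rewrite rE resform_split //.
(* [j = (X - a) / b] satisfies [j ^+ 2 + 1 = d / b ^+ 2]. *)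
rewrite (@resform_anti _ _ _ (b^-1 *: ('X - a%:P))) ?linearZ /= ?sM //; last first.
  rewrite (_ : _ + 1 = (b ^- 2) *: d) ?dvdpZr ?dvdpp ?invr_eq0 ?expf_neq0 //.
  rewrite exprZn exprVn /d scalerDr; congr (_ + _).
  by rewrite -mul_polyC -polyCM mulVf // expf_neq0.
rewrite add0r; apply: IH => //; rewrite ?linearZ /= ?sM //.
  by rewrite -ltnS (leq_trans _ rn) // rE !addSn ltnS add0n ltnW.
move=> x; apply: contra (nr x); rewrite fE rootM => ->; by rewrite ?orbT.
Qed.

(** Splitting off a root x of f = (X - x) g scales the summand at x by g(x) = f'(x) and the one at
    another root y by y - x, which completes g'(y) to f'(y). The factor of [f] without roots in [K]
    contributes nothing. *)
Lemma resform_sig m r (f : {poly K}) (M : 'M[{poly K}]_m) (s : seq K) : M^T = M ->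
  f \is monic -> size f = r.+1 -> separable_poly f -> uniq s ->
  (forall x, (x \in s) = root f x) ->
  sigf (@resform m r f M) =
    \sum_(x <- s) sgz (f^`()).[x] * sig (map_mx (horner^~ x) M).
Proof.
elim: s r f M => [|x s IH] r f M sM mf sf sepf us sE.
  by rewrite big_nil; apply: resform_noroot => // x; rewrite -sE.
have /factor_theorem[g fE] : root f x by rewrite -sE mem_head.
have mX := monicXsubC x.
have mg : g \is monic by move: mf; rewrite fE monicMr.
have g0 : g != 0 by rewrite monic_neq0.
have [r2 sg] : exists r2, size g = r2.+1.
  by move: g0; rewrite -size_poly_eq0; case: (size g) => // k _; exists k.
have rE : r = (1 + r2)%N.
  by apply: succn_inj; rewrite -sf fE size_Mmonic // sg size_XsubC addnC.
move: sepf; rewrite fE mulrC separable_mul => /and3P[_ sepg cop].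
move: us => /= /andP[xs us].
have gx : g.[x] != 0.
  by apply: (coprimep_root cop); rewrite root_XsubC.
rewrite rE resform_split ?size_XsubC // resform_lin ?linearZ /= ?sM //.
rewrite (IH _ _ _ _ mg sg sepg us) ?linearZ /= ?sM //; last first.
  move=> y; have := sE y; rewrite inE fE rootM root_XsubC.
  by case: (eqVneq y x) => [->|] /=; rewrite ?orbF ?orbT ?(negPf xs) //= => _; rewrite rootE (negPf gx).
have mapZ (p : {poly K}) y : map_mx (horner^~ y) (p *: M) = p.[y] *: map_mx (horner^~ y) M.
  by apply/matrixP => i j; rewrite !mxE hornerM.
have dE y : (('X - x%:P) * g)^`().[y] = g.[y] + (y - x) * g^`().[y].
  by rewrite derivM derivXsubC mul1r hornerD hornerM hornerXsubC.
rewrite [RHS]big_cons; congr (_ + _).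
  by rewrite mapZ (@sigZ K m g.[x]) // dE subrr mul0r addr0.
apply: eq_big_seq => y ys; rewrite mapZ hornerXsubC.
have yx : y - x != 0 by rewrite subr_eq0; apply: contraNneq xs => <-.
rewrite (@sigZ K m (y - x)) // mulrA -sgzM dE.
have -> : g.[y] = 0.
  apply/rootP; have := sE y; rewrite inE ys orbT fE rootM root_XsubC => /esym.
  by rewrite -subr_eq0 (negPf yx) orbF.
by rewrite add0r [g^`().[y] * _]mulrC.
Qed.

End Residue.

(** * Separation of roots *)

Section Thom.
Variable K : rcfType.

Lemma sgr_between (u v w : K) : u <= v <= w -> Num.sg u = Num.sg w -> Num.sg v = Num.sg u.
Proof.
move=> /andP[uv vw]; case: (sgrP u) => [u0|u0|u0] E.
- have /eqP w0 : w == 0 by rewrite -sgr_eq0 -E.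
  by rewrite (_ : v = 0) ?sgr0 //; apply: le_anti; rewrite -{2}u0 -{1}w0 uv vw.
- by rewrite gtr0_sg // (lt_le_trans u0).
- by rewrite ltr0_sg // (le_lt_trans vw) // -sgr_lt0 -E ltrN10.
Qed.

(** Induction on the degree: the sign of g' is constant between [a] and [b], so [g] is monotone
    there, and its equal signs at the two ends force the sign in between. *)
Lemma thom_convex (g : {poly K}) a b x : a < x < b ->
  (forall k, Num.sg (g^`(k)).[a] = Num.sg (g^`(k)).[b]) ->
  forall k, Num.sg (g^`(k)).[x] = Num.sg (g^`(k)).[a].
Proof.
have [n] := ubnP (size g); elim: n g a b x => // n IH g a b x gn /andP[ax xb] H.
have [->|g0] := eqVneq g 0; first by move=> k; rewrite linear0 !horner0.
have IH' y : a < y < b -> forall k, Num.sg (g^`()^`(k)).[y] = Num.sg (g^`()^`(k)).[a].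
  move=> aby; apply: (IH _ a b) => // [|k].
    by rewrite -ltnS (leq_trans _ gn) // ltnS lt_size_deriv.
  by rewrite -derivSn H.
have gax : Num.sg g.[x] = Num.sg g.[a].
  have [c1 c1in E1] := poly_mvt g ax; have [c2 c2in E2] := poly_mvt g xb.
  have D1 : Num.sg (g^`()).[c1] = Num.sg (g^`()).[a].
    apply: (IH' c1 _ 0%N); move: c1in; rewrite in_itv /= => /andP[-> c1x].
    exact: lt_trans c1x xb.
  have D2 : Num.sg (g^`()).[c2] = Num.sg (g^`()).[a].
    apply: (IH' c2 _ 0%N); move: c2in; rewrite in_itv /= => /andP[xc2 ->].
    by rewrite (lt_trans ax xc2).
  have S1 : Num.sg (g.[x] - g.[a]) = Num.sg (g^`()).[a].
    by rewrite E1 sgrM D1 [X in _ * X]gtr0_sg ?mulr1 // subr_gt0.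
  have S2 : Num.sg (g.[b] - g.[x]) = Num.sg (g^`()).[a].
    by rewrite E2 sgrM D2 [X in _ * X]gtr0_sg ?mulr1 // subr_gt0.
  have Hab := H 0%N; rewrite !derivn0 in Hab.
  have [d0|d0] := leP 0 (g^`()).[a].
    apply: sgr_between Hab; rewrite -(subr_ge0 g.[a]) -(subr_ge0 g.[x]).
    by rewrite -![0 <= _ - _]sgr_ge0 S1 S2 sgr_ge0 d0.
  rewrite Hab; apply: sgr_between (esym Hab); rewrite -(subr_le0 g.[x]) -(subr_le0 g.[a]).
  by rewrite -![_ - _ <= 0]sgr_le0 S1 S2 sgr_le0 ltW.
by case=> [|k]; rewrite ?derivn0 // !derivSn IH' // ax.
Qed.

(** Between two distinct roots with the same signs, [thom_convex] preserves the nonzero sign of f',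
    which contradicts Rolle's theorem. *)
Lemma thom (f : {poly K}) x y : root f x -> root f y -> ~~ root f^`() x ->
  (forall k, Num.sg (f^`(k)).[x] = Num.sg (f^`(k)).[y]) -> x = y.
Proof.
have aux u v : u < v -> root f u -> root f v -> ~~ root f^`() u ->
    (forall k, Num.sg (f^`(k)).[u] = Num.sg (f^`(k)).[v]) -> False.
  move=> uv /rootP fu /rootP fv f'u H.
  have fuv : f.[u] = f.[v] by rewrite fu fv.
  have [c cin c0] := poly_rolle uv fuv.
  have := thom_convex (x := c) _ H 1%N; rewrite derivn1 c0 sgr0 => E.
  by move: f'u; rewrite rootE -sgr_eq0 -E // eqxx.
move=> fx fy f'x H; apply: contrapT => /eqP; rewrite neq_lt => /orP[xy|yx].
  exact: aux xy fx fy f'x H.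
apply: aux yx fy fx _ (fun k => esym (H k)).
by rewrite rootE -sgr_eq0 -(H 1%N) sgr_eq0.
Qed.

(** Expanding the product over [cs] gives an integer combination of sums as in the first hypothesis,
    for products of [d] with elements of [cs]. *)
Lemma isolate (C : {poly K} -> Prop) (s : seq K) (w : K -> int) (t : K) (cs : seq {poly K}) :
  (forall c, C c -> \sum_(x <- s) sgz c.[x] * w x = 0) ->
  (forall c d, c \in cs -> C d -> C (c * d)) ->
  forall d, C d ->
  \sum_(x <- s) sgz d.[x] * (\prod_(c <- cs) (1 + sgz c.[t] * sgz c.[x])) * w x = 0.
Proof.
move=> H; elim: cs => [|c cs IH] Ccs d Cd.
  by rewrite -[RHS](H d Cd); apply: eq_bigr => x _; rewrite big_nil mulr1.
have Ccs' c' d' : c' \in cs -> C d' -> C (c' * d').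
  by move=> c'cs; apply: Ccs; rewrite inE c'cs orbT.
have E1 := IH Ccs' d Cd.
have E2 := IH Ccs' _ (Ccs c d (mem_head _ _) Cd).
transitivity (\sum_(x <- s) sgz d.[x] * \prod_(c <- cs) (1 + sgz c.[t] * sgz c.[x]) * w x
   + sgz c.[t] * \sum_(x <- s) sgz (c * d).[x] * \prod_(c <- cs) (1 + sgz c.[t] * sgz c.[x]) * w x).
  rewrite mulr_sumr -big_split; apply: eq_bigr => x _ /=.
  by rewrite big_cons hornerM sgzM; ring.
by rewrite E1 E2 mulr0 addr0.
Qed.

(* By Thom's lemma the signs of the derivatives of f separate its roots, so that the product
   of the 1 + sgz c.[t] * sgz c.[x] over these derivatives c vanishes at every root x but t. *)
Lemma isolated_weight (C : {poly K} -> Prop) (f : {poly K}) (s : seq K) (w : K -> int) (t : K) :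
  uniq s -> t \in s -> {in s, forall x, root f x} ->
  (forall c, C c -> \sum_(x <- s) sgz c.[x] * w x = 0) -> C 1 ->
  (forall c d, C c -> C d -> C (c * d)) ->
  (forall c, C c -> {in s, forall x, ~~ root c x}) ->
  (forall k, (0 < k < size f)%N -> C f^`(k)) -> (1 < size f)%N ->
  w t = 0.
Proof.
move=> us ts rs H C1 CM Cn Cf sf.
pose cs := [seq f^`(k) | k <- iota 1 (size f).-1].
have csC c : c \in cs -> C c.
  case/mapP => k; rewrite mem_iota => /andP[k0 kf] ->; apply: Cf; rewrite k0 /=.
  by move: kf; rewrite add1n prednK // ltnW.
have sgzpm c x : c \in cs -> x \in s -> (sgz c.[x] == 1) || (sgz c.[x] == -1).
  move=> /csC cC xs; have := Cn c cC x xs; rewrite rootE.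
  by case: (ltrgt0P c.[x]) => // [/gtr0_sgz ->|/ltr0_sgz ->].
have := @isolate C s w t cs H (fun c d ccs Cd => CM c d (csC c ccs) Cd) 1 C1.
(* At [x = t] every factor is 2, so the product does not vanish. *)
rewrite (bigD1_seq t) //= [X in _ + X]big1_seq ?addr0 => [|x /andP[xt xs]].
  rewrite -polyC1 hornerC sgz1 mul1r => /eqP; rewrite mulf_eq0 => /orP[|/eqP //].
  rewrite prodf_seq_eq0 => /hasP[c ccs /= ]; have := sgzpm c t ccs ts.
  by case/orP => /eqP ->.
have [//|ne] := eqVneq (\prod_(c <- cs) (1 + sgz c.[t] * sgz c.[x])) 0.
  by move=> ->; rewrite mulr0 mul0r.
case/eqP: xt; apply: (@thom f) => //; try exact: rs.
  by rewrite -derivn1; apply: (Cn) => //; apply: Cf.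
have sgE (u v : K) : sgz u = sgz v -> Num.sg u = Num.sg v by rewrite !sgrEz => ->.
(* The signs of [f] itself agree because both points are roots, those of the derivatives of order at
   least [size f] because these are 0. *)
case=> [|k]; first by rewrite derivn0 (rootP (rs _ xs)) (rootP (rs _ ts)).
have [kf|kf] := ltnP k.+1 (size f); last first.
  by rewrite derivn_poly0 // !horner0.
have ccs : f^`(k.+1) \in cs.
  by apply: map_f; rewrite mem_iota /= add1n prednK // ltnW.
move: ne; rewrite prodf_seq_neq0 => /allP /(_ _ ccs) /=.
have := sgzpm _ _ ccs ts; have := sgzpm _ _ ccs xs.
by case/orP => /eqP E /orP[]/eqP E'; rewrite E E' // => _; apply: sgE; rewrite E E'.
Qed.

End Thom.

(** * Local constancy of the signature *)

Section Continuity.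
Variable K : rcfType.

Definition evalmx m n (t : K) (M : 'M[{poly K}]_(m, n)) : 'M[K]_(m, n) :=
  map_mx (horner_eval t) M.

Lemma evalmx_sym m t (M : 'M[{poly K}]_m) : M^T = M -> (evalmx t M)^T = evalmx t M.
Proof. by move=> sM; rewrite matrix.map_trmx sM. Qed.

Lemma det_evalmx m t (M : 'M[{poly K}]_m) : \det (evalmx t M) = (\det M).[t].
Proof. by rewrite det_map_mx. Qed.

(** Diagonalizing over [K[X]] makes the signature a sum of signs of polynomials, away from the roots
    of [\det C]. The polynomial [g] may vanish where [M] is invertible; [sig_local] handles such
    points. *)
Lemma sig_generic m (M : 'M[{poly K}]_m) : M^T = M ->
  exists2 g : {poly K}, g != 0 & forall a b, a <= b ->
    (forall t, a <= t <= b -> ~~ root g t) -> sig (evalmx a M) = sig (evalmx b M).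
Proof.
have two : (2%:R : {poly K}) != 0 by rewrite -polyC_natr polyC_eq0 pnatr_eq0.
move=> sM; have [C dC [d E]] := congr_diag two sM.
exists (\det C * \prod_(i | d 0 i != 0) d 0 i).
  by rewrite mulf_neq0 //; apply/prodf_neq0.
move=> a b ab H.
have sigE t : a <= t <= b -> sig (evalmx t M) = \sum_i sgz (d 0 i).[t].
  move=> /H; rewrite rootM => /norP[ct _].
  rewrite -(@sig_congr _ _ _ (evalmx t C)); last first.
    by rewrite unitmxE unitfE det_evalmx.
  rewrite matrix.map_trmx -!map_mxM E map_diag_mx sig_diag.
  by apply: eq_bigr => i _; rewrite mxE.
rewrite !sigE ?lexx ?ab //; apply: eq_bigr => i _.
have [->|di] := eqVneq (d 0 i) 0; first by rewrite !horner0.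
have nr t : a <= t <= b -> ~~ root (d 0 i) t.
  move=> /H; rewrite rootM => /norP[_]; apply: contra => rt.
  by rewrite (bigD1 i) //= rootM rt.
have : Num.sg (d 0 i).[a] = Num.sg (d 0 i).[b].
  have nr' : {in `[a, b], forall t, ~~ root (d 0 i) t} by move=> t; rewrite in_itv => /nr.
  by apply: (polyrN0_itv nr'); rewrite in_itv /= ?lexx ?ab.
by rewrite !sgrEz => /eqP; rewrite eqr_int => /eqP.
Qed.

Lemma common_radius (I : finType) (P : I -> K -> Prop) :
  (forall i, exists2 e, 0 < e & forall d, 0 < d <= e -> P i d) ->
  exists2 e, 0 < e & forall i, P i e.
Proof.
move=> H; have [e He] := choice (fun i => let: ex_intro2 e e0 Pe := H i in
  ex_intro (fun e => 0 < e /\ forall d, 0 < d <= e -> P i d) e (conj e0 Pe)).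
exists (\big[Num.min/1]_i e i).
  by elim/big_ind: _ => // [x y x0 y0|i _]; rewrite ?lt_min ?x0 //; case: (He i).
move=> i; apply: (He i).2; rewrite bigmin_le_cond // andbT.
by elim/big_ind: _ => // [x y x0 y0|j _]; rewrite ?lt_min ?x0 //; case: (He j).
Qed.

(** A positive definite subspace at [x] is normalized to Gram matrix 1; at nearby points its Gram
    matrix is [1 + D] with small [D], hence still positive definite. *)
Lemma pos_local m (M : 'M[{poly K}]_m) x : M^T = M ->
  exists2 e, 0 < e & forall y, `|y - x| < e -> (pos (evalmx x M) <= pos (evalmx y M))%N.
Proof.
move=> sM; have [U UE] := haspos_normal (evalmx_sym x sM) (pos_haspos (evalmx x M)).
set k := pos _ in U UE *.
pose N : 'M[{poly K}]_k := map_mx polyC U *m M *m (map_mx polyC U)^T.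
have NE y : evalmx y N = U *m evalmx y M *m U^T.
  rewrite /N /evalmx !map_mxM -matrix.map_trmx -!map_mx_comp /=.
  have -> : map_mx (horner_eval y \o polyC) U = U.
    by apply/matrixP => i j; rewrite !mxE /= /horner_eval hornerC.
  by [].
(* Entries of [D] below 1 / (k + 1) bound |z D z^T| by k / (k + 1) times the squared length of z. *)
pose eps : K := k.+1%:R^-1; have eps0 : 0 < eps by rewrite invr_gt0 ltr0n.
have [e e0 He] : exists2 e, 0 < e & forall ij : 'I_k * 'I_k,
    forall y, `|y - x| < e -> `|(N ij.1 ij.2).[y] - (N ij.1 ij.2).[x]| < eps.
  apply: common_radius => -[i j] /=; have [e e0 He] := poly_cont x (N i j) eps0.
  by exists e => // d /andP[_ de] y yd; apply: He; apply: lt_le_trans yd de.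
exists e => // y ye; apply: haspos_pos; exists U; rewrite -NE => z z0.
have nE : evalmx y N = 1%:M + \matrix_(i, j) ((N i j).[y] - (N i j).[x]).
  rewrite -UE -NE; apply/matrixP => i j; rewrite !mxE /horner_eval; ring.
rewrite nE mulmxDr mulmxDl mulmx1 mxE.
have z2 : (z *m z^T) 0 0 = \sum_i z 0 i ^+ 2.
  by rewrite mxE; apply: eq_bigr => i _; rewrite mxE expr2.
have z2_gt0 : 0 < \sum_i z 0 i ^+ 2.
  rewrite lt_neqAle sumr_ge0 ?andbT => [|i _]; last exact: sqr_ge0.
  apply: contra z0; rewrite eq_sym psumr_eq0 => [/allP H|i _]; last exact: sqr_ge0.
  by apply/eqP/rowP => i; rewrite mxE; apply/eqP; rewrite -sqrf_eq0; apply: H; rewrite mem_index_enum.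
rewrite z2; set D := \matrix_(i, j) _.
suff : `|(z *m D *m z^T) 0 0| <= (k%:R * eps) * \sum_i z 0 i ^+ 2.
  move=> le; have le' : - (z *m D *m z^T) 0 0 <= k%:R * eps * \sum_i z 0 i ^+ 2.
    by rewrite (le_trans (ler_norm _)) // normrN.
  rewrite -[X in 0 < _ + X]opprK subr_gt0; apply: le_lt_trans le' _.
  rewrite -[X in _ < X]mul1r ltr_pM2r // ltr_pdivrMr ?ltr0n // mul1r ltr_nat //.
rewrite mxE; under eq_bigr do rewrite mxE mulr_suml.
rewrite exchange_big /=; apply: le_trans (ler_norm_sum _ _ _) _.
have le1 (i : 'I_k) : `|\sum_j z 0 i * D i j * z^T j 0| <= \sum_j eps * ((z 0 i ^+ 2 + z 0 j ^+ 2) / 2%:R).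
  apply: le_trans (ler_norm_sum _ _ _) _; apply: ler_sum => j _.
  have -> : `|z 0 i * D i j * z^T j 0| = `|D i j| * (`|z 0 i| * `|z 0 j|).
    by rewrite !normrM [z^T j 0]mxE; ring.
  apply: ler_pM; rewrite ?mulr_ge0 ?normr_ge0 //; first by rewrite mxE; apply: ltW; apply: (He (i, j)).
  rewrite -(real_normK (num_real (z 0 i))) -(real_normK (num_real (z 0 j))).
  rewrite ler_pdivlMr ?ltr0n // -subr_ge0.
  have -> : `|z 0 i| ^+ 2 + `|z 0 j| ^+ 2 - `|z 0 i| * `|z 0 j| * 2%:R = (`|z 0 i| - `|z 0 j|) ^+ 2 by ring.
  exact: sqr_ge0.
apply: le_trans (ler_sum _ (fun i _ => le1 i)) _; rewrite le_eqVlt; apply/orP; left; apply/eqP.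
have two0 : (2%:R : K) != 0 by rewrite pnatr_eq0.
set S := \sum_i z 0 i ^+ 2.
rewrite (eq_bigr (fun i => eps / 2%:R * (k%:R * z 0 i ^+ 2 + S))) => [|i _].
  rewrite -mulr_sumr big_split /= sumr_const card_ord -mulr_sumr -/S -mulr_natl.
  by field.
rewrite (eq_bigr (fun j => eps / 2%:R * (z 0 i ^+ 2 + z 0 j ^+ 2))) => [|j _]; last by ring.
by rewrite -mulr_sumr big_split /= sumr_const card_ord mulr_natl.
Qed.

(** Neither [pos] of [M] nor that of [- M] can drop near [x], and neither can rise, since at [x]
    they already add up to [m]. *)
Lemma sig_local m (M : 'M[{poly K}]_m) x : M^T = M -> ~~ root (\det M) x ->
  exists2 e, 0 < e & forall y, `|y - x| < e -> sig (evalmx y M) = sig (evalmx x M).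
Proof.
move=> sM dM; have [e1 e10 H1] := pos_local x sM.
have sMN : (- M)^T = - M by rewrite linearN /= sM.
have [e2 e20 H2] := pos_local x sMN.
exists (Num.min e1 e2); first by rewrite lt_min e10.
move=> y; rewrite lt_min => /andP[/H1 p1 /H2].
rewrite /evalmx !map_mxN -!/(evalmx _ _) => p2.
have := @pos_negD_unit _ _ _ (evalmx_sym x sM); rewrite unitmxE unitfE det_evalmx => /(_ dM) E.
have := pos_negD (evalmx y M); rewrite /sig => le.
have -> : pos (evalmx y M) = pos (evalmx x M).
  apply/eqP; rewrite eqn_leq p1 andbT -(leq_add2r (pos (- evalmx x M))) E.
  by rewrite (leq_trans _ le) // leq_add2l.
have -> // : pos (- evalmx y M) = pos (- evalmx x M).
apply/eqP; rewrite eqn_leq p2 andbT -(leq_add2l (pos (evalmx x M))) E.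
by rewrite (leq_trans _ le) // leq_add2r.
Qed.

Lemma count_lt (T : eqType) (p q : pred T) (s : seq T) r : subpred p q -> r \in s ->
  ~~ p r -> q r -> (count p s < count q s)%N.
Proof.
move=> pq; elim: s => // x s IH; rewrite inE => /orP[/eqP <-|rs] npr qr /=.
  by rewrite (negPf npr) qr add0n add1n ltnS sub_count.
rewrite -addnS leq_add ?IH //; first by case: (p x) (pq x) => // ->.
Qed.

(** The order topology of [K] may be disconnected, so local constancy alone proves nothing; an
    induction on the number of roots of [g] in the interval replaces connectedness. *)
Lemma eq_of_locally_constant (T : Type) (s : K -> T) (g : {poly K}) a b : g != 0 -> a <= b ->
  (forall u v, u <= v -> (forall t, u <= t <= v -> ~~ root g t) -> s u = s v) ->
  (forall r, a <= r <= b -> exists2 e, 0 < e & forall y, `|y - r| < e -> s y = s r) ->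
  s a = s b.
Proof.
move=> g0 + G; pose cnt u v := count (fun r => u <= r <= v) (rootsR g).
have [n] := ubnP (cnt a b); elim: n a b => [|n IH] a b cn ab H; first by rewrite ltn0 in cn.
have [/hasP[r rg /andP[ar rb]]|/hasPn nr] := boolP (has (fun r => a <= r <= b) (rootsR g)); last first.
  apply: G => // t tab; apply/negP => gt.
  have tr : t \in rootsR g.
    have /roots_onP/(_ t) := roots_on_rootsR g0.
    by rewrite in_itv /= gt => /(_ isT) <-.
  by have := nr t tr; rewrite tab.
have [|e e0 He] := H r; first by rewrite ar rb.
have e2 : 0 < e / 2%:R by rewrite divr_gt0 // ltr0n.
have e2e : e / 2%:R < e by rewrite ltr_pdivrMr ?ltr0n // ltr_pMr // ltr1n.
have cntS u v : a <= u -> v <= b -> ~~ (u <= r <= v) -> (cnt u v < n)%N.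
  move=> au vb ruv; rewrite -ltnS (leq_trans _ cn) // ltnS.
  apply: (count_lt (r := r)) => //; last by rewrite ar rb.
  by move=> x /andP[ux xv]; rewrite (le_trans au ux) (le_trans xv vb).
(* Either [a] lies within [e / 2] of [r], or the interval from [a] to [r - e / 2] contains fewer
   roots. *)
have left : s a = s r.
  have [lt|le] := ltP a (r - e / 2%:R); last first.
    by apply: He; rewrite distrC ger0_norm ?subr_ge0 // (le_lt_trans _ e2e) // lerBlDl -lerBlDr.
  rewrite (IH a (r - e / 2%:R)) ?ltW //.
  - by apply: He; rewrite addrC addrA addNr add0r normrN gtr0_norm.
  - apply: cntS => //; first by rewrite (le_trans _ rb) // gerBl ltW.
    by rewrite negb_and -ltNge -[X in _ || X]ltNge ltrBlDr ltrDl e2 orbT.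
  move=> t /andP[at' tr]; apply: H; rewrite at' (le_trans tr) // (le_trans _ rb) //.
  by rewrite gerBl ltW.
have right : s b = s r.
  have [lt|le] := ltP (r + e / 2%:R) b; last first.
    by apply: He; rewrite ger0_norm ?subr_ge0 // (le_lt_trans _ e2e) // lerBlDl.
  rewrite -(IH (r + e / 2%:R) b) ?ltW //.
  - by apply: He; rewrite addrC addKr gtr0_norm.
  - apply: cntS => //; first by rewrite (le_trans ar) // lerDl ltW.
    by rewrite negb_and -ltNge ltrDl e2.
  move=> t /andP[rt tb]; apply: H; rewrite tb andbT (le_trans _ rt) // (le_trans ar) //.
  by rewrite lerDl ltW.
by rewrite left right.
Qed.

Lemma sig_const m (M : 'M[{poly K}]_m) a b : M^T = M -> a <= b ->
  (forall t, a <= t <= b -> ~~ root (\det M) t) ->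
  sig (evalmx a M) = sig (evalmx b M).
Proof.
move=> sM ab dM; have [g g0 G] := sig_generic sM.
apply: (@eq_of_locally_constant _ (fun t => sig (evalmx t M)) g a b g0 ab G) => r rab.
by apply: sig_local => //; apply: dM.
Qed.

End Continuity.

(** * Neutral representations *)

Section Points.
Variables (E : fieldType) (A : falgType E) (s : 'End(A)).
Variables (K : rcfType) (iota : {rmorphism E -> K}).
Variables (m : nat) (rho : A -> 'M[K]_m) (G : 'M[K]_m).
Local Notation be i := ((vbasis {:A})`_i).

(* A representation of (A, s) on K^m, semilinear along iota, adjoint to the symmetric form G:
   for s a = a, the form G *m rho a represents <a>. *)
Record hermrep : Prop := HermRep {
  ptD : forall a b, rho (a + b) = rho a + rho b;
  ptM : forall a b, rho (a * b) = rho a *m rho b;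
  pt1 : rho 1 = 1%:M;
  ptZ : forall c a, rho (c *: a) = iota c *: rho a;
  ptS : forall a, (rho a)^T *m G = G *m rho (s a);
  ptG : G^T = G;
  ptU : G \in unitmx;
  ptI : forall k : 'I_(\dim {:A}) -> K, \sum_i k i *: rho (be i) = 0 -> forall i, k i = 0 }.

Definition neutral : Prop :=
  forall a, s a = a -> rho a \in unitmx -> sig (G *m rho a) = 0.

Hypothesis pt : hermrep.
Hypothesis sM : forall a b, s (a * b) = s b * s a.
Hypothesis sK : forall a, s (s a) = a.

Lemma rho0 : rho 0 = 0.
Proof. by apply: (addrI (rho 0)); rewrite -(ptD pt) !addr0. Qed.

Lemma rho_sum (I : finType) (F : I -> A) : rho (\sum_i F i) = \sum_i rho (F i).
Proof. by apply: big_morph; [exact: (ptD pt) | exact: rho0]. Qed.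

Lemma rhoN a : rho (- a) = - rho a.
Proof. by apply: (addrI (rho a)); rewrite -(ptD pt) !subrr rho0. Qed.

Lemma rho_inj a : rho a = 0 -> a = 0.
Proof.
move=> ra; rewrite (coord_vbasis (memvf a)) big1 // => i _.
have : \sum_i iota (coord (vbasis {:A}) i a) *: rho (be i) = 0.
  rewrite -[RHS]ra [in RHS](coord_vbasis (memvf a)) rho_sum.
  by apply: eq_bigr => j _; rewrite (ptZ pt).
by move/(ptI pt)/(_ i)/eqP; rewrite fmorph_eq0 => /eqP ->; rewrite scale0r.
Qed.

Lemma s1 : s 1 = 1.
Proof. by rewrite -[LHS]mulr1 -[X in _ * X]sK -sM mulr1 sK. Qed.

Lemma rho_nat n : rho n%:R = n%:R%:M.
Proof.
elim: n => [|n IH]; first by rewrite rho0 -[0%:R]/(0 : K) raddf0.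
by rewrite !mulrSr (ptD pt) IH (pt1 pt) raddfD.
Qed.

Lemma rho_nat_unit n : (0 < n)%N -> rho n%:R \in unitmx.
Proof.
move=> n0; rewrite rho_nat -scalemx1 unitmxZ ?unitmx1 //.
by rewrite unitfE pnatr_eq0 -lt0n.
Qed.

Definition starmx p q (x : 'M[A]_(p, q)) : 'M[A]_(q, p) := map_mx s x^T.

Lemma starmxM p q r (x : 'M[A]_(p, q)) (y : 'M_(q, r)) : starmx (x *m y) = starmx y *m starmx x.
Proof.
apply/matrixP => i j; rewrite !mxE linear_sum /=; apply: eq_bigr => k _.
by rewrite sM !mxE.
Qed.

Lemma starmxK p q (x : 'M[A]_(p, q)) : starmx (starmx x) = x.
Proof. by apply/matrixP => i j; rewrite !mxE sK. Qed.

Lemma starmxD p q (x y : 'M[A]_(p, q)) : starmx (x + y) = starmx x + starmx y.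
Proof. by apply/matrixP => i j; rewrite !mxE linearD. Qed.

Lemma starmxN p q (x : 'M[A]_(p, q)) : starmx (- x) = - starmx x.
Proof. by apply/matrixP => i j; rewrite !mxE linearN. Qed.

Lemma starmx0 p q : starmx (0 : 'M[A]_(p, q)) = 0.
Proof. by apply/matrixP => i j; rewrite !mxE linear0. Qed.

Lemma starmx1 p : starmx (1%:M : 'M[A]_p) = 1%:M.
Proof. by apply/matrixP => i j; rewrite !mxE eq_sym; case: eqP; rewrite ?s1 ?linear0. Qed.

Lemma starmx_block p q p' q' (a : 'M[A]_(p, q)) b c (d : 'M[A]_(p', q')) :
  starmx (block_mx a b c d) = block_mx (starmx a) (starmx c) (starmx b) (starmx d).
Proof. by rewrite /starmx tr_block_mx map_block_mx. Qed.

(** Matrices over [A] act on tuples of vectors of [K^m]; the columns of [u] are the entries of the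
    tuple. *)
Definition act p q (x : 'M[A]_(p, q)) (u : 'M[K]_(m, q)) : 'M[K]_(m, p) :=
  \matrix_(a, i) \sum_j (rho (x i j) *m u) a j.

Lemma actP p q (x : 'M[A]_(p, q)) : linear (act x).
Proof.
move=> c u v; apply/matrixP => a i; rewrite !mxE mulr_sumr -big_split.
by apply: eq_bigr => j _; rewrite mulmxDr -scalemxAr !mxE.
Qed.

Lemma actM p q r (x : 'M[A]_(p, q)) (y : 'M_(q, r)) u : act (x *m y) u = act x (act y u).
Proof.
apply/matrixP => a i; rewrite !mxE.
transitivity (\sum_j \sum_k (rho (x i k) *m rho (y k j) *m u) a j).
  apply: eq_bigr => j _; rewrite [(x *m y) i j]mxE rho_sum mulmx_suml summxE.
  by apply: eq_bigr => k _; rewrite (ptM pt).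
rewrite exchange_big; apply: eq_bigr => k _; rewrite [RHS]mxE.
under [RHS]eq_bigr do rewrite mxE mulr_sumr.
rewrite [RHS]exchange_big; apply: eq_bigr => j _ /=.
by rewrite -mulmxA [LHS]mxE.
Qed.

Lemma act1 p u : act (1%:M : 'M[A]_p) u = u.
Proof.
apply/matrixP => a i; rewrite mxE (bigD1 i) //= [1%:M i i]mxE eqxx mulr1n (pt1 pt) mul1mx.
rewrite big1 ?addr0 // => j /negPf ji.
by rewrite [1%:M i j]mxE eq_sym ji mulr0n rho0 mul0mx mxE.
Qed.

Definition pair p (u w : 'M[K]_(m, p)) : K := \tr (u^T *m G *m w).

Lemma pairC p (u w : 'M[K]_(m, p)) : pair u w = pair w u.
Proof. by rewrite /pair -mxtrace_tr !trmx_mul trmxK (ptG pt) mulmxA. Qed.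

Lemma pairP p (u u' w : 'M[K]_(m, p)) c : pair (c *: u + u') w = c * pair u w + pair u' w.
Proof. by rewrite /pair linearP /= !mulmxDl -!scalemxAl mxtraceD mxtraceZ. Qed.

Lemma mulmx_act p q n (x : 'M[A]_(p, q)) (U : 'M[K]_(n, m)) w j l :
  (U *m act x w) j l = \sum_i (U *m (rho (x l i) *m w)) j i.
Proof.
rewrite mxE; under eq_bigr do rewrite mxE mulr_sumr.
rewrite exchange_big; apply: eq_bigr => i _ /=; rewrite [RHS]mxE.
by apply: eq_bigr => a _.
Qed.

Lemma pair_act p q (x : 'M[A]_(p, q)) u w : pair (act x u) w = pair u (act (starmx x) w).
Proof.
have L1 (W : 'M[K]_(m, p)) i l :
    ((act x u)^T *m W) i l = \sum_j ((rho (x i j) *m u)^T *m W) j l.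
  rewrite mxE; under eq_bigr do rewrite !mxE mulr_suml.
  rewrite exchange_big; apply: eq_bigr => j _ /=; rewrite [RHS]mxE.
  by apply: eq_bigr => a _; rewrite [in RHS]mxE.
rewrite /pair /mxtrace; under eq_bigr do rewrite -mulmxA L1.
under [RHS]eq_bigr do rewrite mulmx_act.
rewrite exchange_big; apply: eq_bigr => j _; apply: eq_bigr => i _ /=.
rewrite [starmx x j i]mxE [x^T j i]mxE; congr (fun_of_matrix _ j i).
by rewrite trmx_mul -!mulmxA; congr (_ *m _); rewrite !mulmxA (ptS pt).
Qed.

Definition herm p (x : 'M[A]_p) : Prop := starmx x = x.

Definition sg p (x : 'M[A]_p) : int := sigf (fun u v => pair u (act x v)).

Lemma symform_herm p (x : 'M[A]_p) : herm x -> symform (fun u v => pair u (act x v)).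
Proof.
move=> hx; split=> [c u v w|u v]; first exact: pairP.
by rewrite -{1}hx -pair_act pairC.
Qed.

Definition inverse p (x y : 'M[A]_p) : Prop := x *m y = 1%:M /\ y *m x = 1%:M.

Lemma sg_congr p (x c c' : 'M[A]_p) : herm x -> inverse c c' ->
  sg (starmx c *m x *m c) = sg x.
Proof.
move=> hx [cc' _]; apply: (@sigf_isom _ _ _ _ _ (act c)).
- exact: symform_herm.
- exact: actP.
- by move=> w; exists (act c' w); rewrite -actM cc' act1.
by move=> u v; rewrite !actM -pair_act.
Qed.

Lemma sg_block p q (x : 'M[A]_p) (y : 'M[A]_q) : herm x -> herm y ->
  sg (block_mx x 0 0 y) = sg x + sg y.
Proof.
move=> hx hy; rewrite -sigf_sum; try exact: symform_herm.
symmetry; apply: (@sigf_isom _ _ _ _ _ (fun u => row_mx u.1 u.2)).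
- by apply: symform_herm; rewrite /herm starmx_block !starmx0 hx hy.
- by move=> c u v; rewrite scale_row_mx add_row_mx.
- by move=> w; exists (lsubmx w, rsubmx w); rewrite hsubmxK.
move=> [u1 u2] [v1 v2] /=.
have -> : act (block_mx x 0 0 y) (row_mx v1 v2) = row_mx (act x v1) (act y v2).
  apply/matrixP => a i; rewrite mxE big_split_ord /=.
  case: (split_ordP i) => k ->.
    rewrite row_mxEl mxE [X in _ + X]big1 ?addr0 => [|j _]; last first.
      by rewrite block_mxEur [X in rho X]mxE rho0 mul0mx mxE.
    by apply: eq_bigr => j _; rewrite block_mxEul mul_mx_row row_mxEl.
  rewrite row_mxEr mxE [X in X + _]big1 ?add0r => [|j _]; last first.
    by rewrite block_mxEdl [X in rho X]mxE rho0 mul0mx mxE.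
  by apply: eq_bigr => j _; rewrite block_mxEdr mul_mx_row row_mxEr.
rewrite /pair tr_row_mx -[in RHS]mulmxA [in RHS]mul_mx_row mul_col_row mxtrace_block.
by rewrite !mulmxA.
Qed.

Lemma sg_scalar (a : A) : s a = a -> sg (a%:M : 'M[A]_1) = sig (G *m rho a).
Proof.
move=> sa; have ha : herm (a%:M : 'M[A]_1).
  by apply/matrixP => i j; rewrite !ord1 !mxE eqxx !mulr1n.
have Gsym : (G *m rho a)^T = G *m rho a.
  by rewrite trmx_mul (ptG pt) (ptS pt) sa.
rewrite -(sigf_row Gsym).
symmetry; apply: (@sigf_isom _ _ _ _ _ (fun u : 'rV[K]_m => u^T)).
- exact: symform_herm.
- by move=> c u v; rewrite linearP.
- by move=> w; exists w^T; rewrite trmxK.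
move=> u v; rewrite /pair trmxK /mxtrace big_ord1.
congr (fun_of_matrix _ 0 0); rewrite -!mulmxA; congr (_ *m (_ *m _)).
by apply/matrixP => i j; rewrite !ord1 [RHS]mxE big_ord1 [a%:M _ _]mxE eqxx mulr1n.
Qed.

(** If [x] acts injectively on vectors over [K], it is injective on [A^p] because [rho] is faithful,
    and then bijective there by dimension over [E]. *)
Lemma act_surj_inverse p (x : 'M[A]_p) : (forall u, act x u = 0 -> u = 0) ->
  exists y, x *m y = 1%:M.
Proof.
move=> x_inj; pose V := {ffun 'I_p -> A}.
pose f (v : V) : V := [ffun i => \sum_j x i j * v j].
have fl : linear f.
  move=> c u v; apply/ffunP => i; rewrite !ffunE scaler_sumr -big_split.
  by apply: eq_bigr => j _; rewrite !ffunE mulrDr scalerAr.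
pose fa := GRing.isLinear.Build _ _ _ _ f fl.
pose fL : {linear V -> V} := HB.pack f fa.
have fE v : linfun fL v = f v by rewrite lfunE.
have ker0 : lker (linfun fL) == 0%VS.
  apply/lker0P => v w; rewrite !fE => fvw; apply/ffunP => j; apply/eqP.
  rewrite -subr_eq0; apply/eqP; pose z : 'M[A]_(p, 1) := \matrix_(i, _) (v i - w i).
  have xz : x *m z = 0.
    apply/matrixP => i k; have /ffunP/(_ i) := fvw; rewrite !ffunE => vw.
    transitivity (\sum_l x i l * v l - \sum_l x i l * w l); last by rewrite vw subrr mxE.
    rewrite mxE -sumrB; apply: eq_bigr => l _.
    by rewrite [z _ _]mxE mulrBr.
  apply: rho_inj; apply/matrixP => a b; rewrite mxE.
  (* Acting on the [b]-th basis vector, the column [z] produces the [b]-th columns of the matrices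
     [rho (z j 0)]. *)
  have /matrixP/(_ a j) : act z (delta_mx b 0 : 'cV_m) = 0.
    apply: x_inj; rewrite -actM xz; apply/matrixP => c d; rewrite mxE big1 ?mxE // => l _.
    by rewrite [X in rho X]mxE rho0 mul0mx mxE.
  by rewrite mxE big_ord1 [X in rho X]mxE -colE !mxE.
have img w : exists v, f v = w.
  have : w \in limg (linfun fL) by rewrite lker0_limgf // memvf.
  by case/memv_imgP => v _ ->; exists v; rewrite fE.
pose e k : V := [ffun i => (i == k)%:R].
have [g gE] := choice (fun k => img (e k)).
exists (\matrix_(i, k) g k i); apply/matrixP => i k; rewrite !mxE.
have /ffunP/(_ i) := gE k; rewrite !ffunE => <-.
by apply: eq_bigr => j _; rewrite mxE.
Qed.

Lemma herm_inverse p (x : 'M[A]_p) : herm x -> (forall u, act x u = 0 -> u = 0) ->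
  exists2 y, herm y & inverse x y.
Proof.
move=> hx /act_surj_inverse[y xy].
have yx : starmx y *m x = 1%:M by rewrite -{1}hx -starmxM xy starmx1.
have yE : starmx y = y by rewrite -[LHS]mulmx1 -xy mulmxA yx mul1mx.
by exists y => //; split=> //; rewrite -{1}yE.
Qed.

Lemma nat_avoid (q : {poly K}) : q != 0 -> exists2 n, (0 < n)%N & ~~ root q n%:R.
Proof.
move=> q0; pose t := [seq n%:R : K | n <- seq.iota 1 (size q)].
have [/allP al|/allPn[x /mapP[n]]] := boolP (all (root q) t); last first.
  by rewrite mem_iota => /andP[n0 _] -> nr; exists n.
have ut : uniq t.
  by rewrite map_inj_uniq ?iota_uniq //; move=> a b /eqP; rewrite eqr_nat => /eqP.
have := max_poly_roots q0 (introT (@allP _ _ _) al) ut.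
by rewrite size_map size_iota ltnn.
Qed.

Lemma natE n : (0 < n)%N -> n%:R != 0 :> E.
Proof. by move=> n0; rewrite -(fmorph_eq0 iota) rmorph_nat pnatr_eq0 -lt0n. Qed.

Definition natA n : A := n%:R^-1%:A.

Lemma natA_mul n : (0 < n)%N -> n%:R * natA n = 1 /\ natA n * n%:R = 1.
Proof.
move=> n0; rewrite /natA -scalerAr -scalerAl mulr1 mul1r.
by rewrite -scaler_nat scalerA mulVf ?natE // scale1r.
Qed.

Lemma s_nat n : s n%:R = n%:R.
Proof. by rewrite -scaler_nat linearZ /= s1. Qed.

Lemma s_natA n : s (natA n) = natA n.
Proof. by rewrite linearZ /= s1. Qed.

Lemma rho_natA n : rho (natA n) = (n%:R^-1)%:M.
Proof. by rewrite (ptZ pt) (pt1 pt) fmorphV rmorph_nat scalemx1. Qed.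

(** Each condition excludes the roots of one nonzero polynomial in n; for the second it is det (1 +
    n rho(b)), which is n^m det (rho(b) + 1 / n). *)
Lemma shift_unit (a b : A) : exists2 n, (0 < n)%N &
  rho (a + n%:R) \in unitmx /\ rho (b + natA n) \in unitmx.
Proof.
pose q : {poly K} := \det (1%:M + 'X *: map_mx polyC (rho b)).
have q0 : q != 0.
  apply/eqP => /(congr1 (horner^~ 0)); rewrite horner0 -[LHS]det_evalmx.
  rewrite /evalmx map_mxD map_mx1 (_ : map_mx _ (_ *: _) = 0) ?addr0 ?det1.
    by move/eqP; rewrite oner_eq0.
  by apply/matrixP => i j; rewrite !mxE /= /horner_eval hornerM hornerX mul0r.
have c0 : char_poly (- rho a) != 0 by rewrite monic_neq0 // char_poly_monic.
have [|n n0] := @nat_avoid (char_poly (- rho a) * q); first by rewrite mulf_neq0.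
rewrite rootM => /norP[ra rb]; exists n => //; rewrite (ptD pt) rho_nat (ptD pt) rho_natA.
have nK : (n%:R : K) != 0 by rewrite pnatr_eq0 -lt0n.
rewrite !unitmxE !unitfE; split.
  apply: contra ra => /eqP d0; rewrite /root /char_poly -det_evalmx -d0; apply/eqP; congr (\det _).
  by apply/matrixP => i j; rewrite !mxE /horner_eval !hornerE hornerMn hornerX opprK addrC.
apply: contra rb => /eqP d0; rewrite /root /q -det_evalmx.
rewrite (_ : evalmx _ _ = n%:R *: (rho b + n%:R^-1%:M)) ?detZ ?d0 ?mulr0 //.
apply/matrixP => i j; rewrite !mxE /horner_eval !hornerE.
rewrite mulrDr addrC; congr (_ + _); case: (i == j); rewrite ?mulr0 ?horner0 //.
by rewrite mulr1n mulfV // -polyC1 hornerC.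
Qed.

Lemma herm_shift_inverse (a : A) (d : A) : s (a + d) = a + d -> rho (a + d) \in unitmx ->
  exists2 e : A, s e = e & (a + d) * e = 1 /\ e * (a + d) = 1.
Proof.
move=> sa ua; have h : herm ((a + d)%:M : 'M[A]_1).
  by apply/matrixP => i j; rewrite !ord1 !mxE eqxx !mulr1n.
have [|y hy [y1 y2]] := herm_inverse h.
  move=> u u0; rewrite -[u](mulKmx ua) (_ : rho _ *m u = 0) ?mulmx0 //.
  apply/matrixP => k i; move/matrixP/(_ k i): u0; rewrite !ord1 mxE big_ord1.
  by rewrite [_%:M _ _]mxE eqxx mulr1n.
exists (y 0 0).
  by move/matrixP/(_ 0 0): hy; rewrite !mxE.
split.
  by move/matrixP/(_ 0 0): y1; rewrite !mxE big_ord1 !mxE eqxx !mulr1n.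
by move/matrixP/(_ 0 0): y2; rewrite !mxE big_ord1 !mxE eqxx !mulr1n.
Qed.

Hypothesis Z : neutral.

(** Over [A], [x] is congruent to the orthogonal sum of <a> and its Schur complement [d], and <a>
    has signature 0 by neutrality. *)
Lemma sg_schur p (a : A) (b : 'M[A]_(1, p)) (c : 'M[A]_p) (e : A) :
  s a = a -> herm c -> s e = e -> a * e = 1 -> e * a = 1 -> rho a \in unitmx ->
  let x := block_mx a%:M b (starmx b) c in
  let d := c - starmx b *m (e%:M *m b) in
  sg x = sg d /\ ((exists z, inverse d z) -> exists z, inverse x z).
Proof.
move=> sa hc se ae ea ua x d.
have hS (f : A) : s f = f -> starmx (f%:M : 'M_1) = f%:M.
  by move=> sf; apply/matrixP => i j; rewrite !ord1 !mxE eqxx !mulr1n.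
have scE (f g : A) : (f%:M : 'M_1) *m g%:M = (f * g)%:M by rewrite -scalar_mxM.
have hd : herm d.
  by rewrite /herm starmxD starmxN !starmxM starmxK hc hS // -mulmxA.
pose t : 'M_(1 + p) := block_mx 1%:M (e%:M *m b) 0 1%:M.
pose t' : 'M_(1 + p) := block_mx 1%:M (- (e%:M *m b)) 0 1%:M.
have tt' : inverse t t'.
  split; rewrite mulmx_block !(mul1mx, mulmx1, mul0mx, mulmx0, addr0, add0r).
    by rewrite addNr -scalar_mx_block.
  by rewrite subrr -scalar_mx_block.
have st : starmx t = block_mx 1%:M 0 (starmx b *m e%:M) 1%:M.
  by rewrite starmx_block !starmx1 starmx0 starmxM hS.
pose D : 'M_(1 + p) := block_mx a%:M 0 0 d.
have hD : herm D by rewrite /herm starmx_block !starmx0 hS // hd.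
have xE : starmx t *m D *m t = x.
  rewrite st !mulmx_block !(mul1mx, mulmx1, mul0mx, mulmx0, addr0, add0r).
  rewrite -!mulmxA !scE ?(mulmxA a%:M) ?scE ae ea mul1mx mulmx1 /x.
  by congr block_mx; rewrite /d addrC subrK.
split.
  by rewrite -xE (sg_congr hD tt') (sg_block (hS a sa) hd) sg_scalar // (Z sa ua) add0r.
move=> [z [dz zd]].
pose D' : 'M_(1 + p) := block_mx e%:M 0 0 z.
have DD' : D *m D' = 1%:M.
  rewrite mulmx_block !(mul0mx, mulmx0, addr0, add0r) scE ae dz.
  by rewrite -scalar_mx_block.
have D'D : D' *m D = 1%:M.
  rewrite mulmx_block !(mul0mx, mulmx0, addr0, add0r) scE ea zd.
  by rewrite -scalar_mx_block.
case: tt' => tt1 tt2; exists (t' *m D' *m starmx t'); rewrite -xE; split.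
  rewrite -!mulmxA (mulmxA t t') tt1 mul1mx (mulmxA D D') DD' mul1mx.
  by rewrite -starmxM tt2 starmx1.
rewrite -!mulmxA (mulmxA (starmx t') (starmx t)) -starmxM tt1 starmx1 mul1mx.
by rewrite (mulmxA D' D) D'D mul1mx.
Qed.

Lemma herm_block p (x : 'M[A]_(1 + p)) : herm x ->
  exists a b c, [/\ x = block_mx a%:M b (starmx b) c, s a = a & herm c].
Proof.
move=> hx; exists (x 0 0), (ursubmx x), (drsubmx x); split.
- rewrite -[LHS]submxK; congr block_mx.
    apply/matrixP => i j; rewrite !ord1 [RHS]mxE eqxx mulr1n 2!mxE.
    by congr (fun_of_matrix x _ _); apply: val_inj.
  by rewrite -[in LHS]hx /starmx -map_dlsubmx trmx_ursub.
- by rewrite -[in RHS]hx !mxE.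
by rewrite /herm /starmx trmx_drsub map_drsubmx -/(starmx x) hx.
Qed.

Lemma sg_dim0 (x : 'M[A]_0) : herm x -> sg x = 0.
Proof.
move=> hx; apply: (@sigf_anti _ _ _ id); first exact: symform_herm.
- by [].
- by move=> w; exists w.
by move=> u v; rewrite /pair /mxtrace big_ord0 oppr0.
Qed.

Lemma sg_diag0 p (f : 'I_p -> A) : (forall i, s (f i) = f i) ->
  (forall i, rho (f i) \in unitmx) -> sg (diag_mx (\row_i f i)) = 0.
Proof.
have hD q (g : 'I_q -> A) : (forall i, s (g i) = g i) -> herm (diag_mx (\row_i g i)).
  move=> sf; apply/matrixP => i j; rewrite !mxE [j == i]eq_sym.
  by case: (i =P j) => [->|_]; rewrite ?sf ?linear0.
elim: p f => [|p IH] f sf uf; first by apply: sg_dim0; apply: hD.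
have -> : diag_mx (\row_i f i) =
    block_mx (f (lshift p (0 : 'I_1)))%:M 0 0 (diag_mx (\row_i f (rshift 1 i))) :> 'M_(1 + p).
  rewrite -diag_const_mx -diag_mx_row; congr diag_mx; apply/rowP => i.
  by rewrite !mxE; case: split_ordP => j ->; rewrite !mxE ?ord1.
have h1 : herm ((f (lshift p (0 : 'I_1)))%:M : 'M_1).
  by apply/matrixP => i j; rewrite !ord1 !mxE eqxx !mulr1n.
apply: (etrans (sg_block h1 (hD _ _ (fun i => sf (rshift 1 i))))).
by rewrite sg_scalar ?Z ?add0r ?IH.
Qed.

(* The d i are chosen one after the other, avoiding finitely many values, so that x + D and
   y + D^-1 can both be diagonalized over A. *)
Lemma generic_shift p (x y : 'M[A]_p) : herm x -> herm y ->
  exists d : 'I_p -> nat, [/\ forall i, (0 < d i)%N,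
    sg (x + diag_mx (\row_i (d i)%:R)) = 0,
    sg (y + diag_mx (\row_i natA (d i))) = 0 &
    exists z, inverse (y + diag_mx (\row_i natA (d i))) z].
Proof.
elim: p x y => [|p IH] x y hx hy.
  exists (fun=> 1%N); split=> //; try apply: sg_dim0.
  - by apply/matrixP => - [].
  - by apply/matrixP => - [].
  by exists 0; split; apply/matrixP => - [].
move: x y hx hy; rewrite -[p.+1]/(1 + p)%N => x y hx hy.
have [a [b [c [xE sa hc]]]] := herm_block hx.
have [a' [b' [c' [yE sa' hc']]]] := herm_block hy.
have [n n0 [ua ua']] := shift_unit a a'.
have san : s (a + n%:R) = a + n%:R by rewrite linearD /= sa s_nat.
have san' : s (a' + natA n) = a' + natA n by rewrite linearD /= sa' s_natA.
have [e se [ae ea]] := herm_shift_inverse san ua.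
have [e' se' [ae' ea']] := herm_shift_inverse san' ua'.
have hS (f : A) : s f = f -> starmx (f%:M : 'M_1) = f%:M.
  by move=> sf; apply/matrixP => i j; rewrite !ord1 !mxE eqxx !mulr1n.
have hd (f : A) q (g : 'M[A]_(1, q)) (h : 'M[A]_q) :
    s f = f -> herm h -> herm (h - starmx g *m (f%:M *m g)).
  by move=> sf hh; rewrite /herm starmxD starmxN !starmxM starmxK hh hS // -mulmxA.
have [d [d0 dx dy dz]] := IH _ _ (hd e _ b c se hc) (hd e' _ b' c' se' hc').
exists (fun i : 'I_(1 + p) => match split i with inl _ => n | inr j => d j end).
have hD q (f : 'I_q -> A) : (forall i, s (f i) = f i) -> herm (diag_mx (\row_i f i)).
  move=> sf; apply/matrixP => i j; rewrite !mxE [j == i]eq_sym.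
  by case: (i =P j) => [->|_]; rewrite ?sf ?linear0.
have DE (f : nat -> A) :
    diag_mx (\row_(i < 1 + p) f (match split i with inl _ => n | inr j => d j end)) =
    block_mx (f n)%:M 0 0 (diag_mx (\row_i f (d i))).
  rewrite (_ : \row_i _ = row_mx (const_mx (f n)) (\row_i f (d i))).
    by rewrite diag_mx_row diag_const_mx.
  by apply/rowP => i; rewrite !mxE; case: split => j; rewrite !mxE.
have hc1 : herm (c + diag_mx (\row_i (d i)%:R)).
  by rewrite /herm starmxD hc (hD _ _ (fun i => s_nat _)).
have hc2 : herm (c' + diag_mx (\row_i natA (d i))).
  by rewrite /herm starmxD hc' (hD _ _ (fun i => s_natA _)).
have [S1a _] := @sg_schur p _ b _ e san hc1 se ae ea ua.
have [S2a S2b] := @sg_schur p _ b' _ e' san' hc2 se' ae' ea' ua'.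
have addE (f g : A) (b1 : 'M[A]_(1, p)) (b2 : 'M[A]_(p, 1)) (c1 c2 : 'M[A]_p) :
    block_mx f%:M b1 b2 c1 + block_mx g%:M 0 0 c2 = block_mx (f + g)%:M b1 b2 (c1 + c2).
  by rewrite add_block_mx !addr0 -raddfD.
have Ex := etrans (congr2 +%R xE (DE (fun n => n%:R))) (addE _ _ _ _ _ _).
have Ey := etrans (congr2 +%R yE (DE natA)) (addE _ _ _ _ _ _).
split; first by move=> i; case: split.
- rewrite [X in sg X]Ex S1a -[RHS]dx; congr sg; exact: addrAC.
- rewrite [X in sg X]Ey S2a -[RHS]dy; congr sg; exact: addrAC.
rewrite [X in inverse X](Ey : _ = _); apply: S2b.
by rewrite addrAC.
Qed.

(* For y = x^-1 and D diagonal, x + D and y + D^-1 are the two blocks of a form congruent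
   to the orthogonal sum of x and D. *)
Lemma neutral_herm p (x : 'M[A]_p) : herm x -> (forall u, act x u = 0 -> u = 0) -> sg x = 0.
Proof.
move=> hx /(herm_inverse hx)[y hy [xy yx]].
have [d [d0 dx dy [z [yz zy]]]] := generic_shift hx hy.
set D := diag_mx (\row_i (d i)%:R) in dx.
set D' := diag_mx (\row_i natA (d i)) in dy yz zy.
have DD' : D *m D' = 1%:M.
  by rewrite mulmx_diag -diag_const_mx; congr diag_mx; apply/rowP => i; rewrite !mxE (natA_mul (d0 i)).1.
have D'D : D' *m D = 1%:M.
  by rewrite mulmx_diag -diag_const_mx; congr diag_mx; apply/rowP => i; rewrite !mxE (natA_mul (d0 i)).2.
have hD (f : 'I_p -> A) : (forall i, s (f i) = f i) -> herm (diag_mx (\row_i f i)).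
  move=> sf; apply/matrixP => i j; rewrite !mxE [j == i]eq_sym.
  by case: (i =P j) => [->|_]; rewrite ?sf ?linear0.
have hDn : herm D by apply: hD => i; apply: s_nat.
have hDn' : herm D' by apply: hD => i; apply: s_natA.
(* The first [p] columns span the diagonal, on which the form is [x + D]; the others span its
   orthogonal complement, since [x *m y = D *m D'], with form [y + D']. *)
pose c : 'M[A]_(p + p) := block_mx 1%:M y 1%:M (- D').
pose c' : 'M[A]_(p + p) := block_mx (D' *m z) (1%:M - D' *m z) z (- z).
have cc' : c *m c' = 1%:M.
  have e : D' *m z + y *m z = 1%:M by rewrite -mulmxDl addrC.
  rewrite mulmx_block !mul1mx !mulNmx !mulmxN opprK subrr subrK e.
  by rewrite -addrA -opprD e subrr -scalar_mx_block.
have cE : starmx c *m block_mx x 0 0 D *m c = block_mx (x + D) 0 0 (y + D').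
  rewrite starmx_block !starmx1 starmxN hy hDn' !mulmx_block.
  rewrite !(mulmx0, mulmx1, mul1mx, addr0, add0r) !mulNmx !mulmxN yx D'D mul1mx.
  by rewrite xy DD' ?mul1mx ?opprK !subrr.
have hxD : herm (block_mx x 0 0 D) by rewrite /herm starmx_block !starmx0 hx hDn.
have sgE : sg (block_mx (x + D) 0 0 (y + D')) = sg (block_mx x 0 0 D).
  rewrite -cE; apply: (@sigf_isom _ _ _ _ _ (act c)).
  - exact: symform_herm.
  - exact: actP.
  - by move=> w; exists (act c' w); rewrite -actM cc' act1.
  by move=> u v; rewrite !actM -pair_act.
have sgD : sg D = 0.
  apply: (@sg_diag0 p (fun i => (d i)%:R)) => i; first exact: s_nat.
  exact: rho_nat_unit.
have h1 : herm (x + D) by rewrite /herm starmxD hx hDn.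
have h2 : herm (y + D') by rewrite /herm starmxD hy hDn'.
have fin (i j k l : int) : i = 0 -> j = 0 -> l = 0 -> i + j = k + l -> k = 0.
  by move=> -> -> ->; rewrite !addr0 => <-.
exact: (fin _ _ _ _ dx dy sgD (etrans (esym (sg_block h1 h2)) (etrans sgE (sg_block hx hDn)))).
Qed.

End Points.

(** * Polynomial families of symmetric elements *)

Lemma tau_map (E F : fieldType) (iota : {rmorphism E -> F}) (f h : {poly E}) :
  tau (map_poly iota f) (map_poly iota h) = iota (tau f h).
Proof. by rewrite /tau -map_modp coef_map size_map_poly. Qed.

(** If the remainder of [h] were nonzero, a power of [X] would move its leading coefficient to
    degree [r - 1], where Euler's functional reads it off. *)
Lemma tau_nondeg (F : fieldType) (f h : {poly F}) r : size f = r.+1 -> f \is monic ->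
  (forall i : 'I_r, tau f ('X^i * h) = 0) -> f %| h.
Proof.
move=> sf mf H; apply/modp_eq0P; set g := h %% f.
have f0 : f != 0 by rewrite monic_neq0.
have sg : (size g <= r)%N by rewrite -ltnS -sf ltn_modp.
apply/eqP; apply: contraT => g0.
have sg0 : (0 < size g)%N by rewrite size_poly_gt0.
have ir : (r - size g < r)%N by rewrite ltn_subrL sg0 (leq_trans sg0 sg).
have := H (Ordinal ir); rewrite /tau /= -modp_mul -/g modp_small; last first.
  by rewrite mulrC size_mulXn // sf ltnS subnK.
rewrite coefXnM sf /=.
have le : (r - size g <= r.-1)%N by rewrite -ltnS (ltn_predK ir).
rewrite ltnNge le /= (_ : (r.-1 - (r - size g))%N = (size g).-1).
  by rewrite -lead_coefE => /eqP; rewrite lead_coef_eq0 (negPf g0).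
by rewrite -predn_sub subKn.
Qed.

Section Algebraic.
Variables (E : fieldType) (A : falgType E) (s : 'End(A)).
Variables (K : rcfType) (iota : {rmorphism E -> K}).
Variables (m : nat) (rho : A -> 'M[K]_m) (G : 'M[K]_m).
Local Notation be i := ((vbasis {:A})`_i).
Local Notation d := (\dim {:A}).
Hypothesis pt : hermrep s iota rho G.
Hypothesis sM : forall a b, s (a * b) = s b * s a.
Hypothesis sK : forall a, s (s a) = a.
Implicit Types (u : 'I_d -> {poly E}).

Definition Rpoly u : 'M[{poly K}]_m :=
  \sum_i map_poly iota (u i) *: map_mx polyC (rho (be i)).

Lemma evalmx_Rpoly u t :
  evalmx t (Rpoly u) = \sum_i (map_poly iota (u i)).[t] *: rho (be i).
Proof.
apply/matrixP => a b; rewrite mxE /horner_eval !summxE horner_sum.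
by apply: eq_bigr => i _; rewrite !mxE hornerM hornerC.
Qed.

Definition Spoly u : 'M[{poly K}]_m := map_mx polyC G *m Rpoly u.

(* The element \sum_i u i e_i of A[X] is fixed by s. *)
Definition sym_coord u : Prop := forall k,
  \sum_(i < d) coord (vbasis {:A}) k (s (be i)) *: u i = u k.

Lemma rho_coord a : rho a = \sum_(k < d) iota (coord (vbasis {:A}) k a) *: rho (be k).
Proof.
rewrite [in LHS](coord_vbasis (memvf a)) (rho_sum pt).
by apply: eq_bigr => k _; rewrite (ptZ pt).
Qed.

Lemma SpolyE u : Spoly u = \sum_i map_poly iota (u i) *: map_mx polyC (G *m rho (be i)).
Proof.
rewrite /Spoly mulmx_sumr; apply: eq_bigr => i _.
by rewrite -scalemxAr map_mxM.
Qed.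

Lemma Spoly_sym u : sym_coord u -> (Spoly u)^T = Spoly u.
Proof.
move=> su; rewrite SpolyE linear_sum /=.
transitivity (\sum_(i < d) \sum_(k < d) map_poly iota (coord (vbasis {:A}) k (s (be i)) *: u i) *:
    map_mx polyC (G *m rho (be k))).
  apply: eq_bigr => i _; rewrite linearZ /= matrix.map_trmx trmx_mul (ptG pt) (ptS pt).
  rewrite rho_coord mulmx_sumr raddf_sum /= scaler_sumr; apply: eq_bigr => k _.
  rewrite -scalemxAr map_mxZ scalerA map_polyZ mulrC mul_polyC //.
rewrite exchange_big; apply: eq_bigr => k _ /=.
by rewrite -scaler_suml -rmorph_sum su.
Qed.

(** Left multiplication by the element [\sum_i u i e_i] of [A[X]], acting on rows of coordinates. *)
Definition Lpoly u : 'M[{poly E}]_d :=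
  \matrix_(j, k) \sum_(i < d) coord (vbasis {:A}) k (be i * be j) *: u i.

Lemma Rpoly_mul u (z : 'I_d -> {poly E}) :
  Rpoly u *m Rpoly z = Rpoly (fun k => ((\row_j z j) *m Lpoly u) 0 k).
Proof.
rewrite /Rpoly mulmx_suml.
transitivity (\sum_(i < d) \sum_(j < d) \sum_(k < d)
    map_poly iota (coord (vbasis {:A}) k (be i * be j) *: (z j * u i)) *: map_mx polyC (rho (be k))).
  apply: eq_bigr => i _; rewrite mulmx_sumr; apply: eq_bigr => j _.
  rewrite -scalemxAl -scalemxAr -map_mxM -(ptM pt) rho_coord raddf_sum /= scalerA scaler_sumr.
  apply: eq_bigr => k _; rewrite map_mxZ scalerA map_polyZ rmorphM /=.
  by rewrite mulrC mul_polyC [_ (u i) * _]mulrC.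
under eq_bigr do rewrite exchange_big /=.
rewrite exchange_big; apply: eq_bigr => k _ /=.
under eq_bigr do rewrite -scaler_suml -rmorph_sum.
rewrite -scaler_suml -rmorph_sum; congr (map_poly iota _ *: _).
rewrite mxE exchange_big; apply: eq_bigr => j _ /=.
rewrite !mxE mulr_sumr; apply: eq_bigr => i _.
by rewrite scalerAr.
Qed.

(* The norm of \sum_i u i e_i: its roots are those of det (Spoly u), but it has coefficients
   in E, so that the components of the complement of its roots contain points algebraic over E. *)
Definition ppoly u : {poly E} := \det (Lpoly u).

(** Cramer's rule: the adjugate of the left multiplication, applied to 1, gives the cofactor [z]. *)
Lemma Rpoly_adj u : exists z, Rpoly u *m Rpoly z = (map_poly iota (ppoly u))%:M.
Proof.
pose e1 : 'rV[{poly E}]_d := \row_k (coord (vbasis {:A}) k 1)%:P.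
exists (fun j => (e1 *m \adj (Lpoly u)) 0 j).
rewrite Rpoly_mul (_ : \row_j _ = e1 *m \adj (Lpoly u)); last by apply/rowP => j; rewrite mxE.
rewrite -mulmxA mul_adj_mx mul_mx_scalar /Rpoly.
transitivity (map_poly iota (ppoly u) *: map_mx polyC (rho 1)); last first.
  by rewrite (pt1 pt) map_mx1 scalemx1.
rewrite [rho 1]rho_coord -!/(ppoly u); move: (ppoly u) => p.
rewrite !raddf_sum /=; apply: eq_bigr => k _.
by rewrite !mxE map_mxZ scalerA rmorphM /= map_polyC.
Qed.

Lemma det_Spoly_dvd u : \det (Spoly u) %| map_poly iota (ppoly u) ^+ m.
Proof.
have [z zE] := Rpoly_adj u; apply/dvdpP.
exists ((\det G)^-1%:P * \det (Rpoly z)).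
rewrite -det_scalar -zE !det_mulmx det_map_mx.
have dG : \det G != 0 by rewrite -unitfE -unitmxE (ptU pt).
transitivity (((\det G)^-1%:P * (\det G)%:P) * (\det (Rpoly u) * \det (Rpoly z))); last by ring.
by rewrite -polyCM mulVf // mul1r.
Qed.

Lemma root_det_Spoly u t : root (\det (Spoly u)) t -> root (map_poly iota (ppoly u)) t.
Proof.
have /dvdpP[q qE] := det_Spoly_dvd u => rt.
have : root (map_poly iota (ppoly u) ^+ m) t by rewrite qE rootM rt orbT.
by rewrite /root horner_exp expf_eq0 => /andP[].
Qed.

(** A zero of the norm makes the element at [t] a zero divisor, with a nonzero cofactor [y] over
    [K]; by [ptI] the representation stays faithful over [K], so the matrix of the element is
    singular. *)
Lemma root_ppoly u t : root (map_poly iota (ppoly u)) t -> root (\det (Spoly u)) t.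
Proof.
rewrite /ppoly -det_map_mx /root -!det_evalmx => /det0P[y y0 yL].
apply: contraNT y0 => dS; apply/eqP/rowP => j; rewrite mxE.
move: j; apply: (ptI pt).
have uR : evalmx t (Rpoly u) \in unitmx.
  move: dS; rewrite det_evalmx det_mulmx hornerM mulf_eq0 negb_or => /andP[_].
  by rewrite -det_evalmx unitmxE unitfE.
rewrite -[LHS](mulKmx uR) (_ : evalmx t (Rpoly u) *m _ = 0) ?mulmx0 //.
transitivity (\sum_(k < d) (y *m evalmx t (map_mx (map_poly iota) (Lpoly u))) 0 k *: rho (be k)); last first.
  by rewrite yL big1 // => k _; rewrite mxE scale0r.
rewrite evalmx_Rpoly mulmx_suml.
transitivity (\sum_(i < d) \sum_(j < d) \sum_(k < d)
    ((map_poly iota (u i)).[t] * y 0 j * iota (coord (vbasis {:A}) k (be i * be j))) *: rho (be k)).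
  apply: eq_bigr => i _; rewrite mulmx_sumr; apply: eq_bigr => j _.
  rewrite -scalemxAl -scalemxAr -(ptM pt) rho_coord scalerA scaler_sumr.
  by apply: eq_bigr => k _; rewrite scalerA.
under eq_bigr do rewrite exchange_big /=.
rewrite exchange_big; apply: eq_bigr => k _ /=.
under eq_bigr do rewrite -scaler_suml.
rewrite -scaler_suml; congr (_ *: _); rewrite mxE exchange_big; apply: eq_bigr => j _ /=.
rewrite !mxE rmorph_sum /horner_eval horner_sum mulr_sumr; apply: eq_bigr => i _.
by rewrite /= map_polyZ hornerZ; ring.
Qed.

(* The transfer along tau of the form <c * \sum_l u l e_l> over A[X]/f. *)
Definition resmx (f c : {poly E}) u r : 'M[A]_r :=
  \matrix_(i, j) \sum_(l < d) tau f (c * 'X^(i + j) * u l) *: be l.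

Lemma resmx_herm f c u r : sym_coord u -> herm s (resmx f c u r).
Proof.
move=> su; apply/matrixP => i j; rewrite !mxE linear_sum addnC /=.
transitivity (\sum_(l < d) \sum_(k < d)
    tau f (c * 'X^(i + j) * (coord (vbasis {:A}) k (s (be l)) *: u l)) *: be k).
  apply: eq_bigr => l _; rewrite linearZ /=.
  rewrite {1}(coord_vbasis (memvf (s (be l)))) scaler_sumr; apply: eq_bigr => k _.
  by rewrite -scalerAr tauZ scalerA mulrC.
rewrite exchange_big; apply: eq_bigr => k _ /=.
by rewrite -scaler_suml -tau_sum -mulr_sumr su.
Qed.

(** The bridge between two computations of one signature: [neutral_herm] applies to the left side,
    [resform_sig] to the right side. *)
Lemma pair_resmx f c u r v w :
  pair G v (act rho (resmx f c u r) w) =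
  resform (map_poly iota f) (map_poly iota c *: Spoly u) v w.
Proof.
rewrite /pair /mxtrace; under eq_bigr do rewrite mulmx_act.
have rVE a (z : 'M[K]_(m, r)) : rVpoly (row a z) = \sum_i z a i *: 'X^i.
  rewrite [row a z]row_sum_delta linear_sum; apply: eq_bigr => i _.
  by rewrite linearZ /= rVpoly_delta mxE.
have key (i j : 'I_r) a b :
    tau (map_poly iota f) ('X^i * (map_poly iota c *: Spoly u) a b * 'X^j) =
    (G *m rho (resmx f c u r i j)) a b.
  have -> : (map_poly iota c *: Spoly u) a b =
      \sum_(l < d) ((G *m rho (be l)) a b)%:P * (map_poly iota c * map_poly iota (u l)).
    rewrite mxE SpolyE summxE mulr_sumr; apply: eq_bigr => l _.
    rewrite mxE [X in _ * (_ * X)]mxE; ring.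
  rewrite [X in rho X]mxE (rho_sum pt) mulmx_sumr summxE.
  rewrite mulr_sumr mulr_suml tau_sum.
  apply: eq_bigr => l _; rewrite (ptZ pt) -scalemxAr [RHS]mxE -tau_map.
  rewrite [RHS]mulrC -tauZ !rmorphM /= map_polyXn exprD; congr tau.
  by rewrite -mul_polyC; ring.
rewrite /resform.
transitivity (\sum_i \sum_j \sum_a \sum_b v a i * (G *m rho (resmx f c u r i j)) a b * w b j).
  apply: eq_bigr => i _; apply: eq_bigr => j _; rewrite !mulmxA -(mulmxA v^T) mxE.
  under eq_bigr do rewrite mxE mulr_suml.
  rewrite exchange_big; apply: eq_bigr => a _; apply: eq_bigr => b _ /=.
  by rewrite [v^T _ _]mxE.
under eq_bigr do rewrite exchange_big /=.
rewrite exchange_big; apply: eq_bigr => a _ /=.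
under eq_bigr do rewrite exchange_big /=.
rewrite exchange_big; apply: eq_bigr => b _ /=.
rewrite !rVE !mulr_suml tau_sum; apply: eq_bigr => i _.
rewrite mulr_sumr tau_sum; apply: eq_bigr => j _.
by rewrite -key -scalerAr -!scalerAl !tauZ; ring.
Qed.

End Algebraic.

Section MinimalPolynomial.
Variables (E F : fieldType) (iota : {rmorphism E -> F}) (t : F).
Local Notation "p ^i" := (map_poly iota p) (at level 2, format "p ^i").

Definition minimal_root (f : {poly E}) : Prop :=
  [/\ f \is monic, root f^i t & forall q, q != 0 -> root q^i t -> (size f <= size q)%N].

Lemma minimal_root_exists : algebraicOver iota t -> exists f, minimal_root f.
Proof.
move=> [q q0 rq].
pose P n := `[< exists q : {poly E}, [/\ q != 0, root q^i t & size q = n] >].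
have exP : exists n, P n by exists (size q); apply/asboolP; exists q.
case: (ex_minnP exP) => n /asboolP[g [g0 rg sg]] minn.
exists ((lead_coef g)^-1 *: g).
have lg : (lead_coef g)^-1 != 0 by rewrite invr_eq0 lead_coef_eq0.
split.
- by rewrite monicE lead_coefZ mulVf // lead_coef_eq0.
- by rewrite map_polyZ rootZ // fmorph_eq0.
by move=> h h0 rh; rewrite size_scale // sg; apply: minn; apply/asboolP; exists h.
Qed.

(** [t] is a root of the gcd or of its cofactor in [f]; in the second case minimality makes the gcd
    constant, and either assumption on [c] rules out the first. *)
Lemma minimal_root_coprime (f c : {poly E}) : minimal_root f -> c != 0 ->
  (size c < size f)%N \/ ~~ root c^i t -> coprimep c f.
Proof.
move=> [mf rf minf] c0 H; have f0 : f != 0 by rewrite monic_neq0.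
have /dvdpP[g fE] := dvdp_gcdr c f.
have g0 : g != 0 by apply: contraNneq f0 => g0; rewrite fE g0 mul0r.
have d0 : gcdp c f != 0 by rewrite gcdp_eq0 (negPf c0).
move: rf; rewrite {1}fE rmorphM rootM => /orP[rg|rd].
  have := minf g g0 rg; rewrite {1}fE size_mul // /coprimep => le.
  have := size_poly_gt0 (gcdp c f); rewrite d0; move: le.
  have : (0 < size g)%N by rewrite size_poly_gt0.
  case: (size g) (size (gcdp c f)) => [|k] [|[|l]] // _.
  by rewrite !addnS addSn /= ltnNge leq_addr.
case: H => [cf|rc].
  have := minf _ d0 rd; rewrite leqNgt (leq_ltn_trans _ cf) //.
  by rewrite dvdp_leq // dvdp_gcdl.
by case/negP: rc; have /dvdpP[h {1}->] := dvdp_gcdl c f; rewrite rmorphM rootM rd orbT.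
Qed.

End MinimalPolynomial.

Lemma derivn_char0 (E : fieldType) (f : {poly E}) r k : (forall n, (n%:R == 0 :> E) = (n == 0)%N) ->
  f \is monic -> size f = r.+1 -> (0 < k <= r)%N -> f^`(k) != 0 /\ (size f^`(k) < size f)%N.
Proof.
move=> ch mf sf /andP[k0 kr]; split.
  apply/eqP => /polyP/(_ (r - k)%N); rewrite coef_derivn subnKC // coef0.
  have := mf; rewrite monicE lead_coefE sf /= => /eqP -> /eqP.
  by rewrite ch -leqn0 leqNgt ffact_gt0 kr.
rewrite sf ltnS; apply/leq_sizeP => i ri; rewrite coef_derivn nth_default ?mul0rn //.
by rewrite sf -(add1n r) leq_add.
Qed.

Section NeutralAlgebraic.
Variables (E : fieldType) (A : falgType E) (s : 'End(A)).
Variables (K : rcfType) (iota : {rmorphism E -> K}).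
Variables (m : nat) (rho : A -> 'M[K]_m) (G : 'M[K]_m).
Local Notation be i := ((vbasis {:A})`_i).
Local Notation d := (\dim {:A}).
Local Notation "p ^i" := (map_poly iota p) (at level 2, format "p ^i").
Hypothesis pt : hermrep s iota rho G.
Hypothesis sM : forall a b, s (a * b) = s b * s a.
Hypothesis sK : forall a, s (s a) = a.
Hypothesis Z : neutral s rho G.
Implicit Types (u : 'I_d -> {poly E}).

(** By nondegeneracy of Euler's functional, [f] divides the product of [c], [Spoly] and the column
    [W] of polynomials encoded by [v]. Multiplying by the adjugate and using coprimality, [f]
    divides [W], whose entries have smaller degree. *)
Lemma resmx_inj (f c : {poly E}) u r (v : 'M[K]_(m, r)) : sym_coord s u -> f \is monic ->
  size f = r.+1 -> coprimep c f -> coprimep (\det (Spoly iota rho G u)) f^i ->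
  act rho (resmx f c u r) v = 0 -> v = 0.
Proof.
move=> su mf sf cf Sf v0.
pose W : 'cV[{poly K}]_m := \col_b rVpoly (row b v).
have dv1 a : f^i %| ((c^i *: Spoly iota rho G u) *m W) a 0.
  apply: (@tau_nondeg _ _ _ r); rewrite ?size_map_poly ?monic_map // => i.
  have : pair G (delta_mx a i) (act rho (resmx f c u r) v) = 0.
    by rewrite v0 /pair mulmx0 mxtrace0.
  rewrite (pair_resmx pt) /resform (bigD1 a) //= [X in _ + X]big1 ?addr0 => [<-|b ba].
    have -> : row a (delta_mx a i) = delta_mx 0 i :> 'rV[K]_r.
      by apply/rowP => j; rewrite !mxE eqxx.
    rewrite mxE mulr_sumr tau_sum rVpoly_delta; apply: eq_bigr => b _.
    by rewrite [W b 0]mxE mulrA.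
  rewrite big1 // => e _; rewrite (_ : row b _ = 0) ?linear0 ?mul0r ?tau0 //.
  by apply/rowP => j; rewrite !mxE (negPf ba).
have dv2 b : f^i %| W b 0.
  have : f^i %| (c^i * \det (Spoly iota rho G u)) * W b 0.
    have -> : (c^i * \det (Spoly iota rho G u)) * W b 0 =
        (\adj (Spoly iota rho G u) *m ((c^i *: Spoly iota rho G u) *m W)) b 0.
      by rewrite -scalemxAl -scalemxAr mulmxA mul_adj_mx mul_scalar_mx !mxE mulrA.
    rewrite mxE; apply: (big_ind (fun p => f^i %| p)) => [|x y|a _]; rewrite ?dvdp0 //.
      exact: dvdp_add.
    by apply: dvdp_mull; apply: dv1.
  rewrite Gauss_dvdpr // coprimep_sym coprimepMl Sf andbT.
  by rewrite coprimep_map.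
apply/row_matrixP => b; apply: (can_inj (@rVpolyK _ _)); rewrite row0 linear0.
have := dv2 b; rewrite mxE => /dvdp_leq; case: eqP => // _ /(_ isT).
by rewrite size_map_poly sf leqNgt ltnS size_poly.
Qed.

(* The transfers of all the twists by products of derivatives of the minimal polynomial f of t
   have signature 0, which isolates the contribution of the root t of f. *)
Lemma neutral_algebraic u t : sym_coord s u -> ~~ root (\det (Spoly iota rho G u)) t ->
  algebraicOver iota t -> sig (evalmx t (Spoly iota rho G u)) = 0.
Proof.
move=> su rt /minimal_root_exists[f mf]; have [f1 rf _] := mf.
have ch n : (n%:R == 0 :> E) = (n == 0)%N by rewrite -(fmorph_eq0 iota) rmorph_nat pnatr_eq0.
have f0 : f != 0 by rewrite monic_neq0.
have [r sf] : exists r, size f = r.+2.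
  case E1 : (size f) => [|[|r]]; last by exists r.
    by move/eqP: E1; rewrite size_poly_eq0 (negPf f0).
  move: rf; have : size f^i = 1%N by rewrite size_map_poly.
  by move/eqP; rewrite size_poly_eq1 => /eqp_root ->; rewrite rootC oner_eq0.
have sfi : size f^i = r.+2 by rewrite size_map_poly.
have mfi : f^i \is monic by rewrite map_monic.
have copD k : (0 < k <= r.+1)%N -> coprimep f^`(k) f.
  move=> kr; have [D0 Ds] := derivn_char0 ch f1 sf kr.
  by apply: (minimal_root_coprime mf) => //; left.
have sepc : coprimep f^i (f^i)^`().
  by rewrite deriv_map coprimep_map coprimep_sym; apply: (copD 1%N).
have sepf : separable_poly f^i by rewrite separable_poly.unlock.
(* The determinant divides a power of the norm, which is defined over [E] and does not vanish at
   [t], hence is coprime to the minimal polynomial. *)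
have copS : coprimep (\det (Spoly iota rho G u)) f^i.
  apply: (coprimep_dvdr (det_Spoly_dvd pt u)); apply: coprimep_expl.
  rewrite coprimep_map; apply: (minimal_root_coprime mf).
    apply: contraNneq rt => p0; apply: (root_ppoly pt); by rewrite p0 rmorph0 root0.
  by right; apply: contra rt; apply: (root_ppoly pt).
have Ssym := Spoly_sym pt su.
pose rs := rootsR f^i.
have rsE x : (x \in rs) = root f^i x.
  have fi0 : f^i != 0 by rewrite monic_neq0.
  by have /roots_onP/(_ x) := roots_on_rootsR fi0; rewrite in_itv /= => /(_ isT) ->.
have main (c : {poly E}) : coprimep c f ->
    \sum_(x <- rs) sgz c^i.[x] * (sgz (f^i)^`().[x] * sig (evalmx x (Spoly iota rho G u))) = 0.
  move=> cf; have hx := resmx_herm f c r.+1 su.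
  have sg0 : sg rho G (resmx f c u r.+1) = 0.
    by apply: (neutral_herm pt sM sK Z hx) => v; apply: resmx_inj.
  have := @resform_sig K m r.+1 f^i (c^i *: Spoly iota rho G u) rs.
  rewrite linearZ /= Ssym => /(_ erefl mfi sfi sepf (uniq_roots _ _ _) rsE).
  have -> : sigf (@resform K m r.+1 f^i (c^i *: Spoly iota rho G u)) = sg rho G (resmx f c u r.+1).
    by apply: (@eq_sigf K) => v w; rewrite (pair_resmx pt).
  rewrite sg0 => /esym resE; rewrite -[RHS]resE; apply: eq_big_seq => x; rewrite rsE => rx.
  have cx : c^i.[x] != 0.
    by apply: (coprimep_root (_ : coprimep f^i c^i)) => //; rewrite coprimep_map coprimep_sym.
  rewrite mulrCA; congr (_ * _).
  rewrite -(@sigZ K m c^i.[x]) //; congr sig; apply/matrixP => i j.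
  by rewrite !mxE /horner_eval hornerM.
have trs : t \in rs by rewrite rsE.
(* The class of polynomials over [E] coprime to [f] is closed under products and contains the
   derivatives of [f], which are nonzero of smaller degree. *)
have := @isolated_weight K (fun c' => exists2 c : {poly E}, coprimep c f & c' = c^i) f^i rs
  (fun x => sgz (f^i)^`().[x] * sig (evalmx x (Spoly iota rho G u))) t (uniq_roots _ _ _) trs.
move=> /(_ _ _ _ _ _ _ _)/eqP; rewrite mulf_eq0 => H.
have /orP[|/eqP //] : (sgz (f^i)^`().[t] == 0) || (sig (evalmx t (Spoly iota rho G u)) == 0).
  apply: H.
  - by move=> x; rewrite rsE.
  - by move=> _ [c cf ->]; apply: main.
  - by exists 1; rewrite ?coprime1p ?rmorph1.
  - by move=> _ _ [c cf ->] [c' cf' ->]; exists (c * c'); rewrite ?coprimepMl ?cf ?rmorphM.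
  - move=> _ [c cf ->] x; rewrite rsE => rx; rewrite /root.
    by apply: (coprimep_root (_ : coprimep f^i c^i)) => //; rewrite coprimep_map coprimep_sym.
  - move=> k; rewrite sfi => /andP[k0 kr]; exists f^`(k); last by rewrite derivn_map.
    by apply: copD; rewrite k0.
  - by rewrite sfi.
rewrite sgz_eq0 => /eqP d0.
have /(coprimep_root sepc) := rf.
by rewrite d0 eqxx.
Qed.

End NeutralAlgebraic.

(** * Evaluation at arbitrary points *)

Section NeutralGeneral.
Variables (E : fieldType) (K : rcfType) (iota : {rmorphism E -> K}).
Local Notation "p ^i" := (map_poly iota p) (at level 2, format "p ^i").

Lemma seq_closest_below (s : seq K) (t : K) :
  (exists l, [/\ l \in s, l < t & forall x, x \in s -> x < t -> x <= l]) \/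
  (forall x, x \in s -> t <= x).
Proof.
elim: s => [|y s IH]; first by right.
have [ty|yt] := leP t y.
  case: IH => [[l [ls lt H]]|H]; [left; exists l; split=> // | right].
  - by rewrite inE ls orbT.
  - by move=> x; rewrite inE => /orP[/eqP ->|/H //]; rewrite ltNge ty.
  by move=> x; rewrite inE => /orP[/eqP ->|/H].
left; case: IH => [[l [ls lt H]]|H].
  exists (Num.max y l); split; rewrite ?gt_max ?yt ?lt //.
    by rewrite inE; case: leP => _; rewrite ?eqxx ?ls ?orbT.
  by move=> x; rewrite inE => /orP[/eqP -> _|/H {}H /H xl]; rewrite le_max ?lexx ?xl ?orbT.
exists y; split; rewrite ?mem_head // => x; rewrite inE => /orP[/eqP ->//|/H tx].
by rewrite ltNge tx.
Qed.

Lemma seq_closest_above (s : seq K) (t : K) :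
  (exists l, [/\ l \in s, t < l & forall x, x \in s -> t < x -> l <= x]) \/
  (forall x, x \in s -> x <= t).
Proof.
case: (seq_closest_below (map -%R s) (- t)) => [[l [/mapP[y ys ->]]]|H].
  rewrite ltrN2 => ty H; left; exists y; split=> // x xs tx.
  by rewrite -lerN2; apply: H; rewrite ?ltrN2 // map_f.
by right=> x xs; rewrite -lerN2; apply: H; rewrite map_f.
Qed.

(** Algebraic elements need not be dense in [K], but the roots of [q] are algebraic: if [l] and [h]
    are the roots nearest to [t] on either side, then [(l + h) / 2], or [l + 1], [h - 1], [0] when
    neighbours are missing, lies in the component of [t]. *)
Lemma algebraic_between (q : {poly E}) t : ~~ root q^i t ->
  exists2 t0, algebraicOver iota t0 &
    forall x, (t <= x <= t0) || (t0 <= x <= t) -> ~~ root q^i x.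
Proof.
move=> rt; have qi0 : q^i != 0 by apply: contraNneq rt => ->; rewrite root0.
have q0 : q != 0 by apply: contraNneq qi0 => ->; rewrite rmorph0.
have rsE x : (x \in rootsR q^i) = root q^i x.
  by have /roots_onP/(_ x) := roots_on_rootsR qi0; rewrite in_itv /= => /(_ isT) ->.
have alg x : x \in rootsR q^i -> algebraicOver iota x by rewrite rsE; exists q.
have alg2 : algebraicOver iota 2%:R by rewrite -(rmorph_nat iota); apply: algebraic_id.
have [[l [ls lt Hl]]|Hl] := seq_closest_below (rootsR q^i) t;
  have [[h [hs th Hh]]|Hh] := seq_closest_above (rootsR q^i) t.
- exists ((l + h) / 2%:R).
    by apply: algebraic_div => //; apply: algebraic_add; apply: alg.
  have lh : l < h by apply: lt_trans lt th.
  have l2 : l < (l + h) / 2%:R by rewrite midf_lt.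
  have h2 : (l + h) / 2%:R < h by rewrite midf_lt.
  move=> x /orP[/andP[tx x0]|/andP[x0 xt]]; rewrite -rsE; apply/negP => xs.
    have {tx}tx : t < x by rewrite lt_neqAle tx andbT; apply: contraNneq rt => ->; rewrite -rsE.
    by have := lt_le_trans (le_lt_trans x0 h2) (Hh x xs tx); rewrite ltxx.
  have {xt}xt : x < t by rewrite lt_neqAle xt andbT; apply: contraNneq rt => <-; rewrite -rsE.
  by have := lt_le_trans (lt_le_trans l2 x0) (Hl x xs xt); rewrite ltxx.
- exists (l + 1); first by apply: algebraic_add; [exact: alg | exact: algebraic1].
  move=> x /orP[/andP[tx x0]|/andP[x0 xt]]; rewrite -rsE; apply/negP => xs.
    by move: rt; rewrite (_ : t = x) -?rsE ?xs //; apply: le_anti; rewrite tx Hh.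
  have {xt}xt : x < t by rewrite lt_neqAle xt andbT; apply: contraNneq rt => <-; rewrite -rsE.
  by have := le_trans x0 (Hl x xs xt); rewrite leNgt ltrDl ltr01.
- exists (h - 1); first by apply: algebraic_sub; [exact: alg | exact: algebraic1].
  move=> x /orP[/andP[tx x0]|/andP[x0 xt]]; rewrite -rsE; apply/negP => xs; last first.
    by move: rt; rewrite (_ : t = x) -?rsE ?xs //; apply: le_anti; rewrite xt Hl.
  have {tx}tx : t < x by rewrite lt_neqAle tx andbT; apply: contraNneq rt => ->; rewrite -rsE.
  have := le_trans (Hh x xs tx) x0.
  by rewrite leNgt ltrBlDr ltrDl ltr01.
exists 0; first exact: algebraic0.
move=> x _; rewrite -rsE; apply/negP => xs; move: rt; rewrite (_ : t = x) -?rsE ?xs //.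
by apply: le_anti; rewrite Hl ?Hh.
Qed.

Variables (A : falgType E) (s : 'End(A)).
Variables (m : nat) (rho : A -> 'M[K]_m) (G : 'M[K]_m).
Hypothesis pt : hermrep s iota rho G.
Hypothesis sM : forall a b, s (a * b) = s b * s a.
Hypothesis sK : forall a, s (s a) = a.
Hypothesis Z : neutral s rho G.

(* sig is constant between t and an algebraic t0 that no root of the norm separates from t. *)
Lemma neutral_eval (u : 'I_(\dim {:A}) -> {poly E}) t : sym_coord s u ->
  ~~ root (\det (Spoly iota rho G u)) t -> sig (evalmx t (Spoly iota rho G u)) = 0.
Proof.
move=> su rt; have pt0 : ~~ root (ppoly u)^i t by apply: contra rt; apply: (root_ppoly pt).
have [t0 at0 H] := algebraic_between pt0.
have Ssym := Spoly_sym pt su.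
have S0 x : (t <= x <= t0) || (t0 <= x <= t) -> ~~ root (\det (Spoly iota rho G u)) x.
  by move=> /H; apply: contra; apply: (root_det_Spoly pt).
have nt0 : sig (evalmx t0 (Spoly iota rho G u)) = 0.
  apply: (neutral_algebraic pt sM sK Z) => //; apply: S0.
  by case: (leP t t0) => [le|/ltW le]; rewrite ?le ?lexx ?orbT.
rewrite -[RHS]nt0; case: (leP t t0) => [le|/ltW le].
  by apply: sig_const => // x xt; apply: S0; rewrite xt.
by symmetry; apply: sig_const => // x xt; apply: S0; rewrite xt orbT.
Qed.

End NeutralGeneral.

(** * Extension of the base field *)

Section Adjoin.
Variables (E : fieldType) (K : rcfType) (iota : {rmorphism E -> K}) (t : K).
Local Notation "p ^i" := (map_poly iota p) (at level 2, format "p ^i").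

(** The subfield E(t) of [K] as a set of values of fractions, which treats algebraic and
    transcendental [t] alike. *)
Definition adjpred : {pred K} := fun z =>
  `[< exists u v : {poly E}, v^i.[t] != 0 /\ z = u^i.[t] / v^i.[t] >].

Lemma adjpred_id c : iota c \in adjpred.
Proof.
apply/asboolP; exists c%:P, 1.
by rewrite rmorph1 map_polyC /= !hornerC oner_neq0 divr1.
Qed.

Lemma adjpred_gen : t \in adjpred.
Proof.
apply/asboolP; exists 'X, 1.
by rewrite rmorph1 map_polyX /= hornerX hornerC oner_neq0 divr1.
Qed.

Fact adjpred_divring_closed : divring_closed adjpred.
Proof.
split; first by rewrite -(rmorph1 iota) adjpred_id.
  move=> x y /asboolP[u [v [v0 ->]]] /asboolP[u' [v' [v0' ->]]]; apply/asboolP.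
  exists (u * v' - u' * v), (v * v'); rewrite rmorphB !rmorphM /= hornerD hornerN !hornerM.
  by split; [rewrite mulf_neq0 | field; rewrite v0 v0'].
move=> x y /asboolP[u [v [v0 ->]]] /asboolP[u' [v' [v0' ->]]]; apply/asboolP.
have [u0'|u0'] := eqVneq u'^i.[t] 0.
  exists 0, 1; rewrite rmorph0 rmorph1 horner0 hornerC oner_neq0 u0'.
  by rewrite mul0r invr0 mulr0 mul0r.
exists (u * v'), (v * u'); rewrite !rmorphM /= !hornerM.
by split; [rewrite mulf_neq0 | field; rewrite v0 v0' u0'].
Qed.
HB.instance Definition _ := GRing.isDivringClosed.Build K adjpred adjpred_divring_closed.

Record adjoin := Adjoin { adjval :> K; adjvalP : adjval \in adjpred }.
HB.instance Definition _ := [isSub for adjval].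
HB.instance Definition _ := [Choice of adjoin by <:].
HB.instance Definition _ := [SubChoice_isSubComUnitRing of adjoin by <:].
HB.instance Definition _ := [SubComUnitRing_isSubIntegralDomain of adjoin by <:].
HB.instance Definition _ := [SubIntegralDomain_isSubField of adjoin by <:].

Definition adj_in (c : E) : adjoin := Adjoin (adjpred_id c).
Definition adj_gen : adjoin := Adjoin adjpred_gen.

Fact adj_in_additive : zmod_morphism adj_in.
Proof. by move=> x y; apply: val_inj; rewrite /= rmorphB. Qed.
Fact adj_in_multiplicative : monoid_morphism adj_in.
Proof. by split=> [|x y]; apply: val_inj; rewrite /= ?rmorph1 ?rmorphM. Qed.
HB.instance Definition _ := GRing.isZmodMorphism.Build E adjoin adj_in adj_in_additive.
HB.instance Definition _ := GRing.isMonoidMorphism.Build E adjoin adj_in adj_in_multiplicative.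

Fact adjval_additive : zmod_morphism adjval. Proof. by []. Qed.
Fact adjval_multiplicative : monoid_morphism adjval. Proof. by []. Qed.
HB.instance Definition _ := GRing.isZmodMorphism.Build adjoin K adjval adjval_additive.
HB.instance Definition _ := GRing.isMonoidMorphism.Build adjoin K adjval adjval_multiplicative.

End Adjoin.

Section ExtendRep.
Variables (E : fieldType) (K : rcfType) (iota : {rmorphism E -> K}) (t : K).
Local Notation L := (adjoin iota t).
Local Notation jota := (@adjval _ _ iota t : {rmorphism L -> K}).
Variables (A : falgType E) (s : 'End(A)).
Variables (m : nat) (rho : A -> 'M[K]_m) (G : 'M[K]_m).
Hypothesis pt : hermrep s iota rho G.
Hypothesis sM : forall a b, s (a * b) = s b * s a.
Hypothesis sK : forall a, s (s a) = a.
Local Notation be i := ((vbasis {:A})`_i).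
Local Notation d := (\dim {:A}).
Local Notation AL := (scalext (adj_in iota t) A).

Definition ext_inv : 'End(AL) := linfun (scalext_map s).
Definition ext_rho (x : AL) : 'M[K]_m := \sum_i adjval (crd x i) *: rho (be i).

Lemma ext_rhoP c (u v : AL) : ext_rho (c *: u + v) = adjval c *: ext_rho u + ext_rho v.
Proof.
rewrite /ext_rho scaler_sumr -big_split; apply: eq_bigr => i _ /=.
by rewrite /crd !mxE rmorphD rmorphM scalerDl scalerA.
Qed.

Lemma ext_rhoD u v : ext_rho (u + v) = ext_rho u + ext_rho v.
Proof. by rewrite -[u]scale1r ext_rhoP rmorph1 !scale1r. Qed.

Lemma ext_rho0 : ext_rho 0 = 0.
Proof. by apply: (addrI (ext_rho 0)); rewrite -ext_rhoD !addr0. Qed.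

Lemma ext_rhoZ c u : ext_rho (c *: u) = adjval c *: ext_rho u.
Proof. by rewrite -[_ *: u]addr0 ext_rhoP ext_rho0 addr0. Qed.

Lemma ext_rho_sum (I : finType) (F : I -> AL) : ext_rho (\sum_i F i) = \sum_i ext_rho (F i).
Proof. by apply: big_morph; [exact: ext_rhoD | exact: ext_rho0]. Qed.

Lemma ext_rho_tens1 a : ext_rho (tens1 (adj_in iota t) a) = rho a.
Proof.
rewrite [RHS](rho_coord pt) /ext_rho; apply: eq_bigr => i _.
by rewrite /crd mxE.
Qed.

Lemma ext_rho_hermrep : hermrep ext_inv jota ext_rho G.
Proof.
split.
- exact: ext_rhoD.
- move=> u v; rewrite -[u * v]/(scalext_mul u v) /scalext_mul ext_rho_sum.
  rewrite [X in _ = X *m _]/ext_rho mulmx_suml; apply: eq_bigr => i _.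
  rewrite ext_rho_sum [X in _ = _ *m X]/ext_rho mulmx_sumr; apply: eq_bigr => k _.
  by rewrite ext_rhoZ ext_rho_tens1 (ptM pt) -scalemxAl -scalemxAr scalerA rmorphM.
- by rewrite ext_rho_tens1 (pt1 pt).
- exact: ext_rhoZ.
- move=> u; rewrite /ext_inv lfunE /= /scalext_map ext_rho_sum mulmx_sumr.
  rewrite [X in X^T]/ext_rho linear_sum mulmx_suml; apply: eq_bigr => i _.
  by rewrite ext_rhoZ ext_rho_tens1 linearZ /= -scalemxAl -scalemxAr (ptS pt).
- exact: (ptG pt).
- exact: (ptU pt).
move=> k k0.
(* The chosen basis of [AL] need not consist of the [tens1] of basis elements of [A]; independence
   is transported by the change of basis [W], which remains row free over [K]. *)
pose W : 'M[L]_(\dim {:AL}, d) := \matrix_(j, i) crd (vbasis {:AL})`_j i.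
have fW : row_free W.
  rewrite -kermx_eq0; apply/negPn/negP => /rowV0Pn[y /sub_kermxP yW /eqP]; apply.
  have /freeP fr := basis_free (vbasisP {:AL}).
  apply/rowP => j; rewrite mxE; apply: fr => {j}.
  rewrite [LHS]scalext_basis big1 // => i _.
  rewrite (_ : crd _ i = 0) ?scale0r //; move/rowP/(_ i): yW; rewrite !mxE => <-.
  rewrite /crd summxE; apply: eq_bigr => j _.
  by rewrite !mxE.
have : (\row_j k j) *m map_mx jota W = 0.
  apply/rowP => i; rewrite [RHS]mxE; move: i; apply: (ptI pt).
  rewrite -[RHS]k0 /ext_rho; under [RHS]eq_bigr do rewrite scaler_sumr.
  rewrite exchange_big; apply: eq_bigr => i _ /=.
  rewrite mxE scaler_suml; apply: eq_bigr => j _.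
  by rewrite !mxE scalerA.
have fV : row_free (map_mx jota W) by rewrite row_free_map.
move=> kW j; have := row_free_inj fV (etrans kW (esym (mul0mx _ _))).
by move/rowP/(_ j); rewrite !mxE.
Qed.

Lemma ext_invM a b : ext_inv (a * b) = ext_inv b * ext_inv a.
Proof.
rewrite /ext_inv !lfunE /=; apply: (involM (scalext_involution _ _)).
by split=> //; exact: linearD.
Qed.

Lemma ext_invK a : ext_inv (ext_inv a) = a.
Proof.
rewrite /ext_inv !lfunE /=; apply: (involK (scalext_involution _ _)).
by split=> //; exact: linearD.
Qed.

(** Clearing denominators writes [x] as the value at [t] of a polynomial family over [E], up to the
    factor V(t). The family [w] is symmetric perhaps only at [t], so it is replaced by its
    symmetrization [u], whose value is 2 V(t) x. *)
Lemma ext_neutral : neutral s rho G -> neutral ext_inv ext_rho G.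
Proof.
move=> Z x sx ux.
have H i : exists uv : {poly E} * {poly E}, (map_poly iota uv.2).[t] != 0 /\
    adjval (crd x i) = (map_poly iota uv.1).[t] / (map_poly iota uv.2).[t].
  by have /asboolP[u [v uv]] := adjvalP (crd x i); exists (u, v).
have [uv uvP] := choice H.
pose V := \prod_i (uv i).2.
pose w (i : 'I_d) := (uv i).1 * \prod_(j | j != i) (uv j).2.
have V0 : (map_poly iota V).[t] != 0.
  rewrite rmorph_prod horner_prod; apply/prodf_neq0 => i _.
  exact: (uvP i).1.
have wE i : (map_poly iota (w i)).[t] = (map_poly iota V).[t] * adjval (crd x i).
  have -> : V = (uv i).2 * \prod_(j | j != i) (uv j).2 by rewrite /V (bigD1 i).
  rewrite (uvP i).2 /w !rmorphM /= !hornerM.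
  by have v0 := (uvP i).1; field.
pose u (k : 'I_d) := w k + \sum_(i < d) coord (vbasis {:A}) k (s (be i)) *: w i.
have coordss (k l : 'I_d) :
    \sum_(i < d) coord (vbasis {:A}) k (s (be i)) * coord (vbasis {:A}) i (s (be l)) = (k == l)%:R.
  transitivity (coord (vbasis {:A}) k (s (s (be l)))); last first.
    rewrite (sK (be l)); have cf := coord_free l k (basis_free (vbasisP {:A})).
    by apply: etrans cf _; rewrite [X in nat_of_bool X]eq_sym.
  have -> : s (s (be l)) = \sum_(i < d) coord (vbasis {:A}) i (s (be l)) *: s (be i).
    rewrite [in LHS](coord_vbasis (memvf (s (be l)))) linear_sum.
    by apply: eq_bigr => i _; rewrite linearZ.
  rewrite linear_sum; apply: eq_bigr => i _.
  by apply: etrans (esym (linearZ _ _)); rewrite mulrC.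
have su : sym_coord s u.
  move=> k; rewrite /u; under eq_bigr do rewrite scalerDr scaler_sumr.
  rewrite big_split /= addrC; congr (_ + _).
  rewrite exchange_big /=; under eq_bigr do under eq_bigr do rewrite scalerA.
  under eq_bigr do rewrite -scaler_suml coordss.
  rewrite (bigD1 k) //= eqxx scale1r big1 ?addr0 // => l lk.
  by rewrite eq_sym (negPf lk) scale0r.
have evalS : evalmx t (Spoly iota rho G u) = (2%:R * (map_poly iota V).[t]) *: (G *m ext_rho x).
  have -> : evalmx t (Spoly iota rho G u) = G *m evalmx t (Rpoly iota rho u).
    rewrite /Spoly /evalmx map_mxM; congr (_ *m _).
    by apply/matrixP => i j; rewrite !mxE /= /horner_eval hornerC.
  rewrite scalemxAr; congr (_ *m _); rewrite evalmx_Rpoly.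
  transitivity ((map_poly iota V).[t] *: ext_rho x +
    (map_poly iota V).[t] *: ext_rho (ext_inv x)); last first.
    rewrite sx -scalerDl; congr (_ *: _).
    by ring.
  rewrite /u; under eq_bigr do rewrite rmorphD /= hornerD scalerDl.
  rewrite big_split /=; congr (_ + _).
    by rewrite /ext_rho scaler_sumr; apply: eq_bigr => i _; rewrite wE scalerA.
  rewrite /ext_inv lfunE /= /scalext_map ext_rho_sum scaler_sumr.
  under [RHS]eq_bigr do rewrite ext_rhoZ ext_rho_tens1 (rho_coord pt) !scaler_sumr.
  rewrite exchange_big /=; apply: eq_bigr => k _.
  rewrite rmorph_sum horner_sum scaler_suml; apply: eq_bigr => i _ /=.
  rewrite map_polyZ hornerZ wE !scalerA; congr (_ *: _).
  by rewrite /= mulrC -mulrA.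
have c0 : 2%:R * (map_poly iota V).[t] != 0 by rewrite mulf_neq0 // pnatr_eq0.
have := neutral_eval pt sM sK Z su (t := t); rewrite /root -det_evalmx evalS detZ det_mulmx.
rewrite !mulf_eq0 expf_eq0 (negPf c0) andbF /= -[\det G == 0]negbK -unitfE -unitmxE (ptU pt) /=.
rewrite -unitfE -unitmxE => /(_ ux) sc.
have := etrans (esym (sigZ (G *m ext_rho x) c0)) sc.
by move/eqP; rewrite mulf_eq0 sgz_eq0 (negPf c0) => /eqP.
Qed.

End ExtendRep.

(* The coefficients k i are adjoined to E one at a time. *)
Lemma neutral_combination (K : rcfType) (m : nat) (G : 'M[K]_m) (l : nat) :
  forall (E : fieldType) (iota : {rmorphism E -> K}) (A : falgType E) (s : 'End(A))
    (rho : A -> 'M[K]_m),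
  hermrep s iota rho G -> (forall a b, s (a * b) = s b * s a) -> (forall a, s (s a) = a) ->
  neutral s rho G -> forall (a0 : A) (k : 'I_l -> K) (a : 'I_l -> A),
  let T := rho a0 + \sum_i k i *: rho (a i) in
  (G *m T)^T = G *m T -> T \in unitmx -> sig (G *m T) = 0.
Proof.
elim: l => [|l IH] E iota A s rho pt sM sK Z a0 k a T sT uT.
  have TE : T = rho a0 by rewrite /T big_ord0 addr0.
  rewrite TE in sT uT *; apply: Z => //.
  (* Symmetry of [G *m rho a0] means [rho (s a0) = rho a0], and [rho] is injective. *)
  move: sT; rewrite trmx_mul (ptG pt) (ptS pt) => /(congr1 (mulmx (invmx G))).
  rewrite !mulKmx ?(ptU pt) // => /eqP; rewrite -subr_eq0 -(rhoN pt) -(ptD pt) => /eqP.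
  by move/(rho_inj pt)/eqP; rewrite subr_eq0 => /eqP.
pose t := k ord0; pose L := adj_in iota t.
have ept := ext_rho_hermrep t pt.
(* Over E(t) the first coefficient is a scalar of the base field, so its term is absorbed by
   [a0]. *)
have TE : T = @ext_rho _ _ iota t A m rho (tens1 L a0 + adj_gen iota t *: tens1 L (a ord0)) +
    \sum_(i < l) k (lift ord0 i) *: @ext_rho _ _ iota t A m rho (tens1 L (a (lift ord0 i))).
  rewrite (ptD ept) (ptZ ept) !(ext_rho_tens1 t pt) /T big_ord_recl addrA.
  by congr (_ + _); apply: eq_bigr => i _; rewrite (ext_rho_tens1 t pt).
rewrite TE; apply: (IH _ _ _ _ _ ept (ext_invM sM sK) (ext_invK sM sK)).
- exact: ext_neutral.
- by rewrite -TE.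
by rewrite -TE.
Qed.

(** * Ultraproducts of real closed fields *)

Section Ultraproduct.
Variables (I : Type) (U : set_system I) (UF : UltraFilter U) (K : I -> rcfType).
Local Notation T := (forall i, K i).
Implicit Types f g h : T.
Local Open Scope classical_set_scope.
Local Open Scope quotient_scope.

Let ueq (f g : T) : bool := `[< U [set i | f i = g i] >].
Let ueq_refl : reflexive ueq.
Proof. by move=> f; apply/asboolP; apply: filterS (filterT : U _) => i. Qed.
Let ueq_sym : symmetric ueq.
Proof.
by move=> f g; apply/asboolP/asboolP; apply: filterS => i /= ->.
Qed.
Let ueq_trans : transitive ueq.
Proof.
move=> f g h /asboolP gf /asboolP fh; apply/asboolP.
by apply: filterS2 gf fh => i /= -> ->.
Qed.

Definition ultra_eq := EquivRel ueq ueq_refl ueq_sym ueq_trans.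
Definition ultra := {eq_quot ultra_eq}.
HB.instance Definition _ := Choice.on ultra.

Definition cls f : ultra := \pi_ultra f.
Definition rep (x : ultra) : T := repr x.

Lemma clsP f g : cls f = cls g <-> U [set i | f i = g i].
Proof.
split=> [/eqP|fg]; first by rewrite /cls piE => /asboolP.
by apply/eqmodP/asboolP.
Qed.

Lemma repK x : cls (rep x) = x.
Proof. exact: reprK. Qed.

Lemma rep_cls f : U [set i | rep (cls f) i = f i].
Proof. by apply/clsP; rewrite repK. Qed.

Let op2 (o : forall i, K i -> K i -> K i) (x y : ultra) := cls (fun i => o i (rep x i) (rep y i)).
Let op2E o f g : op2 o (cls f) (cls g) = cls (fun i => o i (f i) (g i)).
Proof. by apply/clsP; apply: filterS2 (rep_cls f) (rep_cls g) => i /= -> ->. Qed.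

Definition uadd := op2 (fun _ => +%R).
Definition umul := op2 (fun _ => *%R).
Definition uopp (x : ultra) := cls (fun i => - rep x i).
Definition uinv (x : ultra) := cls (fun i => (rep x i)^-1).
Definition unorm (x : ultra) := cls (fun i => `|rep x i|).
Definition ule (x y : ultra) := `[< U [set i | rep x i <= rep y i] >].

Let uaddE f g : uadd (cls f) (cls g) = cls (fun i => f i + g i) := op2E _ f g.
Let umulE f g : umul (cls f) (cls g) = cls (fun i => f i * g i) := op2E _ f g.
Let uoppE f : uopp (cls f) = cls (fun i => - f i).
Proof. by apply/clsP; apply: filterS (rep_cls f) => i /= ->. Qed.
Let uinvE f : uinv (cls f) = cls (fun i => (f i)^-1).
Proof. by apply/clsP; apply: filterS (rep_cls f) => i /= ->. Qed.
Let unormE f : unorm (cls f) = cls (fun i => `|f i|).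
Proof. by apply/clsP; apply: filterS (rep_cls f) => i /= ->. Qed.
Let uleP f g : reflect (U [set i | f i <= g i]) (ule (cls f) (cls g)).
Proof.
apply: (iffP (asboolP _)) => fg; apply: filterS3 fg (rep_cls f) (rep_cls g) => i /=.
  by move=> + <- <-.
by move=> + -> ->.
Qed.

Let clsW (P : ultra -> Prop) : (forall f, P (cls f)) -> forall x, P x.
Proof. by move=> Pf x; rewrite -[x]repK. Qed.
Lemma all_cls f g : (forall i, f i = g i) -> cls f = cls g.
Proof. by move=> fg; apply/clsP; apply: filterS (filterT : U _) => i _ /=. Qed.

Let uaddA : associative uadd.
Proof.
elim/clsW=> f; elim/clsW=> g; elim/clsW=> h; rewrite !uaddE.
by apply: all_cls => i; rewrite addrA.
Qed.
Let uaddC : commutative uadd.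
Proof. by elim/clsW=> f; elim/clsW=> g; rewrite !uaddE; apply: all_cls => i; rewrite addrC. Qed.
Let uadd0 : left_id (cls (fun=> 0)) uadd.
Proof. by elim/clsW=> f; rewrite uaddE; apply: all_cls => i; rewrite add0r. Qed.
Let uaddN : left_inverse (cls (fun=> 0)) uopp uadd.
Proof. by elim/clsW=> f; rewrite uoppE uaddE; apply: all_cls => i; rewrite addNr. Qed.
HB.instance Definition _ := GRing.isZmodule.Build ultra uaddA uaddC uadd0 uaddN.

Let umulA : associative umul.
Proof.
elim/clsW=> f; elim/clsW=> g; elim/clsW=> h; rewrite !umulE.
by apply: all_cls => i; rewrite mulrA.
Qed.
Let umulC : commutative umul.
Proof. by elim/clsW=> f; elim/clsW=> g; rewrite !umulE; apply: all_cls => i; rewrite mulrC. Qed.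
Let umul1 : left_id (cls (fun=> 1)) umul.
Proof. by elim/clsW=> f; rewrite umulE; apply: all_cls => i; rewrite mul1r. Qed.
Let umulDl : left_distributive umul +%R.
Proof.
elim/clsW=> f; elim/clsW=> g; elim/clsW=> h; rewrite -![_ + _]/(uadd _ _).
by rewrite !(umulE, uaddE); apply: all_cls => i; rewrite mulrDl.
Qed.
Let u1_neq0 : cls (fun=> 1) != cls (fun=> 0).
Proof.
apply/eqP => /clsP h; have [i /eqP] := filter_ex h.
by rewrite oner_eq0.
Qed.
HB.instance Definition _ := GRing.Zmodule_isComNzRing.Build ultra umulA umulC umul1 umulDl u1_neq0.

Let uVf (x : ultra) : x != 0 -> uinv x * x = 1.
Proof.
elim/clsW: x => f /eqP f0; rewrite -[_ * _]/(umul _ _) uinvE umulE; apply/clsP.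
case: (in_ultra_setVsetC [set i | f i = 0] UF) => [h|h].
  by case: f0; apply/clsP.
by apply: filterS h => i /= /eqP h; rewrite mulVf.
Qed.
Let uinv0 : uinv 0 = 0.
Proof. by rewrite -[0]/(cls _) uinvE; apply: all_cls => i; rewrite invr0. Qed.
HB.instance Definition _ := GRing.ComNzRing_isField.Build ultra uVf uinv0.

Lemma clsD f g : cls (fun i => f i + g i) = cls f + cls g.
Proof. exact: esym (uaddE f g). Qed.
Lemma clsM f g : cls (fun i => f i * g i) = cls f * cls g.
Proof. exact: esym (umulE f g). Qed.
Lemma clsN f : cls (fun i => - f i) = - cls f.
Proof. exact: esym (uoppE f). Qed.
Lemma cls0 : cls (fun=> 0) = 0. Proof. by []. Qed.
Lemma cls1 : cls (fun=> 1) = 1. Proof. by []. Qed.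

Let ule0D (x y : ultra) : ule 0 x -> ule 0 y -> ule 0 (x + y).
Proof.
elim/clsW: x => f; elim/clsW: y => g; rewrite -clsD => /uleP f0 /uleP g0; apply/uleP.
by apply: filterS2 f0 g0 => i /=; exact: addr_ge0.
Qed.
Let ule0M (x y : ultra) : ule 0 x -> ule 0 y -> ule 0 (x * y).
Proof.
elim/clsW: x => f; elim/clsW: y => g; rewrite -clsM => /uleP f0 /uleP g0; apply/uleP.
by apply: filterS2 f0 g0 => i /=; exact: mulr_ge0.
Qed.
Let ule0_anti (x : ultra) : ule 0 x -> ule x 0 -> x = 0.
Proof.
elim/clsW: x => f /uleP f0 /uleP g0; apply/clsP.
by apply: filterS2 f0 g0 => i /= f0 f1; apply: le_anti; rewrite f0 f1.
Qed.
Let usub_ge0 (x y : ultra) : ule 0 (y - x) = ule x y.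
Proof.
elim/clsW: x => f; elim/clsW: y => g; rewrite -clsN -clsD.
by apply/uleP/uleP; apply: filterS => i /=; rewrite subr_ge0.
Qed.
Let ule0_total (x : ultra) : ule 0 x || ule x 0.
Proof.
elim/clsW: x => f; case: (in_ultra_setVsetC [set i | 0 <= f i] UF) => h; apply/orP.
  by left; apply/uleP.
by right; apply/uleP; apply: filterS h => i /= /negP; rewrite -ltNge => /ltW.
Qed.
Let unormN (x : ultra) : unorm (- x) = unorm x.
Proof. by elim/clsW: x => f; rewrite -clsN !unormE; apply: all_cls => i; rewrite normrN. Qed.
Let uge0_norm (x : ultra) : ule 0 x -> unorm x = x.
Proof.
elim/clsW: x => f /uleP f0; rewrite unormE; apply/clsP.
by apply: filterS f0 => i /=; exact: ger0_norm.
Qed.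
Let ult_def (x y : ultra) : (y != x) && ule x y = (y != x) && ule x y.
Proof. by []. Qed.
HB.instance Definition _ := Num.IntegralDomain_isLeReal.Build ultra
  ule0D ule0M ule0_anti usub_ge0 ule0_total unormN uge0_norm ult_def.

Lemma cls_leP f g : reflect (U [set i | f i <= g i]) (cls f <= cls g).
Proof. exact: uleP. Qed.

Lemma cls_sum n (f : 'I_n -> T) : cls (fun i => \sum_j f j i) = \sum_j cls (f j).
Proof.
elim: n f => [|n IH] f.
  by rewrite big_ord0 -cls0; apply: all_cls => i; rewrite big_ord0.
rewrite big_ord_recl -IH -clsD; apply: all_cls => i; exact: big_ord_recl.
Qed.

Lemma clsX f n : cls (fun i => f i ^+ n) = cls f ^+ n.
Proof.
elim: n => [|n IH]; first exact: cls1.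
by rewrite exprS -IH -clsM; apply: all_cls => i; rewrite exprS.
Qed.

Let cls_horner n (p : 'I_n -> T) f :
  (\sum_j (cls (p j))%:P * 'X^j).[cls f] = cls (fun i => (\sum_j (p j i)%:P * 'X^j).[f i]).
Proof.
rewrite horner_sum (eq_bigr (fun j => cls (fun i => p j i * f i ^+ j))); last first.
  by move=> j _; rewrite hornerM hornerC hornerXn clsM clsX.
rewrite -cls_sum; apply: all_cls => i; rewrite horner_sum.
by apply: eq_bigr => j _; rewrite hornerM hornerC hornerXn.
Qed.

(** The polynomial [p] is read fibrewise with the common length [size p], and the intermediate value
    theorem is applied in [U]-almost every fibre. *)
Fact ultra_closed : Num.real_closed_axiom ultra.
Proof.
move=> p a b; pose P i := \sum_(j < size p) (rep p`_j i)%:P * 'X^j.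
have pE f : p.[cls f] = cls (fun i => (P i).[f i]).
  rewrite /P -cls_horner; congr (_.[_]); rewrite -[LHS]coefK poly_def.
  by apply: eq_bigr => j _; rewrite repK mul_polyC.
(* The default value 0 in [r] below can matter only outside a set of [U]. *)
elim/clsW: a => f; elim/clsW: b => g; rewrite !pE => /cls_leP fg /andP[/cls_leP pf /cls_leP pg].
pose r i := xget 0 [set x | f i <= x <= g i /\ root (P i) x].
have rP : U [set i | f i <= r i <= g i /\ root (P i) (r i)].
  apply: filterS3 fg pf pg => i /= fgi pfi pgi.
  have [|x x1 x2] := @poly_ivt (K i) (P i) (f i) (g i) fgi; first by rewrite pfi pgi.
  by apply: (@xgetPex _ 0 [set x | f i <= x <= g i /\ root (P i) x]); exists x.
exists (cls r); first by apply/andP; split; apply/cls_leP; apply: filterS rP => i /= -[/andP[]].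
by apply/eqP; rewrite pE -cls0; apply/clsP; apply: filterS rP => i /= -[_ /eqP].
Qed.
HB.instance Definition _ := Num.RealField_isClosed.Build ultra ultra_closed.

Definition mcls p q (X : forall i, 'M[K i]_(p, q)) : 'M[ultra]_(p, q) :=
  \matrix_(a, b) cls (fun i => X i a b).

Lemma mclsP p q (X Y : forall i, 'M[K i]_(p, q)) :
  U [set i | X i = Y i] -> mcls X = mcls Y.
Proof.
by move=> XY; apply/matrixP => a b; rewrite !mxE; apply/clsP; apply: filterS XY => i /= ->.
Qed.

Lemma all_mcls p q (X Y : forall i, 'M[K i]_(p, q)) : (forall i, X i = Y i) -> mcls X = mcls Y.
Proof. by move=> XY; apply: mclsP; apply: filterS (filterT : U _) => i _ /=. Qed.

Lemma mclsD p q (X Y : forall i, 'M[K i]_(p, q)) :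
  mcls (fun i => X i + Y i) = mcls X + mcls Y.
Proof. by apply/matrixP => a b; rewrite !mxE -clsD; apply: all_cls => i; rewrite mxE. Qed.

Lemma mclsN p q (X : forall i, 'M[K i]_(p, q)) : mcls (fun i => - X i) = - mcls X.
Proof. by apply/matrixP => a b; rewrite !mxE -clsN; apply: all_cls => i; rewrite mxE. Qed.

Lemma mclsZ p q f (X : forall i, 'M[K i]_(p, q)) :
  mcls (fun i => f i *: X i) = cls f *: mcls X.
Proof. by apply/matrixP => a b; rewrite !mxE -clsM; apply: all_cls => i; rewrite mxE. Qed.

Lemma mclsM p q r (X : forall i, 'M[K i]_(p, q)) (Y : forall i, 'M[K i]_(q, r)) :
  mcls (fun i => X i *m Y i) = mcls X *m mcls Y.
Proof.
apply/matrixP => a b; rewrite !mxE (eq_bigr (fun j => cls (fun i => X i a j * Y i j b))).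
  by rewrite -cls_sum; apply: all_cls => i; rewrite mxE.
by move=> j _; rewrite !mxE clsM.
Qed.

Lemma mclsT p q (X : forall i, 'M[K i]_(p, q)) : mcls (fun i => (X i)^T) = (mcls X)^T.
Proof. by apply/matrixP => a b; rewrite !mxE; apply: all_cls => i; rewrite mxE. Qed.

Lemma mcls1 n : mcls (fun i => 1%:M : 'M_n) = 1%:M.
Proof.
apply/matrixP => a b; rewrite !mxE; case: (eqVneq a b) => [->|ab] /=.
  by rewrite -cls1; apply: all_cls => i; rewrite mxE eqxx.
rewrite mulr0n -cls0; apply: all_cls => i.
by rewrite mxE (negPf ab).
Qed.

Lemma mcls_sum p q n (X : 'I_n -> forall i, 'M[K i]_(p, q)) :
  mcls (fun i => \sum_j X j i) = \sum_j mcls (X j).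
Proof.
apply/matrixP => a b; rewrite !mxE summxE (eq_bigr (fun j => cls (fun i => X j i a b))).
  by rewrite -cls_sum; apply: all_cls => i; rewrite summxE.
by move=> j _; rewrite mxE.
Qed.

End Ultraproduct.

Section UltraproductRep.
Variables (E : fieldType) (A : falgType E) (s : 'End(A)) (m : nat).
Variables (I : Type) (U : set_system I) (UF : UltraFilter U) (K : I -> rcfType).
Variables (iota : forall i, {rmorphism E -> K i}) (rho : forall i, A -> 'M[K i]_m).
Variables (G : forall i, 'M[K i]_m).
Hypothesis pt : forall i, hermrep s (iota i) (@rho i) (G i).
Local Notation be i := ((vbasis {:A})`_i).

Definition ultra_in (c : E) : ultra UF K := cls UF (fun i => iota i c).

Fact ultra_in_additive : zmod_morphism ultra_in.
Proof.
by move=> a b; rewrite /ultra_in -clsN -clsD; apply: all_cls => i; rewrite rmorphB.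
Qed.
Fact ultra_in_multiplicative : monoid_morphism ultra_in.
Proof.
split=> [|a b]; first by rewrite /ultra_in -cls1; apply: all_cls => i; rewrite rmorph1.
by rewrite /ultra_in -clsM; apply: all_cls => i; rewrite rmorphM.
Qed.
HB.instance Definition _ := GRing.isZmodMorphism.Build E (ultra UF K) ultra_in ultra_in_additive.
HB.instance Definition _ := GRing.isMonoidMorphism.Build E (ultra UF K) ultra_in ultra_in_multiplicative.

Definition ultra_rho (a : A) : 'M[ultra UF K]_m := mcls UF (fun i => @rho i a).

Lemma ultra_hermrep : hermrep s ultra_in ultra_rho (mcls UF G).
Proof.
split.
- by move=> a b; rewrite /ultra_rho -mclsD; apply: all_mcls => i; rewrite (ptD (pt i)).
- by move=> a b; rewrite /ultra_rho -mclsM; apply: all_mcls => i; rewrite (ptM (pt i)).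
- by rewrite /ultra_rho -mcls1; apply: all_mcls => i; rewrite (pt1 (pt i)).
- by move=> c a; rewrite /ultra_rho -mclsZ; apply: all_mcls => i; rewrite (ptZ (pt i)).
- by move=> a; rewrite /ultra_rho -mclsT -!mclsM; apply: all_mcls => i; rewrite (ptS (pt i)).
- by rewrite -mclsT; apply: all_mcls => i; rewrite (ptG (pt i)).
- have GV : mcls UF G *m mcls UF (fun i => invmx (G i)) = 1%:M; last first.
    exact: (mulmx1_unit GV).1.
  by rewrite -mclsM -mcls1; apply: all_mcls => i; rewrite mulmxV ?(ptU (pt i)).
pose R i : 'M[K i]_(\dim {:A}, m * m) := \matrix_j mxvec (@rho i (be j)).
have fR i : row_free (R i).
  rewrite -kermx_eq0; apply/negPn/negP => /rowV0Pn[y /sub_kermxP yR /eqP]; apply.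
  apply/rowP => j; rewrite [RHS]mxE; move: j; apply: (ptI (pt i)).
  apply: (can_inj mxvecK); rewrite linear0 -[RHS]yR linear_sum mulmx_sum_row.
  by apply: eq_bigr => j _; rewrite rowK linearZ.
(* The right inverses express independence by equations. *)
have RV : mcls UF R *m mcls UF (fun i => pinvmx (R i)) = 1%:M.
  by rewrite -mclsM -mcls1; apply: all_mcls => i; rewrite mulmxVp.
move=> k k0; suff : \row_j k j = 0 by move=> /rowP k0' j; have := k0' j; rewrite !mxE.
suff : (\row_j k j) *m mcls UF R = 0.
  by move/(congr1 (mulmx^~ (mcls UF (fun i => pinvmx (R i))))); rewrite -mulmxA RV mulmx1 mul0mx.
rewrite -[RHS](linear0 mxvec) -k0 linear_sum mulmx_sum_row.
apply: eq_bigr => j _; rewrite linearZ mxE; congr (_ *: _).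
apply/rowP => l; rewrite !mxE; case/mxvec_indexP: l => a b.
rewrite [RHS]mxvecE mxE; apply: all_cls => i.
by rewrite mxE mxvecE.
Qed.

End UltraproductRep.

(** * Finite lists of test units *)

Section FiniteTest.
Variables (E : fieldType) (A : falgType E) (s : 'End(A)) (m : nat).
Hypothesis sM : forall a b, s (a * b) = s b * s a.
Hypothesis sK : forall a, s (s a) = a.
Local Notation be i := ((vbasis {:A})`_i).

(** A counterexample to the list [l], bundled with its field so that a family indexed by all lists
    can be formed. *)
Record definite_rep (l : seq A) := DefiniteRep {
  drK : rcfType;
  driota : {rmorphism E -> drK};
  drrho : A -> 'M[drK]_m;
  drG : 'M[drK]_m;
  drk : 'I_(\dim {:A}) -> drK;
  drC : 'M[drK]_m;
  drP : hermrep s driota drrho drG;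
  drU : drC \in unitmx;
  drE : drG *m (\sum_i drk i *: drrho (be i)) = drC *m drC^T;
  drZ : forall a, a \in l -> s a = a -> a \is a GRing.unit -> sig (drG *m drrho a) = 0 }.

Lemma rho_unit (K : rcfType) (iota : {rmorphism E -> K}) rho (G : 'M_m) a :
  hermrep s iota rho G -> s a = a -> rho a \in unitmx -> a \is a GRing.unit.
Proof.
move=> pt sa ua; have := @herm_shift_inverse _ A s K iota m rho G pt sM sK a 0.
rewrite addr0 => /(_ sa ua)[e _ [ae ea]].
by apply/unitrP; exists e.
Qed.

Lemma unit_rho (K : rcfType) (iota : {rmorphism E -> K}) rho (G : 'M_m) a :
  hermrep s iota rho G -> a \is a GRing.unit -> rho a \in unitmx.
Proof.
move=> pt ua; have aV : rho a *m rho a^-1 = 1%:M by rewrite -(ptM pt) divrr // (pt1 pt).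
exact: (mulmx1_unit aV).1.
Qed.

(* An ultraproduct along the finite lists of A would be neutral and represent a definite form. *)
Lemma no_definite_family : (0 < m)%N -> (forall l : seq A, definite_rep l) -> False.
Proof.
move=> m0 B.
(* For an ultrafilter above [F], every element [a] belongs to almost all lists. *)
pose F : set_system (seq A) :=
  filter_from setT (fun l : seq A => [set H : seq A | {subset l <= H}]%classic).
have FF : ProperFilter F.
  apply: filter_from_proper; last by move=> l _; exists l => /=.
  apply: filter_from_filter; first by exists [::].
  move=> l l' _ _; exists (l ++ l') => // H /= sub.
  by split=> /= x xl; apply: sub; rewrite mem_cat xl ?orbT.
have [U [UF FU]] := ultraFilterLemma FF.
pose K l := drK (B l).
pose rho l := @drrho l (B l); pose G l := drG (B l).
have pt := @ultra_hermrep E A s m _ U UF K (fun l => driota (B l)) rho G (fun l => drP (B l)).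
set urho := ultra_rho _ _ in pt; set uG := mcls _ _ in pt.
have Z : neutral s urho uG.
  move=> a sa ua; have a1 := rho_unit pt sa ua.
  have Ua : U [set l : seq A | a \in l]%classic.
    by apply: FU; exists [:: a] => // l /= sub; apply: sub; rewrite mem_head.
  have sym (l : seq A) : (G l *m rho l a)^T = G l *m rho l a.
    by rewrite trmx_mul (ptG (drP (B l))) (ptS (drP (B l))) sa.
  have uni (l : seq A) : G l *m rho l a \in unitmx.
    by rewrite unitmx_mul (ptU (drP (B l))) (unit_rho (drP (B l)) a1).
  (* The witnesses must have the same size in all fibres; it is determined by [h + h = m]. *)
  pose h := m./2.
  have H l : exists VV : 'M[K l]_(h, m) * 'M[K l]_(h, m), a \in l ->
      [/\ (h + h)%N = m, VV.1 *m (G l *m rho l a) *m VV.1^T = 1%:M &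
          VV.2 *m (G l *m rho l a) *m VV.2^T = - 1%:M].
    case: (boolP (a \in l)) => [al|_]; last by exists (0, 0).
    have [h' [hh [V [V' [V1 V2]]]]] := sig0_split (sym l) (uni l) (@drZ l (B l) a al sa a1).
    have hE : h' = h by rewrite /h -hh addnn doubleK.
    by subst h'; exists (V, V').
  pose VV l := projT1 (cid (H l)); have VVP l := projT2 (cid (H l)).
  have [l0 al0] := filter_ex Ua; have [hh _ _] := VVP l0 al0.
  apply: (@split_sig0 _ _ h _ (mcls UF (fun l => (VV l).1)) (mcls UF (fun l => (VV l).2))) => //.
    rewrite -mclsT -!mclsM -mcls1; apply: mclsP; apply: filterS Ua => l /= al.
    by have [_ -> _] := VVP l al.
  rewrite -mclsT -!mclsM -mcls1 -mclsN; apply: mclsP; apply: filterS Ua => l /= al.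
  by have [_ _ ->] := VVP l al.
pose C := mcls UF (fun l => drC (B l)); pose k i := cls UF (fun l => drk (B l) i).
have uC : C \in unitmx.
  have CV : C *m mcls UF (fun l => invmx (drC (B l))) = 1%:M; last first.
    exact: (mulmx1_unit CV).1.
  by rewrite -mclsM -mcls1; apply: all_mcls => l; rewrite mulmxV ?drU.
pose T := urho 0 + \sum_i k i *: urho (be i).
have TE : uG *m T = C *m C^T.
  rewrite /T (rho0 pt) add0r -mclsT -mclsM.
  have -> : \sum_i k i *: urho (be i) = mcls UF (fun l => \sum_i drk (B l) i *: rho l (be i)).
    by rewrite mcls_sum; apply: eq_bigr => i _; rewrite mclsZ.
  by rewrite -mclsM; apply: all_mcls => l; rewrite drE.
have sT : (uG *m T)^T = uG *m T by rewrite TE trmx_mul trmxK.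
have uGT : uG *m T \in unitmx by rewrite TE unitmx_mul unitmx_tr uC.
have uT : T \in unitmx by move: uGT; rewrite (unitmx_mul uG T) => /andP[].
have : sig (uG *m T) = 0 := neutral_combination pt sM sK Z sT uT.
rewrite (congr1 (@sig _ m) TE) (sig_unit_posdef uC) => /eqP.
by rewrite -[_ == _]/(m == 0%N) -leqn0 leqNgt m0.
Qed.

(** The size [m] is fixed because matrices in an ultraproduct need a common size; the list is
    uniform in [K] and [iota]. *)
Theorem finite_test : (0 < m)%N -> exists l : seq A,
  (forall a, a \in l -> s a = a /\ a \is a GRing.unit) /\
  forall (K : rcfType) (iota : {rmorphism E -> K}) (rho : A -> 'M[K]_m) (G : 'M[K]_m)
    (k : 'I_(\dim {:A}) -> K) (C : 'M[K]_m),
  hermrep s iota rho G -> C \in unitmx -> G *m (\sum_i k i *: rho (be i)) = C *m C^T ->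
  exists2 a, a \in l & sig (G *m rho a) <> 0.
Proof.
move=> m0; apply: contrapT => H; apply: (no_definite_family m0) => l.
pose l' := [seq a <- l | (s a == a) && (a \is a GRing.unit)].
suff : exists B : definite_rep l, True by move=> /cid[].
apply: contrapT => nB; apply: H; exists l'; split.
  by move=> a; rewrite mem_filter => /andP[/andP[/eqP]].
move=> K iota rho G k C pt uC GE; apply: contrapT => nZ; apply: nB.
suff B : definite_rep l by exists B.
apply: (DefiniteRep pt uC GE) => a al sa ua; apply: contrapT => Za.
by apply: nZ; exists a; rewrite // mem_filter sa eqxx ua.
Qed.

End FiniteTest.

(** * Hermitian forms over the local division rings *)

(* A division ring of dimension d over its real closed subfield of symmetric elements:
   the Euclidean coordinates co carry the trace form of th x * y to the dot product. *)
Record real_division (K : rcfType) (D : nzRingType) (th : D -> D) (d : nat)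
    (inc : K -> D) (co : D -> 'rV[K]_d) : Prop := RealDivision {
  incD : {morph inc : x y / x + y};
  incM : {morph inc : x y / x * y};
  inc1 : inc 1 = 1;
  incC : forall x u, inc x * u = u * inc x;
  rdI : involution th;
  th_inc : forall x, th (inc x) = inc x;
  th_fix : forall u, th u = u -> exists x, u = inc x;
  norm_pos : forall u, u != 0 -> exists2 x, 0 < x & th u * u = inc x;
  coD : {morph co : u v / u + v};
  coZ : forall u x, co (u * inc x) = x *: co u;
  co_bij : bijective co;
  co_th : forall u v, co u *m (co v)^T = co 1 *m (co (th u * v))^T }.

Section Diagonalize.
Variables (K : rcfType) (D : nzRingType) (th : D -> D) (d : nat).
Variables (inc : K -> D) (co : D -> 'rV[K]_d).
Hypothesis RD : real_division th inc co.
Variable h : hermform th false.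

Lemma th0 : th 0 = 0.
Proof. by apply: (addrI (th 0)); rewrite -(involD (rdI RD)) !addr0. Qed.

Lemma inc0 : inc 0 = 0.
Proof. by apply: (addrI (inc 0)); rewrite -(incD RD) !addr0. Qed.

Lemma incN x : inc (- x) = - inc x.
Proof. by apply: (addrI (inc x)); rewrite -(incD RD) !subrr inc0. Qed.

Lemma inc_injective : injective inc.
Proof.
move=> x y xy; apply/eqP; rewrite -subr_eq0; apply/eqP; apply/eqP; apply: contraT => n0.
have := oner_neq0 D; rewrite -(inc1 RD) -(mulVf n0) (incM RD) (incD RD) incN xy subrr.
by rewrite mulr0 eqxx.
Qed.

Lemma th1 : th 1 = 1.
Proof. by rewrite -(inc1 RD) (th_inc RD). Qed.

Lemma sign_comm (b : bool) (u : D) : (-1) ^+ b * u = u * (-1) ^+ b.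
Proof. by case: b => /=; rewrite ?expr1 ?expr0 ?mulN1r ?mulrN1 ?mul1r ?mulr1. Qed.

Local Notation phi := (@hfun _ _ _ h).

Lemma phiC x y : phi y x = th (phi x y).
Proof. by rewrite hfunC expr0 mul1r. Qed.

Lemma phi0r x : phi x 0 = 0.
Proof. by apply: (addrI (phi x 0)); rewrite -hfunDr !addr0. Qed.

Lemma phi0l x : phi 0 x = 0.
Proof. by rewrite phiC phi0r th0. Qed.

Lemma phi_sumr (I : finType) x (F : I -> h) : phi x (\sum_i F i) = \sum_i phi x (F i).
Proof. by apply: (big_morph (phi x)) => [y z|]; [rewrite hfunDr | rewrite phi0r]. Qed.

Lemma phi_suml (I : finType) x (F : I -> h) : phi (\sum_i F i) x = \sum_i phi (F i) x.
Proof. by apply: (big_morph (phi^~ x)) => [y z|]; [rewrite hfunDl | rewrite phi0l]. Qed.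

Lemma phiNr x y : phi x (- y) = - phi x y.
Proof. by apply: (addrI (phi x y)); rewrite -hfunDr !subrr phi0r. Qed.

Lemma phiZr x y u : phi x (y *>: u) = phi x y * u.
Proof. by rewrite -[x in LHS]ract1 hfunZ th1 mul1r. Qed.

Lemma phiZl x y u : phi (x *>: u) y = th u * phi x y.
Proof. by rewrite -[y in LHS]ract1 hfunZ mulr1. Qed.

Definition orthonormal_family n (e : 'I_n -> h) (s : 'I_n -> bool) :=
  forall i j, phi (e i) (e j) = if i == j then (-1) ^+ s i else 0.

(** An orthonormal family is independent over [K], and [h] embeds as a summand of a free module,
    which has finite dimension over [K]; no dimension theory over [D] enters. *)
Lemma orthonormal_bound : exists B : nat, forall n (e : 'I_n -> h) s,
  orthonormal_family e s -> (n <= B)%N.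
Proof.
have [n0 [p [q qp]]] := hmod_proj h; exists (n0 * d)%N => n e s oe.
pose W : 'M[K]_(n, n0 * d) := \matrix_i mxvec (\matrix_(j < n0) co (q (e i) 0 j)).
suff : row_free W by rewrite /row_free => /eqP <-; exact: rank_leq_col.
rewrite -kermx_eq0; apply/negPn/negP => /rowV0Pn[y /sub_kermxP yW /eqP]; apply.
have co_sum (I : finType) (F : I -> D) : co (\sum_i F i) = \sum_i co (F i).
  apply: (big_morph co) => [u v|]; first exact: (coD RD).
  by apply: (addrI (co 0)); rewrite -(coD RD) !addr0.
have : \sum_i e i *>: inc (y 0 i) = 0.
  apply: (can_inj qp); rewrite linear0 linear_sum; apply/rowP => j; rewrite summxE mxE.
  apply: (bij_inj (co_bij RD)); rewrite co_sum; apply/rowP => l.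
  have -> : co 0 = 0 by apply: (addrI (co 0)); rewrite -(coD RD) !addr0.
  move/rowP/(_ (mxvec_index j l)): yW; rewrite !mxE summxE => y0; rewrite -[RHS]y0.
  apply: eq_bigr => i _; rewrite linearZ mxE [W _ _]mxE mxvecE.
  transitivity (co ((q (e i) 0 j : D) * inc (y 0 i)) 0 l); first by [].
  by rewrite (coZ RD) !mxE.
move=> H; apply/rowP => j; rewrite mxE; apply: inc_injective; rewrite inc0.
move/(congr1 (phi (e j))): H; rewrite phi_sumr phi0r (bigD1 j) //= big1 => [|i ij].
  rewrite addr0 phiZr oe eqxx => /(congr1 ( *%R ((-1) ^+ s j))).
  by rewrite mulrA -expr2 sqrr_sign mul1r mulr0.
by rewrite phiZr oe eq_sym (negPf ij) mul0r.
Qed.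

Lemma orthonormal_extend n (e : 'I_n -> h) s x : orthonormal_family e s ->
  (forall i, phi (e i) x = 0) -> phi x x != 0 ->
  exists (e' : 'I_n.+1 -> h) s', orthonormal_family e' s'.
Proof.
move=> oe xe xx; have [y yE] : exists y, phi x x = inc y by apply: (th_fix RD); rewrite -phiC.
have y0 : y != 0 by apply: contraNneq xx => y0; rewrite yE y0 inc0.
pose z := x *>: inc (Num.sqrt `|y|)^-1.
have zz : phi z z = (-1) ^+ (y < 0)%R.
  rewrite /z phiZl phiZr yE (th_inc RD) -!(incM RD).
  have -> : (Num.sqrt `|y|)^-1 * (y * (Num.sqrt `|y|)^-1) = (-1) ^+ (y < 0)%R.
    rewrite mulrCA -invfM -expr2 sqr_sqrtr // {1}[y]numEsign.
    by rewrite -mulrA mulfV ?mulr1 ?normr_eq0.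
  by case: (y < 0)%R => /=; rewrite ?expr1 ?expr0 ?incN (inc1 RD).
have ze i : phi (e i) z = 0 by rewrite /z phiZr xe mul0r.
exists (fun i => if unlift ord0 i is Some j then e j else z).
exists (fun i => if unlift ord0 i is Some j then s j else (y < 0)%R).
move=> i j; case: (unliftP ord0 i) => [i' ->|->]; case: (unliftP ord0 j) => [j' ->|->].
- by rewrite oe (inj_eq lift_inj).
- by rewrite ze eq_sym (negPf (neq_lift _ _)).
- by rewrite phiC ze th0 (negPf (neq_lift _ _)).
by rewrite zz eqxx.
Qed.

(* The orthogonal complement of a maximal orthonormal family is totally isotropic, hence 0. *)
Lemma herm_diagonal : exists (n : nat) (s : 'I_n -> bool) (f : {linear h -> 'rV[D^c]_n}),
  bijective f /\ forall x y, phi x y = \sum_i th (f x 0 i : D) * (-1) ^+ s i * (f y 0 i : D).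
Proof.
have [B Bb] := orthonormal_bound.
pose P n := `[< exists (e : 'I_n -> h) s, orthonormal_family e s >].
have P0 : exists n, P n.
  by exists 0; apply/asboolP; exists (fun=> 0), (fun=> false); case.
have Pb n : P n -> (n <= B)%N by move/asboolP => [e [s]]; exact: Bb.
case: (ex_maxnP P0 Pb) => n /asboolP[e [s oe]] nmax.
have ext0 x : (forall i, phi (e i) x = 0) -> phi x x = 0.
  move=> xe; apply/eqP; apply: contraT => xx.
  have /asboolP/nmax := orthonormal_extend oe xe xx.
  by rewrite ltnn.
have perp x y : (forall i, phi (e i) x = 0) -> (forall i, phi (e i) y = 0) -> phi x y = 0.
  move=> xe ye; apply/eqP; apply: contraT => xy.
  have alt u : phi x y * u + th (phi x y * u) = 0.
    have : phi (x + y *>: u) (x + y *>: u) = 0.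
      by apply: ext0 => i; rewrite hfunDr phiZr xe ye mul0r addr0.
    rewrite hfunDl !hfunDr ext0 // add0r [phi (y *>: u) (y *>: u)]ext0 ?addr0; last first.
      by move=> i; rewrite phiZr ye mul0r.
    by rewrite [phi (y *>: u) x]phiC phiZr.
  (* In [alt], the choice [u = th (phi x y)] makes [phi x y * u] a positive element of [K], so it
     cannot be opposite to its conjugate. *)
  have txy : th (phi x y) != 0 by apply: contraNneq xy => E0; rewrite -[phi x y](involK (rdI RD)) E0 th0.
  have [z z0 zE] := norm_pos RD txy.
  have := alt (th (phi x y)); rewrite (involK (rdI RD)) in zE; rewrite zE (th_inc RD) -(incD RD).
  rewrite -inc0 => /inc_injective /eqP; rewrite paddr_eq0 ?ltW // => /andP[/eqP z00 _].
  by rewrite z00 ltxx in z0.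
pose c x i := (-1) ^+ s i * phi (e i) x.
have expand x : x = \sum_i e i *>: c x i.
  pose z := x - \sum_i e i *>: c x i.
  have ez i : phi (e i) z = 0.
    rewrite /z hfunDr phiNr phi_sumr (bigD1 i) //= big1 => [|j ji].
      by rewrite phiZr oe eqxx addr0 /c mulrA -expr2 sqrr_sign mul1r subrr.
    by rewrite phiZr oe eq_sym (negPf ji) mul0r.
  suff : z = 0 by move/eqP; rewrite subr_eq0 => /eqP.
  apply: (hfun_nonsing h).1 => w.
  pose z' := w - \sum_i e i *>: c w i.
  have ez' i : phi (e i) z' = 0.
    rewrite /z' hfunDr phiNr phi_sumr (bigD1 i) //= big1 => [|j ji].
      by rewrite phiZr oe eqxx addr0 /c mulrA -expr2 sqrr_sign mul1r subrr.
    by rewrite phiZr oe eq_sym (negPf ji) mul0r.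
  have -> : w = z' + \sum_i e i *>: c w i by rewrite subrK.
  rewrite hfunDr perp // add0r phi_sumr big1 // => i _.
  by rewrite phiZr phiC ez th0 mul0r.
pose f x : 'rV[D^c]_n := \row_i c x i.
have fl : linear f.
  move=> a x y; apply/rowP => i; rewrite !mxE /c hfunDr mulrDr; congr (_ + _).
  by rewrite -[a *: x]/(x *>: a) phiZr mulrA.
pose fa := GRing.isLinear.Build _ _ _ _ f fl.
pose fL : {linear h -> 'rV[D^c]_n} := HB.pack f fa.
exists n, s, fL; split.
  exists (fun y : 'rV[D^c]_n => \sum_i e i *>: (y 0 i : D)) => [x|y] /=.
    by rewrite [RHS]expand; apply: eq_bigr => i _; rewrite mxE.
  apply/rowP => i; rewrite mxE /c phi_sumr (bigD1 i) //= big1 => [|j ji].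
    by rewrite phiZr oe eqxx addr0 mulrA -expr2 sqrr_sign mul1r.
  by rewrite phiZr oe eq_sym (negPf ji) mul0r.
move=> x y /=; rewrite [in LHS](expand x) phi_suml; apply: eq_bigr => i _.
rewrite phiZl !mxE -mulrA; congr (_ * _).
by rewrite /c mulrA -expr2 sqrr_sign mul1r.
Qed.

End Diagonalize.

Section DivisionRings.
Variable K : rcfType.

Fact conj_involution : involution (conjc : K[i]%C -> K[i]%C).
Proof.
split=> [x y|x y|x]; last exact: conjcK.
  exact: rmorphD.
by rewrite rmorphM mulrC.
Qed.

Fact qconj_involution : involution (@qconj K).
Proof.
split=> [[a b c e] [a' b' c' e']|[a b c e] [a' b' c' e']|[a b c e]].
- by rewrite /= -[Quat _ _ _ _ + _]/(qadd _ _) -[qconj _ + _]/(qadd _ _) /qconj /qadd /= !opprD.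
- rewrite -[Quat _ _ _ _ * _]/(qmul _ _) -[qconj _ * _]/(qmul _ _) /qconj /qmul /=.
  by congr Quat; ring.
by rewrite /qconj /= !opprK.
Qed.

Lemma real_division_real :
  real_division (@Dinv K DReal) (fun x : K => x : Drg K DReal) (fun x => const_mx x : 'rV_1).
Proof.
split=> //=.
- by move=> x u; rewrite -[LHS]/((x : K) * (u : K)) mulrC.
- by split=> // a b; rewrite -[LHS]/((a : K) * (b : K)) mulrC.
- by move=> u _; exists u.
- by move=> u u0; exists (u * u) => //; rewrite -expr2 exprn_even_gt0.
- by move=> u v; apply/rowP => i; rewrite !mxE.
- by move=> u x; apply/rowP => i; rewrite !mxE -[LHS]/((u : K) * x) mulrC.
- exists (fun r : 'rV[K]_1 => r 0 0) => [x|r]; first by rewrite mxE.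
  by apply/rowP => i; rewrite mxE !ord1.
by move=> u v; apply/matrixP => i j; rewrite !mxE !big_ord1 !mxE mul1r.
Qed.

Lemma real_division_cplx :
  real_division (@Dinv K DCplx) (fun x : K => x%:C%C : Drg K DCplx)
    (fun z => \row_(i < 2) [:: complex.Re (z : K[i]%C); complex.Im (z : K[i]%C)]`_i).
Proof.
split=> //=.
- by move=> x y; rewrite rmorphD.
- by move=> x y; rewrite rmorphM.
- by move=> x u; rewrite -[LHS]/((x%:C)%C * (u : K[i]%C)) mulrC.
- exact: conj_involution.
- by move=> x; rewrite /conjc /= oppr0.
- move=> [a b] [/eqP]; rewrite eq_sym -addr_eq0 -mulr2n mulrn_eq0 /= => /eqP ->.
  by exists a.
- move=> [a b] ab; exists (a ^+ 2 + b ^+ 2).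
    rewrite lt_neqAle addr_ge0 ?sqr_ge0 // andbT eq_sym paddr_eq0 ?sqr_ge0 // !sqrf_eq0.
    by apply: contra ab => /andP[/eqP -> /eqP ->].
  apply/eqP; rewrite eq_complex /=; apply/andP; split; apply/eqP; ring.
- move=> [a b] [a' b']; apply/rowP => -[[|[|//]] i] /=; by rewrite !mxE.
- by move=> [a b] x; apply/rowP => -[[|[|//]] i]; rewrite !mxE /=; ring.
- exists (fun r : 'rV[K]_2 => (r 0 0 +i* r 0 1)%C) => [[a b]|r].
    by rewrite !mxE.
  apply/rowP => -[[|[|//]] i]; rewrite !mxE /=; congr (r _ _); exact: val_inj.
move=> [a b] [a' b']; apply/matrixP => i j; rewrite !mxE !big_ord_recl !big_ord0 !mxE /=.
ring.
Qed.

Lemma real_division_quat :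
  real_division (@Dinv K DQuat) (fun x : K => qscal x : Drg K DQuat)
    (fun z => \row_(i < 4) [:: qre (z : quat K); qi (z : quat K); qj (z : quat K); qk (z : quat K)]`_i).
Proof.
split=> //=.
- by move=> x y; rewrite -[RHS]/(qadd _ _) /qadd /qscal /= !addr0.
- by move=> x y; rewrite -[RHS]/(qmul _ _) /qmul /qscal /=; congr Quat; ring.
- by move=> x [a b c e]; rewrite -[LHS]/(qmul _ _) -[RHS]/(qmul _ _) /qmul /qscal /=; congr Quat; ring.
- exact: qconj_involution.
- by move=> x; rewrite /qconj /= !oppr0.
- move=> [a b c e] [/eqP + /eqP + /eqP +].
  rewrite eq_sym -addr_eq0 -mulr2n mulrn_eq0 /= => /eqP ->.
  rewrite eq_sym -addr_eq0 -mulr2n mulrn_eq0 /= => /eqP ->.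
  rewrite eq_sym -addr_eq0 -mulr2n mulrn_eq0 /= => /eqP ->.
  by exists a.
- move=> [a b c e] abce; exists (a ^+ 2 + b ^+ 2 + (c ^+ 2 + e ^+ 2)).
    rewrite lt_neqAle !addr_ge0 ?sqr_ge0 // andbT eq_sym paddr_eq0 ?addr_ge0 ?sqr_ge0 //.
    rewrite !paddr_eq0 ?sqr_ge0 // !sqrf_eq0.
    by apply: contra abce => /andP[/andP[/eqP -> /eqP ->] /andP[/eqP -> /eqP ->]].
  by rewrite -[LHS]/(qmul _ _) /qmul /qscal /=; congr Quat; ring.
- move=> [a b c e] [a' b' c' e']; apply/rowP => -[[|[|[|[|//]]]] i] /=; by rewrite !mxE.
- move=> [a b c e] x; apply/rowP => -[[|[|[|[|//]]]] i]; rewrite !mxE /=; ring.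
- exists (fun r : 'rV[K]_4 => Quat (r 0 0) (r 0 (inord 1)) (r 0 (inord 2)) (r 0 (inord 3))) =>
    [[a b c e]|r].
    by rewrite !mxE !inordK.
  apply/rowP => -[[|[|[|[|//]]]] i]; rewrite !mxE /=; congr (r _ _);
    apply: val_inj => //=; by rewrite inordK.
move=> [a b c e] [a' b' c' e']; apply/matrixP => i j; rewrite !mxE !big_ord_recl !big_ord0 !mxE /=.
ring.
Qed.

End DivisionRings.

Section RealCoordinates.
Variables (K : rcfType) (D : nzRingType) (th : D -> D) (d : nat).
Variables (inc : K -> D) (co : D -> 'rV[K]_d).
Hypothesis RD : real_division th inc co.
Variables (h : hermform th false) (n : nat) (s : 'I_n -> bool) (f : {linear h -> 'rV[D^c]_n}).
Hypothesis f_bij : bijective f.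
Hypothesis fE : forall x y, hfun x y = \sum_i th (f x 0 i : D) * (-1) ^+ s i * (f y 0 i : D).

Definition real_coord (x : h) : 'rV[K]_(n * d) :=
  mxvec (\matrix_(i < n, j < d) co (f x 0 i : D) 0 j).

Definition sign_diag : 'M[K]_(n * d) :=
  diag_mx (mxvec (\matrix_(i < n, j < d) (-1) ^+ s i)).

Lemma real_coordE x i j : real_coord x 0 (mxvec_index i j) = co (f x 0 i : D) 0 j.
Proof. by rewrite mxvecE mxE. Qed.

Lemma co0 : co 0 = 0.
Proof. by apply: (addrI (co 0)); rewrite -(coD RD) !addr0. Qed.

Lemma co_sum (I : finType) (F : I -> D) : co (\sum_i F i) = \sum_i co (F i).
Proof. by apply: (big_morph co) => [u v|]; [exact: (coD RD) | exact: co0]. Qed.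

Lemma co_sign (b : bool) u : co ((-1) ^+ b * u) = (-1) ^+ b *: co u.
Proof.
rewrite sign_comm -(coZ RD); congr (co (_ * _)).
by case: b => /=; rewrite ?expr1 ?expr0 ?(incN RD) (inc1 RD).
Qed.

Lemma real_coordD x y : real_coord (x + y) = real_coord x + real_coord y.
Proof.
rewrite /real_coord -linearD; congr mxvec; apply/matrixP => i j.
by rewrite !mxE linearD mxE (coD RD) mxE.
Qed.

Lemma real_coordZ c x : real_coord (x *>: inc c) = c *: real_coord x.
Proof.
rewrite /real_coord -linearZ; congr mxvec; apply/matrixP => i j.
by rewrite !mxE /ract linearZ mxE -[_ * _ in LHS]/((f x 0 i : D) * inc c) (coZ RD) mxE.
Qed.

Lemma real_coord_bij : bijective real_coord.
Proof.
have [g fK gK] := f_bij; have [coi coK coiK] := co_bij RD.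
exists (fun r => g (\row_i coi (row i (vec_mx r)))) => [x|r].
  rewrite /real_coord mxvecK -[RHS]fK; congr g; apply/rowP => i; rewrite mxE.
  by rewrite -[RHS]coK; congr coi; apply/rowP => j; rewrite !mxE.
rewrite /real_coord gK -[RHS]vec_mxK; congr mxvec; apply/matrixP => i j.
by rewrite !mxE coiK !mxE.
Qed.

Lemma sum_mxvec (V : nmodType) (w : 'I_(n * d) -> V) :
  \sum_l w l = \sum_(i < n) \sum_(j < d) w (mxvec_index i j).
Proof.
rewrite pair_bigA /= (reindex _ (curry_mxvec_bij n d)) /=.
by apply: eq_bigr => -[i j].
Qed.

(** The functional [w |-> co 1 *m (co w)^T] is the real part in all three cases; composed with the
    hermitian form, it gives a symmetric form over [K] in which every diagonal sign is repeated [d]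
    times. *)
Lemma real_coord_form x y :
  (co 1 *m (co (hfun x y))^T) 0 0 = (real_coord x *m sign_diag *m (real_coord y)^T) 0 0.
Proof.
rewrite fE co_sum linear_sum mulmx_sumr summxE /sign_diag mul_mx_diag mxE sum_mxvec.
apply: eq_bigr => i _.
rewrite -(sign_comm (s i)) -mulrA co_sign linearZ -scalemxAr mxE -(co_th RD) mxE mulr_sumr.
apply: eq_bigr => j _; rewrite [X in _ = _ * X]mxE [X in _ = X * _]mxE !real_coordE.
by rewrite mxvecE [X in _ * X * _]mxE [X in _ * (_ * X) = _]mxE mulrA [X in X * _]mulrC.
Qed.

Lemma sign_diag_sig : sig sign_diag = d%:Z * \sum_i (-1) ^+ s i.
Proof.
rewrite sig_diag sum_mxvec mulr_sumr; apply: eq_bigr => i _.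
rewrite (eq_bigr (fun=> (-1) ^+ s i)) => [|j _].
  by rewrite sumr_const card_ord -[d%:Z]natz mulr_natl.
by rewrite mxvecE mxE; case: (s i) => /=; rewrite ?expr1 ?expr0 ?sgzN sgz1.
Qed.

Lemma sign_diag_sym : sign_diag^T = sign_diag.
Proof. exact: tr_diag_mx. Qed.

Lemma sign_diag_unit : sign_diag \in unitmx.
Proof.
suff SS : sign_diag *m sign_diag = 1%:M by exact: (mulmx1_unit SS).1.
rewrite /sign_diag mulmx_diag -diag_const_mx; congr diag_mx; apply/rowP => l.
by case/mxvec_indexP: l => i j; rewrite !mxE !mxvecE !mxE -expr2 sqrr_sign.
Qed.

End RealCoordinates.

Lemma bilinear_mx (K : fieldType) m n (M M' : 'M[K]_(m, n)) :
  (forall (x : 'rV_m) (y : 'rV_n), (x *m M *m y^T) 0 0 = (x *m M' *m y^T) 0 0) -> M = M'.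
Proof.
move=> H; apply/matrixP => i j; have := H (delta_mx 0 i) (delta_mx 0 j).
by rewrite !trmx_delta -!rowE -!colE !mxE.
Qed.

(* Factor p over the algebraically closed field K[i] and transport the factorization along tau. *)
Lemma root_map_rcf (K : rcfType) (tau : {rmorphism K -> K}) (p : {poly K}) t :
  p != 0 -> root (map_poly tau p) t -> exists c, tau c = t.
Proof.
move=> p0 rt; pose ti (z : K[i]%C) : K[i]%C := (tau (complex.Re z) +i* tau (complex.Im z))%C.
have tiB : zmod_morphism ti by move=> [a b] [a' b']; rewrite /ti /= !rmorphB.
have tiM : monoid_morphism ti.
  split; first by rewrite /ti /= rmorph1 rmorph0.
  by move=> [a b] [a' b']; rewrite /ti /= rmorphB rmorphD !rmorphM.
pose pB := GRing.isZmodMorphism.Build _ _ ti tiB.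
pose pM := GRing.isMonoidMorphism.Build _ _ ti tiM.
pose T : {rmorphism K[i]%C -> K[i]%C} := HB.pack ti pB pM.
pose P := map_poly (real_complex K) p.
have [r PE] := closed_field_poly_normal P.
have TP : map_poly T P = map_poly (real_complex K) (map_poly tau p).
  rewrite -!map_poly_comp; apply: eq_map_poly => x /=.
  by rewrite /ti /= rmorph0.
have : root (map_poly T P) (t%:C)%C by rewrite TP fmorph_root.
rewrite PE map_polyZ rootZ; last by rewrite fmorph_eq0 lead_coef_eq0 map_poly_eq0.
rewrite rmorph_prod /= rootE horner_prod prodf_seq_eq0 => /hasP[z _] /=.
rewrite -rootE -[map_poly _ _]/(map_poly T _) map_polyXsubC root_XsubC.
move=> /eqP /(congr1 (@complex.Re K)) /= tz.
by exists (complex.Re z).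
Qed.

(** * The representation attached to a Morita equivalence *)

Section MoritaRep.
Variables (F : fieldType) (A : falgType F) (s : 'End(A)) (K : rcfType) (iota : {rmorphism F -> K}).
Hypothesis s_inv : involution s.
Local Notation AK := (scalext iota A).
Local Notation be i := ((vbasis {:A})`_i).
Variables (D : nzRingType) (th : D -> D) (d : nat).
Variables (inc : K -> D) (co : D -> 'rV[K]_d).
Hypothesis RD : real_division th inc co.
Variable N : hmorita_module (scalext_map s : AK -> AK) th false.
Variables (n : nat) (sg : 'I_n -> bool) (f : {linear N -> 'rV[D^c]_n}).
Hypothesis f_bij : bijective f.
Hypothesis fE : forall x y, hfun x y = \sum_i th (f x 0 i : D) * (-1) ^+ sg i * (f y 0 i : D).
Local Notation act z := (@mact _ _ _ _ _ N z).

Lemma act_ract z x u : act z (x *>: u) = act z x *>: u.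
Proof. exact: linearZ. Qed.

Lemma act_of (T : N -> N) : linear T -> exists z, act z =1 T.
Proof.
move=> Tl; pose Ta := GRing.isLinear.Build _ _ _ _ T Tl.
pose TL : {linear N -> N} := HB.pack T Ta.
exact: (mact_surj TL).
Qed.

Lemma coord_ract x u i : f (x *>: u) 0 i = (f x 0 i : D) * u.
Proof. by rewrite /ract linearZ mxE. Qed.

Lemma morita_rank_gt0 : (0 < n)%N.
Proof.
rewrite lt0n; apply/eqP => n0.
have x0 (x : N) : x = 0.
  by apply: (bij_inj f_bij); apply/rowP => i; have := ltn_ord i; rewrite {2}n0.
have [r [l [x /eqP]]] := mmod_generator N.
by rewrite big1 ?(eq_sym 0) ?oner_eq0 // => i _; rewrite [x i]x0 linear0.
Qed.

Lemma morita_vector : exists (e : N) (i0 : 'I_n), f e = delta_mx 0 i0.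
Proof.
have [g fK gK] := f_bij; pose i0 := Ordinal morita_rank_gt0.
by exists (g (delta_mx 0 i0)), i0; rewrite gK.
Qed.

(* Multiplication by c commutes with End_D(N) and is self-adjoint, so it is a symmetric
   central element of D. The field map tau need not be the identity. *)
Lemma scalar_act : exists tau : {rmorphism K -> K}, forall c x, act (c *: 1) x = x *>: inc (tau c).
Proof.
have [e [i0 fe]] := morita_vector.
have fe1 : (f e 0 i0 : D) = 1 by rewrite fe mxE !eqxx.
have feu u : (f (e *>: u) 0 i0 : D) = u by rewrite coord_ract fe1 mul1r.
have inc_eq x y : e *>: inc x = e *>: inc y -> x = y.
  by move=> xy; apply: (inc_injective RD); rewrite -[LHS]feu xy feu.
have hee : hfun e e = (-1) ^+ sg i0.
  rewrite fE (bigD1 i0) //= big1 => [|i ii0].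
    by rewrite fe1 (th1 RD) mul1r mulr1 addr0.
  by rewrite fe mxE (negPf ii0) andbF mulr0.
have H c : exists t, forall x, act (c *: 1) x = x *>: inc t.
  pose u : D := f (act (c *: 1) e) 0 i0.
  have actE y : act (c *: 1) y = y *>: u.
    (* This endomorphism sends [e] to [y], so commuting with all of them determines the action of
       [c] from its value at [e]. *)
    have [z zE] : exists z, act z =1 (fun x => y *>: (f x 0 i0 : D)).
      apply: act_of => a x x'; rewrite linearP !mxE.
      by rewrite /ract scalerDl scalerA.
    have : act (c *: 1) (act z e) = act z (act (c *: 1) e).
      by rewrite -!mactM -scalerAl -scalerAr mul1r mulr1.
    by rewrite !zE fe1 ract1.
  have uC b : b * u = u * b.
    have := act_ract (c *: 1) e b; rewrite !actE -!ractM => E1.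
    by rewrite -[LHS]feu E1 feu.
  have [x xE] : exists x, u = inc x.
    apply: (th_fix RD); have := mact_adj (c *: 1) e e.
    have [_ sM sK] := scalext_involution iota s_inv.
    have -> : scalext_map s (c *: 1 : AK) = c *: 1.
      rewrite linearZ; congr (_ *: _).
      by rewrite -[LHS]mulr1 -[X in _ * X]sK -sM mulr1 sK.
    rewrite !actE phiZl (phiZr RD) hee -sign_comm => /(congr1 ( *%R ((-1) ^+ sg i0))).
    by rewrite !mulrA -expr2 sqrr_sign !mul1r.
  by exists x => y; rewrite actE xE.
have [t tE] := choice H.
have tD a b : t (a + b) = t a + t b.
  by apply: inc_eq; rewrite -tE scalerDl mactD !tE (incD RD) ractDr.
have tB : zmod_morphism t.
  by move=> a b; apply: (addIr (t b)); rewrite -tD !subrK.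
have tM : monoid_morphism t.
  split=> [|a b]; apply: inc_eq; first by rewrite -tE scale1r mact1 (inc1 RD) ract1.
  have -> : inc (t a * t b) = inc (t a) * inc (t b) by exact: (incM RD).
  rewrite ractM -!tE -mactM; congr (act _ e).
  by rewrite -scalerAl mul1r scalerA mulrC.
pose tBm := GRing.isZmodMorphism.Build _ _ t tB.
pose tMm := GRing.isMonoidMorphism.Build _ _ t tM.
pose T : {rmorphism K -> K} := HB.pack t tBm tMm.
by exists T.
Qed.

Variable tau : {rmorphism K -> K}.
Hypothesis tauE : forall c x, act (c *: 1) x = x *>: inc (tau c).

Lemma actZ c z x : act (c *: z) x = act z x *>: inc (tau c).
Proof. by rewrite -[z in LHS]mul1r scalerAl mactM tauE. Qed.

Lemma act0 x : act 0 x = 0.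
Proof. by apply: (addrI (act 0 x)); rewrite -mactD !addr0. Qed.

Lemma act_sum (I : finType) (G : I -> AK) x : act (\sum_i G i) x = \sum_i act (G i) x.
Proof. by apply: (big_morph (fun z => act z x)) => [z w|]; [rewrite mactD | rewrite act0]. Qed.

(* The scalar t is the action of some z in A_K, and z is algebraic over K. *)
Lemma scalar_act_surj t : exists c, tau c = t.
Proof.
have [e [i0 fe]] := morita_vector.
have [z zE] : exists z, act z =1 (fun x => x *>: inc t).
  apply: act_of => a x x'; rewrite /ract scalerDr !scalerA; congr (_ *: _ + _).
  exact: (esym (incC RD _ _)).
have zX j x : act (z ^+ j) x = x *>: inc (t ^+ j).
  elim: j x => [|j IH] x; first by rewrite mact1 (inc1 RD) ract1.
  by rewrite !exprS mactM zE IH -ractM -(incM RD) mulrC.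
pose m := (\dim {:A}).+1.
pose M : 'M[K]_(m, \dim {:A}) := \matrix_j (z ^+ j : 'rV[K]__).
have : kermx M != 0.
  by rewrite kermx_eq0 /row_free neq_ltn ltnS rank_leq_col.
move=> /rowV0Pn[v /sub_kermxP vM v0].
apply: (@root_map_rcf _ _ (rVpoly v)).
  by apply: contraNneq v0 => v0; rewrite -[v]rVpolyK v0 linear0.
have vz : \sum_j v 0 j *: z ^+ j = 0.
  by rewrite -[RHS]vM mulmx_sum_row; apply: eq_bigr => j _; rewrite rowK.
apply/rootP; rewrite map_rVpoly (@horner_coef_wide _ m) ?size_poly //.
apply: (inc_injective RD); rewrite (inc0 RD).
have := act_sum (fun j => v 0 j *: z ^+ j) e; rewrite vz act0.
move/(congr1 (fun w => f w 0 i0 : D)); rewrite /= linear0 mxE linear_sum summxE => ->.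
have inc_sum (I : finType) (G : I -> K) : inc (\sum_i G i) = \sum_i inc (G i).
  by apply: (big_morph inc); [exact: (incD RD) | exact: (inc0 RD)].
rewrite inc_sum; apply: eq_bigr => j _.
by rewrite actZ zX -ractM coord_ract fe mxE !eqxx mul1r -(incM RD) coef_rVpoly_ord mxE mulrC.
Qed.

Hypothesis tau_surj : forall t, exists c, tau c = t.
Local Notation Phi := (real_coord co f).
Local Notation G := (sign_diag K d sg).
Variable Psi : 'rV[K]_(n * d) -> N.
Hypotheses (PhiK : cancel Phi Psi) (PsiK : cancel Psi Phi).

Definition morita_mx (z : AK) : 'M[K]_(n * d) := (lin1_mx (fun r => Phi (act z (Psi r))))^T.

Definition morita_rho (a : A) := morita_mx (tens1 iota a).

Lemma Psi_linear a x y : Psi (a *: x + y) = Psi x *>: inc a + Psi y.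
Proof.
apply: (can_inj PhiK); rewrite PsiK (real_coordD RD) (real_coordZ RD).
by rewrite !PsiK.
Qed.

Lemma morita_mxE z r : r *m (morita_mx z)^T = Phi (act z (Psi r)).
Proof.
pose g r := Phi (act z (Psi r)).
have gl : linear g.
  by move=> a x y; rewrite /g Psi_linear linearD act_ract (real_coordD RD) (real_coordZ RD).
pose ga := GRing.isLinear.Build _ _ _ _ g gl.
pose gL : {linear 'rV[K]_(n * d) -> 'rV[K]_(n * d)} := HB.pack g ga.
by rewrite trmxK (mul_rV_lin1 gL).
Qed.

Lemma eq_morita_mx z (M : 'M_(n * d)) :
  (forall r, Phi (act z (Psi r)) = r *m M^T) -> morita_mx z = M.
Proof.
move=> zM; apply: trmx_inj; apply/row_matrixP => i.
by rewrite !rowE morita_mxE zM.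
Qed.

Lemma morita_mxD z w : morita_mx (z + w) = morita_mx z + morita_mx w.
Proof.
apply: eq_morita_mx => r.
by rewrite mactD (real_coordD RD) linearD mulmxDr !morita_mxE.
Qed.

Lemma morita_mxM z w : morita_mx (z * w) = morita_mx z *m morita_mx w.
Proof.
apply: eq_morita_mx => r.
by rewrite mactM trmx_mul mulmxA !morita_mxE PhiK.
Qed.

Lemma morita_mx1 : morita_mx 1 = 1%:M.
Proof. by apply: eq_morita_mx => r; rewrite mact1 PsiK trmx1 mulmx1. Qed.

Lemma morita_mxZ c z : morita_mx (c *: z) = tau c *: morita_mx z.
Proof.
apply: eq_morita_mx => r.
by rewrite actZ (real_coordZ RD) linearZ -scalemxAr morita_mxE.
Qed.

Lemma morita_mx0 : morita_mx 0 = 0.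
Proof. by apply: (addrI (morita_mx 0)); rewrite -morita_mxD !addr0. Qed.

Lemma morita_mx_sum (I : finType) (w : I -> AK) :
  morita_mx (\sum_i w i) = \sum_i morita_mx (w i).
Proof. by apply: (big_morph morita_mx); [exact: morita_mxD | exact: morita_mx0]. Qed.

Lemma morita_mx_coord z : morita_mx z = \sum_i tau (crd z i) *: morita_rho (be i).
Proof.
rewrite [in LHS](scalext_basis z) morita_mx_sum.
by apply: eq_bigr => i _; rewrite morita_mxZ.
Qed.

Lemma morita_mx_eq0 z : morita_mx z = 0 -> z = 0.
Proof.
move=> z0; apply: (@mact_inj _ _ _ _ _ N) => x; rewrite -[x]PhiK.
apply: (can_inj PhiK); rewrite -morita_mxE z0 trmx0 mulmx0.
by apply: (addrI (Phi 0)); rewrite -(real_coordD RD) !addr0.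
Qed.

Lemma morita_form z x y :
  (x *m (G *m morita_mx z) *m y^T) 0 0 = (co 1 *m (co (hfun (Psi x) (act z (Psi y))))^T) 0 0.
Proof.
rewrite (real_coord_form RD fE) PsiK -morita_mxE trmx_mul trmxK.
by rewrite !mulmxA.
Qed.

Lemma morita_adj z : (morita_mx z)^T *m G = G *m morita_mx (scalext_map s z).
Proof.
apply: bilinear_mx => x y; rewrite morita_form -mact_adj (real_coord_form RD fE).
by rewrite PsiK -morita_mxE !mulmxA.
Qed.

(** The scalars of [F] act through [tau \o iota], another embedding into [K], which [finite_test]
    covers. *)
Lemma morita_hermrep : hermrep s (tau \o iota) morita_rho G.
Proof.
split.
- by move=> a b; rewrite /morita_rho rmorphD morita_mxD.
- by move=> a b; rewrite /morita_rho rmorphM morita_mxM.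
- by rewrite /morita_rho rmorph1 morita_mx1.
- by move=> c a; rewrite /morita_rho tens1Z morita_mxZ.
- by move=> a; rewrite /morita_rho morita_adj scalext_map_tens1.
- exact: sign_diag_sym.
- exact: sign_diag_unit.
(* Surjectivity of [tau] lifts the coefficients [k i] to an element of [AK], on which faithfulness
   of the action can be used. *)
move=> k k0 i; have [c cE] := choice (fun i => tau_surj (k i)).
pose z : AK := \row_i c i.
have zc j : crd z j = c j by rewrite /crd mxE.
have : morita_mx z = 0.
  by rewrite morita_mx_coord -[RHS]k0; apply: eq_bigr => j _; rewrite zc cE.
by move/morita_mx_eq0 => z0; rewrite -cE -zc z0 /crd mxE rmorph0.
Qed.

(* The signs of the diagonalization form an endomorphism of N, hence an element of A_K. *)
Lemma morita_definite : exists k : 'I_(\dim {:A}) -> K,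
  G *m (\sum_i k i *: morita_rho (be i)) = 1%:M *m (1%:M)^T.
Proof.
have [g fK gK] := f_bij.
have [z zE] : exists z, act z =1 (fun x => g (\row_i ((-1) ^+ sg i * (f x 0 i : D)))).
  apply: act_of => a x y; apply: (can_inj fK); rewrite [RHS]linearP !gK.
  apply/rowP => i; rewrite !mxE linearP !mxE mulrDr; congr (_ + _).
  exact: (mulrA ((-1) ^+ sg i : D) (f x 0 i : D) (a : D)).
exists (fun i => tau (crd z i)); rewrite -morita_mx_coord trmx1 mulmx1.
apply: bilinear_mx => x y; rewrite morita_form mulmx1 fE zE gK (co_sum RD) linear_sum.
rewrite mulmx_sumr summxE -[in RHS](PsiK x) -[in RHS](PsiK y) mxE sum_mxvec.
apply: eq_bigr => i _; rewrite -mulrA [X in _ * (_ * X)]mxE [X in co (_ * X)]mulrA -expr2 sqrr_sign mul1r.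
rewrite -(co_th RD) mxE; apply: eq_bigr => j _.
by rewrite [_^T _ _ in RHS]mxE !real_coordE mxE.
Qed.

Lemma morita_dim_gt0 : (0 < n * d)%N.
Proof.
rewrite muln_gt0 morita_rank_gt0 lt0n; apply/eqP => d0.
have := oner_neq0 D; apply/negP/negPn/eqP; apply: (bij_inj (co_bij RD)); apply/rowP => j.
by have := ltn_ord j; rewrite {2}d0.
Qed.

(** [z |-> act z e] maps [AK] onto [N], because some endomorphism of [N] sends [e] to any given
    vector. Only finitely many sizes therefore have to be tested. *)
Lemma morita_dim_le : (n * d <= \dim {:A})%N.
Proof.
have [e [i0 fe]] := morita_vector.
pose M : 'M[K]_(\dim {:A}, n * d) := \matrix_i Phi (act (tens1 iota (be i)) e).
suff : row_full M by rewrite /row_full => /eqP <-; exact: rank_leq_row.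
rewrite -sub1mx; apply/row_subP => l; set r := row l 1%:M.
have [z zE] : exists z, act z =1 (fun x => Psi r *>: (f x 0 i0 : D)).
  apply: act_of => a x x'; rewrite linearP !mxE.
  by rewrite /ract scalerDl scalerA.
have ez : act z e = Psi r by rewrite zE fe mxE !eqxx ract1.
apply/submxP; exists (\row_i tau (crd z i)).
rewrite -[LHS]PsiK -ez -[e in LHS]PhiK -morita_mxE morita_mx_coord linear_sum mulmx_sumr mulmx_sum_row.
apply: eq_bigr => i _; rewrite linearZ -scalemxAr mxE rowK; congr (_ *: _).
by rewrite morita_mxE PhiK.
Qed.

End MoritaRep.

(** * Signatures under a Morita equivalence *)

Section MoritaSign.
Variables (F : fieldType) (A : falgType F) (s : 'End(A)) (K : rcfType) (iota : {rmorphism F -> K}).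
Hypothesis s_inv : involution s.
Local Notation AK := (scalext iota A).
Local Notation be i := ((vbasis {:A})`_i).
Variables (D : nzRingType) (th : D -> D).
Variable M : morita_equiv (scalext_map s : AK -> AK) th false.
Variables (a : A) (Ua : a \is a GRing.unit) (Sa : s a = a).
Variable hK : hermform (scalext_map s : AK -> AK) false.
Hypothesis hKP : is_base_change (tens1 iota (A := A)) (diag1 s_inv Ua Sa) hK.
Local Notation act z := (@mact _ _ _ _ _ (mor_mod M) z).

(** [hK] is known only by its universal property: the map [x |-> e *>: l x] and the identity agree
    on the image of the universal map, hence everywhere, so the image [e] of 1 generates [hK]. *)
Lemma base_change_diag1 : exists (e : hK) (l : {linear hK -> (AK^c)^o}),
  (forall x, e *>: (l x : AK) = x) /\ hfun e e = tens1 iota a.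
Proof.
have [u [uD uZ uU uF]] := hKP.
pose one : diag1 s_inv Ua Sa := (1 : A).
have [l lE _] := uU (AK^c)^o (fun x => tens1 iota (x : A)) (rmorphD (tens1 iota (A := A)))
  (fun x b => rmorphM (tens1 iota (A := A)) (x : A) b).
have s11 : s 1 = 1.
  by have [_ sM sK] := s_inv; rewrite -[LHS]mulr1 -[X in _ * X]sK -sM mulr1 sK.
exists (u one), l; split; last first.
  by rewrite uF; congr (tens1 iota _); rewrite -[LHS]/(s 1 * a * 1) s11 mulr1 mul1r.
pose L (x : hK) := u one *>: (l x : AK).
have Ll : linear L.
  move=> b x y; rewrite /L linearP ractDr; congr (_ + _).
  exact: (ractM (u one) (l x : AK) b).
pose La := GRing.isLinear.Build _ _ _ _ L Ll.
pose LL : {linear hK -> hK} := HB.pack L La.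
have [g gE gU] := uU hK u uD uZ.
have Lu x : LL (u x) = u x.
  by rewrite /= /L lE -uZ; congr u; rewrite -[LHS]/((1 : A) * (x : A)) mul1r.
by move=> x; rewrite -[LHS]/(LL x) (gU LL Lu) -(gU idfun).
Qed.

(* The functor sends h to N with the form (x, y) |-> phi(x, a y), as h (x) K is generated by e. *)
Lemma morita_diag1 : exists g : mor_mod M -> M hK,
  [/\ {morph g : x y / x + y}, forall x u, g (x *>: u) = g x *>: u,
      forall y, exists x, g x = y
    & forall x y, hfun (g x) (g y) = hfun x (act (tens1 iota a) y)].
Proof.
have [e [l [el ee]]] := base_change_diag1.
pose t x n : M hK := @mor_tens _ _ _ _ _ M hK x n.
have [[tDl tDr tb tZ] tU] := mor_tensP M hK.
have fb : balanced (fun z => act z) (fun (x : hK) (n : mor_mod M) => act (l x : AK) n).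
  split=> [x x' n|x n n'|x b n|x n u].
  - by rewrite linearD mactD.
  - by rewrite linearD.
  - by rewrite -mactM /ract linearZ.
  - by rewrite /ract linearZ.
have [g gE _] := tU _ _ fb.
exists (t e); split.
- by move=> x y; exact: tDr.
- by move=> x u; exact: tZ.
- move=> y; exists (g y); pose T (y : M hK) := t e (g y).
  have Tl : linear T by move=> b x z; rewrite /T linearP /t tDr; congr (_ + _); exact: tZ.
  pose Ta := GRing.isLinear.Build _ _ _ _ T Tl.
  pose TL : {linear M hK -> M hK} := HB.pack T Ta.
  have bal : balanced (fun z => act z) t by [].
  have [g' g'E g'U] := tU _ _ bal.
  have Tt x n : TL (t x n) = t x n by rewrite /= /T /t gE -tb el.
  by rewrite -[LHS]/(TL y) (g'U TL Tt) -(g'U idfun).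
by move=> x y; rewrite mor_form ee.
Qed.

Variables (d : nat) (inc : K -> D) (co : D -> 'rV[K]_d).
Hypothesis RD : real_division th inc co.
Variables (n : nat) (sg : 'I_n -> bool) (f : {linear mor_mod M -> 'rV[D^c]_n}).
Hypothesis f_bij : bijective f.
Hypothesis fE : forall x y, hfun x y = \sum_i th (f x 0 i : D) * (-1) ^+ sg i * (f y 0 i : D).
Variable Psi : 'rV[K]_(n * d) -> mor_mod M.
Hypotheses (PhiK : cancel (real_coord co f) Psi) (PsiK : cancel Psi (real_coord co f)).

(** The map [g] of [morita_diag1] is an isometry onto in real coordinates, where the signature is
    [d] times that over [D]; injectivity of [g] is dispensed with by [sig_congr_surj]. *)
Lemma morita_sign n' (sg' : 'I_n' -> bool) (f' : {linear M hK -> 'rV[D^c]_n'}) :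
  bijective f' ->
  (forall x y, hfun x y = \sum_i th (f' x 0 i : D) * (-1) ^+ sg' i * (f' y 0 i : D)) ->
  sig (sign_diag K d sg *m morita_rho co f Psi a) = d%:Z * \sum_i (-1) ^+ sg' i.
Proof.
move=> f'_bij f'E; have [g [gD gZ gS gF]] := morita_diag1.
pose L r := real_coord co f' (g (Psi r)).
have Ll : linear L.
  move=> c x y; rewrite /L (Psi_linear RD PhiK PsiK) gD gZ.
  by rewrite (real_coordD RD) (real_coordZ RD).
pose La := GRing.isLinear.Build _ _ _ _ L Ll.
pose LL : {linear 'rV[K]_(n * d) -> 'rV[K]_(n' * d)} := HB.pack L La.
rewrite -(sign_diag_sig K d sg') -(@sig_congr_surj _ _ _ _ (lin1_mx LL)).
  congr sig; apply: bilinear_mx => x y; rewrite (morita_form RD) // -gF.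
  rewrite (real_coord_form RD f'E) !mulmxA.
  by rewrite -[_ *m _ *m y^T]mulmxA -trmx_mul !mul_rV_lin1.
rewrite -sub1mx; apply/row_subP => i; apply/submxP.
have [Psi' PhiK' PsiK'] := real_coord_bij RD f'_bij.
have [x xE] := gS (Psi' (row i 1%:M)).
exists (real_coord co f x); rewrite mul_rV_lin1 /= /L PhiK xE.
by rewrite PsiK'.
Qed.

End MoritaSign.

(** The element [a] is found from the equivalence alone. The conclusion covers every base change and
    every diagonalization because [ext_form] and [sign] are defined by choice. *)
Lemma morita_finite_test (F : fieldType) (A : falgType F) (s : 'End(A)) (K : rcfType)
    (iota : {rmorphism F -> K}) (s_inv : involution s) (D : nzRingType) (th : D -> D) (d : nat)
    (inc : K -> D) (co : D -> 'rV[K]_d) (RD : real_division th inc co)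
    (M : morita_equiv (scalext_map s : scalext iota A -> scalext iota A) th false)
    (L : nat -> seq A) :
  (forall m, (0 < m)%N -> forall (iota' : {rmorphism F -> K}) (rho : A -> 'M[K]_m)
     (G : 'M[K]_m) (k : 'I_(\dim {:A}) -> K) (C : 'M[K]_m),
     hermrep s iota' rho G -> C \in unitmx ->
     G *m (\sum_i k i *: rho (vbasis {:A})`_i) = C *m C^T ->
     exists2 a, a \in L m & sig (G *m rho a) <> 0) ->
  exists m a, [/\ (m <= \dim {:A})%N, a \in L m &
    forall (Ua : a \is a GRing.unit) (Sa : s a = a)
      (hK : hermform (scalext_map s : scalext iota A -> scalext iota A) false),
    is_base_change (tens1 iota (A := A)) (diag1 s_inv Ua Sa) hK ->
    forall n (sg : 'I_n -> bool) (f : {linear M hK -> 'rV[D^c]_n}), bijective f ->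
    (forall x y, hfun x y = \sum_i th (f x 0 i : D) * (-1) ^+ sg i * (f y 0 i : D)) ->
    \sum_i (-1) ^+ sg i != 0 :> int].
Proof.
move=> LP; have [n [sg [f [f_bij fE]]]] := herm_diagonal RD (mor_mod M).
have [Psi PhiK PsiK] := real_coord_bij RD f_bij.
have [tau tauE] := scalar_act s_inv RD f_bij fE.
have tauS := scalar_act_surj RD f_bij tauE.
have pt := morita_hermrep RD fE tauE tauS PhiK PsiK.
have [k kE] := morita_definite RD f_bij fE tauE PhiK PsiK.
have [a aL a0] := LP _ (morita_dim_gt0 RD f_bij) _ _ _ k 1%:M pt (unitmx1 _ _) kE.
exists (n * d)%N, a; split=> //; first exact: (morita_dim_le RD f_bij tauE PhiK PsiK).
move=> Ua Sa hK hKP n' sg' f' f'_bij f'E; apply: contra_notN a0 => /eqP sum0.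
by rewrite (morita_sign hKP RD fE PhiK PsiK f'_bij f'E) sum0 mulr0.
Qed.

Lemma Dinv_division (K : rcfType) (k : dkind) : k <> DSplit ->
  exists d (inc : K -> Drg K k) (co : Drg K k -> 'rV[K]_d), real_division (@Dinv K k) inc co.
Proof.
case: k => // _; do 3!eexists.
- exact: real_division_real.
- exact: real_division_quat.
exact: real_division_cplx.
Qed.

Lemma signE (K : rcfType) (k : dkind) (h : hermform (@Dinv K k) false) : k <> DSplit ->
  sign h = xget 0 [set z : int | exists n (s : 'I_n -> bool),
    diagonalizes h s /\ z = \sum_i (-1) ^+ s i]%classic.
Proof. by case: k h. Qed.

(** [sign] has default value 0, so a diagonalization must be known to exist before the hypothesis
    applies. *)
Lemma sign_neq0 (K : rcfType) (k : dkind) (h : hermform (@Dinv K k) false) : k <> DSplit ->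
  (forall n (s : 'I_n -> bool), diagonalizes h s -> \sum_i (-1) ^+ s i != 0 :> int) ->
  sign h <> 0.
Proof.
move=> kS nz; have [d [inc [co RD]]] := Dinv_division K kS.
have [n [s [f [f_bij fE]]]] := herm_diagonal RD h.
pose Z := [set z : int | exists n (s : 'I_n -> bool),
  diagonalizes h s /\ z = \sum_i (-1) ^+ s i]%classic.
have [n' [s' [/nz + zE]]] : Z (xget 0 Z).
  by apply: (@xgetPex _ 0 Z); exists (\sum_i (-1) ^+ s i), n, s; split=> //; exists f.
by rewrite signE // -/Z zE => /eqP.
Qed.

Theorem theorem6p4 (F : fieldType) (F_real : formally_real F) (A : algInvol F) :
  exists (s : nat) (H : 'I_s -> hermform (ainv A) false),
    (forall i, is_diag1 (H i)) /\
    forall P : set F, ordering P -> ~ NilOrd A P ->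
    forall (K : rcfType) (iota : {rmorphism F -> K}), real_closure P iota ->
    forall k : dkind, Dkind A P iota k ->
    forall M : morita_equiv (@extinv F A K iota) (@Dinv K k) (epsP A k),
    exists i : 'I_s, msign M (H i) <> 0.
Proof.
have L_exists m : exists l : seq A, (forall a, a \in l -> ainv A a = a /\ a \is a GRing.unit) /\
    ((0 < m)%N -> forall (K : rcfType) (iota : {rmorphism F -> K}) (rho : A -> 'M[K]_m)
     (G : 'M[K]_m) (k : 'I_(\dim {:A}) -> K) (C : 'M[K]_m),
     hermrep (ainv A) iota rho G -> C \in unitmx ->
     G *m (\sum_i k i *: rho (vbasis {:A})`_i) = C *m C^T ->
     exists2 a, a \in l & sig (G *m rho a) <> 0).
  case: m => [|m]; first by exists [::].
  have [l [l1 l2]] := finite_test (@ainvM _ A) (@ainvK _ A) (ltn0Sn m).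
  by exists l.
have [L LP] := choice L_exists.
(* The representations that arise have size at most [\dim {:A}], by [morita_dim_le]. *)
pose l := flatten [seq L m | m <- seq.iota 0 (\dim {:A}).+1].
have lP (i : 'I_(size l)) : ainv A (nth 0 l i) = nth 0 l i /\ nth 0 l i \is a GRing.unit.
  have /flattenP[l' /mapP[m _ ->]] := mem_nth 0 (ltn_ord i).
  exact: (LP m).1.
exists (size l), (fun i => diag1 (ainv_involution A) (lP i).2 (lP i).1); split.
  by move=> i; exists (nth 0 l i), (lP i).2, (lP i).1.
move=> P oP nP K iota rcP k Pk M.
have kS : k <> DSplit.
  by move=> kS; apply: nP; split=> //; exists K, iota, k; split=> //; constructor 3.
(* The sign -1 occurs exactly in the first two cases of [NilOrd]. *)
have e0 : epsP A k = false.
  apply: contra_notF nP => /asboolP kP; split=> //; exists K, iota, k; split=> //.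
  by case: kP; [constructor 1 | constructor 2].
(* The type of [M] depends on [epsP A k], which is only provably equal to [false]; the claim is
   generalized over this sign so that it can be substituted. *)
suff : forall e (M : morita_equiv (@extinv F A K iota) (@Dinv K k) e), e = false ->
    exists i : 'I_(size l),
      sign (M (ext_form iota (diag1 (ainv_involution A) (lP i).2 (lP i).1))) <> 0.
  exact.
move=> {M e0} e M e0; subst e.
have [d [inc [co RD]]] := Dinv_division K kS.
have [m [a [md aL aP]]] := morita_finite_test (ainv_involution A) RD M
  (fun m m0 => (LP m).2 m0 K).
have al : a \in l.
  by apply/flattenP; exists (L m) => //; apply: map_f; rewrite mem_iota ltnS.
pose i : 'I_(size l) := Ordinal (etrans (index_mem a l) al).
have ai : nth 0 l i = a by rewrite nth_index.
exists i; apply: sign_neq0 => // n s [f f_bij fE].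
(* The type of [f] depends on the proofs about [nth 0 l i], so all are generalized before that
   element is replaced by [a]. *)
move: (lP i).2 (lP i).1 f f_bij fE; rewrite ai => Ua Sa f f_bij fE.
exact: (aP Ua Sa _ (ext_formP iota _) n s f f_bij fE).
Qed.
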